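(* Let $p:\mathbb C^n\to\mathbb R$ be a plurisubharmonic function such that (a) $p^*(w):=\sup\{\operatorname{Re}\langle z,w\rangle-p(z): z\in\mathbb C^n\}<\infty$ for every $w\in\mathbb C^n$, and (b) $\lim_{|z|\to\infty}\tilde p(z)/p(z)=1$, where $\tilde p(z)=\sup\{p(z+\zeta):|\zeta|\le1\}$. Then for each $\sigma>0$ there exists $\tau$ with $0<\tau<\sigma$ such that the canonical solution operator $$S_1:A^2_{(0,1)}(\mathbb C^n,\tau p)\to L^2(\mathbb C^n,\sigma p)$$ to $\overline\partial$ is a Hilbert–Schmidt operator.
   Context: $\langle z,w\rangle=\sum_j z_j\overline w_j$ and $d\lambda$ is Lebesgue measure on $\mathbb C^n$. For $\sigma>0$, $L^2(\mathbb C^n,\sigma p)$ is the space of measurable $u$ with $\int_{\mathbb C^n}|u(z)|^2e^{-2\sigma p(z)}d\lambda(z)<\infty$, and $A^2(\mathbb C^n,\sigma p)$ is its closed subspace of entire functions. $A^2_{(0,1)}(\mathbb C^n,\tau p)$ is the Hilbert space of $(0,1)$-forms $f=\sum_{j=1}^n f_j\,d\overline z_j$ with all $f_j\in A^2(\mathbb C^n,\tau p)$, with norm $\|f\|^2=\sum_j\int|f_j|^2e^{-2\tau p}d\lambda$ (such forms are $\overline\partial$-closed). The canonical solution operator $S_1$ assigns to such $f$ the unique $u\in L^2(\mathbb C^n,\sigma p)$ with $\overline\partial u=f$ and $u\perp A^2(\mathbb C^n,\sigma p)$ in $L^2(\mathbb C^n,\sigma p)$. *)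

(* Defs.v *)
From mathcomp Require Import all_boot all_order all_algebra.
From mathcomp Require Import all_classical all_reals all_analysis.
From mathcomp Require Import complex.

Set Implicit Arguments.
Unset Strict Implicit.
Unset Printing Implicit Defensive.

Import Order.TTheory GRing.Theory Num.Theory.
Import numFieldNormedType.Exports.

Local Open Scope classical_set_scope.
Local Open Scope ring_scope.

(* C^n in real coordinates: a point z is a 2 x n real matrix, with     *)
(*   z ord0 j = x_j = Re z_j   and   z ord_max j = y_j = Im z_j.        *)
(* Its topology / normed structure is the one of 'M[R]_(2,n) (all norms *)
(* on R^(2n) being equivalent this is the usual topology of C^n).      *)
Definition Cn (R : realType) (n : nat) := 'M[R]_(2, n).

Definition zcoord (R : realType) (n : nat) (z : Cn R n) (j : 'I_n) : R[i] :=
  Complex (z ord0 j) (z ord_max j).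

Definition enorm (R : realType) (n : nat) (z : Cn R n) : R :=
  Num.sqrt (\sum_(i < 2) \sum_(j < n) z i j ^+ 2).

Definition re_inner (R : realType) (n : nat) (z w : Cn R n) : R :=
  \sum_(j < n) (z ord0 j * w ord0 j + z ord_max j * w ord_max j).

(* multiplication of a vector b of C^n by the scalar e^{i t} *)
Definition rotC (R : realType) (n : nat) (t : R) (b : Cn R n) : Cn R n :=
  \matrix_(i < 2, j < n)
    (if i == ord0 then cos t * b ord0 j - sin t * b ord_max j
     else sin t * b ord0 j + cos t * b ord_max j).

Definition upper_semicontinuous (R : realType) (n : nat) (p : Cn R n -> R) : Prop :=
  forall (a : Cn R n) (eps : R), 0 < eps -> \forall z \near a, p z < p a + eps.

Definition plurisubharmonic (R : realType) (n : nat) (p : Cn R n -> R) : Prop :=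
  upper_semicontinuous p /\
  forall a b : Cn R n,
    ((p a)%:E <= ((2 * pi)^-1)%:E *
       \int[@lebesgue_measure R]_(t in `[0%R, (2 * pi)%R]) (p (a + rotC t b))%:E)%E.

Definition ptilde (R : realType) (n : nat) (p : Cn R n -> R) (z : Cn R n) : R :=
  sup [set p (z + zeta) | zeta in [set zeta : Cn R n | enorm zeta <= 1]].

Definition pd (R : realType) (n : nat) (g : Cn R n -> R) (d : 'I_2 * 'I_n)
  : Cn R n -> R := fun z => 'D_(delta_mx d.1 d.2) g z.

Fixpoint dpart (R : realType) (n : nat) (l : seq ('I_2 * 'I_n)) (g : Cn R n -> R)
  : Cn R n -> R :=
  if l is d :: l' then pd (dpart l' g) d else g.

Definition smooth (R : realType) (n : nat) (g : Cn R n -> R) : Prop :=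
  forall l : seq ('I_2 * 'I_n),
    continuous (dpart l g) /\
    forall (z : Cn R n) (d : 'I_2 * 'I_n), derivable (dpart l g) z (delta_mx d.1 d.2).

Definition test_function (R : realType) (n : nat) (phi : Cn R n -> R[i]) : Prop :=
  smooth (fun z => complex.Re (phi z)) /\ smooth (fun z => complex.Im (phi z)) /\
  exists M : R, forall z, M < enorm z -> phi z = 0.

Definition dxC (R : realType) (n : nat) (phi : Cn R n -> R[i]) (d : 'I_2 * 'I_n)
  (z : Cn R n) : R[i] :=
  Complex (pd (fun w => complex.Re (phi w)) d z) (pd (fun w => complex.Im (phi w)) d z).

Definition dzbar (R : realType) (n : nat) (phi : Cn R n -> R[i]) (j : 'I_n)
  (z : Cn R n) : R[i] :=
  (dxC phi (ord0, j) z + Complex 0 1 * dxC phi (ord_max, j) z) / 2%:R.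

(* Lebesgue measure / integral on C^n = R^(2n), as iterated integrals   *)
(* of Lebesgue measure on R (Tonelli/Fubini).                           *)
Fixpoint iint (R : realType) (k : nat) (F : (nat -> R) -> (nat -> R) -> \bar R)
  : \bar R :=
  match k with
  | 0 => F (fun _ => 0) (fun _ => 0)
  | k'.+1 =>
      (\int[@lebesgue_measure R]_x \int[@lebesgue_measure R]_y
         iint k' (fun a b => F (fun i => if i == k' then x else a i)
                               (fun i => if i == k' then y else b i)))%E
  end.

(* integral over C^n with respect to d lambda of a nonnegative function *)
Definition integral_Cn (R : realType) (n : nat) (F : Cn R n -> \bar R) : \bar R :=
  iint n (fun a b => F (\matrix_(i < 2, j < n) (if i == ord0 then a j else b j))).

Definition rintegral_Cn (R : realType) (n : nat) (g : Cn R n -> R) : R :=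
  fine (integral_Cn (fun z => (Num.max (g z) 0)%:E)) -
  fine (integral_Cn (fun z => (Num.max (- g z) 0)%:E)).

Definition cintegral_Cn (R : realType) (n : nat) (h : Cn R n -> R[i]) : R[i] :=
  Complex (rintegral_Cn (fun z => complex.Re (h z))) (rintegral_Cn (fun z => complex.Im (h z))).

Definition borel_fun (R : realType) (n : nat) (g : Cn R n -> R) : Prop :=
  forall A : set R, measurable A -> <<s @open (Cn R n) >> (g @^-1` A).

Definition abs2 (R : realType) (c : R[i]) : R := complex.Re c ^+ 2 + complex.Im c ^+ 2.

Definition weight (R : realType) (n : nat) (p : Cn R n -> R) (s : R) (z : Cn R n) : R :=
  expR (- (2 * s * p z)).

Definition normsq (R : realType) (n : nat) (p : Cn R n -> R) (s : R)
  (u : Cn R n -> R[i]) : \bar R :=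
  integral_Cn (fun z => (abs2 (u z) * weight p s z)%:E).

Definition inL2 (R : realType) (n : nat) (p : Cn R n -> R) (s : R)
  (u : Cn R n -> R[i]) : Prop :=
  borel_fun (fun z => complex.Re (u z)) /\ borel_fun (fun z => complex.Im (u z)) /\
  (normsq p s u < +oo)%E.

Definition inner (R : realType) (n : nat) (p : Cn R n -> R) (s : R)
  (u v : Cn R n -> R[i]) : R[i] :=
  cintegral_Cn (fun z => u z * conjc (v z) * Complex (weight p s z) 0).

Definition entire (R : realType) (n : nat) (h : Cn R n -> R[i]) : Prop :=
  (forall z, differentiable (fun w => complex.Re (h w)) z /\
             differentiable (fun w => complex.Im (h w)) z) /\
  forall z (j : 'I_n),
    pd (fun w => complex.Re (h w)) (ord0, j) z = pd (fun w => complex.Im (h w)) (ord_max, j) z /\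
    pd (fun w => complex.Re (h w)) (ord_max, j) z = - pd (fun w => complex.Im (h w)) (ord0, j) z.

Definition inA2 (R : realType) (n : nat) (p : Cn R n -> R) (s : R)
  (h : Cn R n -> R[i]) : Prop :=
  entire h /\ inL2 p s h.

(* (0,1)-forms f = sum_j f_j dzbar_j, represented by their coefficients *)
Definition form01 (R : realType) (n : nat) := 'I_n -> Cn R n -> R[i].

Definition inA2form (R : realType) (n : nat) (p : Cn R n -> R) (s : R)
  (f : form01 R n) : Prop :=
  forall j, inA2 p s (f j).

Definition inner_form (R : realType) (n : nat) (p : Cn R n -> R) (s : R)
  (f g : form01 R n) : R[i] :=
  \sum_(j < n) inner p s (f j) (g j).

Definition dbar_weak (R : realType) (n : nat) (u : Cn R n -> R[i]) (f : form01 R n)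
  : Prop :=
  forall (j : 'I_n) (phi : Cn R n -> R[i]), test_function phi ->
    cintegral_Cn (fun z => u z * dzbar phi j z) = - cintegral_Cn (fun z => f j z * phi z).

Definition canonical_solution_operator (R : realType) (n : nat) (p : Cn R n -> R)
  (tau sigma : R) (S : form01 R n -> (Cn R n -> R[i])) : Prop :=
  forall f, inA2form p tau f ->
    [/\ inL2 p sigma (S f), dbar_weak (S f) f &
        forall h, inA2 p sigma h -> inner p sigma (S f) h = 0].

Definition hilbert_schmidt (R : realType) (n : nat) (p : Cn R n -> R)
  (tau sigma : R) (S : form01 R n -> (Cn R n -> R[i])) : Prop :=
  exists (I : choiceType) (e : I -> form01 R n),
    [/\ forall i, inA2form p tau (e i),
        forall i k, inner_form p tau (e i) (e k) = (if i == k then 1 else 0),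
        forall g, inA2form p tau g ->
          (forall i, inner_form p tau g (e i) = 0) -> forall j z, g j z = 0 &
        (\esum_(i in [set: I]) normsq p sigma (S (e i)) < +oo)%E].

(* Main.v *)
(* Take [tau = sigma / 2].  Averaging Cauchy's formula over polydisc-like boxes of
   diameter at most 1 gives, for [f] in A^2(tau p), the pointwise bound
     |f(z)|^2 <= C exp(2 tau ptilde(z)) ||f||^2,
   and testing it on a combination of an orthonormal family [e_i] yields
     sum_i |e_i(z)|^2 <= C' exp(2 tau ptilde(z)).
   A form [f] with entire coefficients has the explicit primitive
   [u_0 = sum_j conj(z_j) f_j]; the canonical solution is [u_0] minus its
   orthogonal projection on A^2(sigma p), so its norm is at most that of [u_0].
   Hence sum_i ||S e_i||^2 is at most a constant times
     int |z|^2 exp(2 tau ptilde - 2 sigma p).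
   By (b) the exponent is at most [- sigma p / 2] far out, and by (a), applied to
   finitely many [w], [p] grows at least linearly, so this integral converges. *)
Require Import Defs.
From HB Require Import structures.
From mathcomp Require Import all_boot all_order all_algebra.
From mathcomp Require Import all_classical all_reals all_analysis.
From mathcomp Require Import complex.
From mathcomp Require Import measurable_realfun ring lra zify.
Set Implicit Arguments.
Unset Strict Implicit.
Unset Printing Implicit Defensive.
Import Order.TTheory GRing.Theory Num.Theory.
Import numFieldNormedType.Exports.
Local Open Scope classical_set_scope.
Local Open Scope ring_scope.

(** * Lebesgue measure on C^n *)

(** Here [entire] means real differentiable with the Cauchy-Riemann equations, and integrals over
    C^n are iterated. Cauchy's theory is therefore built on rectangles, one variable at a time, with
    Goursat's bisection standing in for continuity of the derivatives; a crude lower bound on the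
    contour integral replaces its value 2 pi. The primitive works because each [f_l] is entire, so
    that dbar(conj(z_l) f_l) = f_l d conj(z_l). The decay estimate that bounds the final sum also
    places it in L^2(sigma p). Subtracting the projection must not disturb dbar. Integration against
    a compactly supported function is an inner product with an element of L^2(sigma p), since upper
    semicontinuity bounds exp(2 sigma p) on compact sets; so everything in the closure of A^2(sigma
    p) inherits the vanishing that holds on A^2(sigma p). The Hilbert space geometry is real: the
    complex inner product is recovered from its real part by multiplying with i. The orthonormal set
    comes from Zorn's lemma, and the sum over it is a supremum over finite families, so that
    Bessel's inequality for finite families suffices. *)

Definition BCn (R : realType) (n : nat) := g_sigma_algebraType (@open (Cn R n)).

(** An open set is the union of the countably many sup-norm balls with rational centre and radius
    [m.+1%:R^-1] that it contains, and the preimage of such a ball is a finite intersection of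
    conditions on coordinates. *)
Lemma measurable_fun_Cn (R : realType) (n : nat) d (Y : measurableType d)
    (f : Y -> Cn R n) :
  (forall i j, measurable_fun setT (fun y => f y i j)) ->
  measurable_fun setT (f : Y -> BCn R n).
Proof.
move=> mf; apply: (@measurability _ _ Y (BCn R n) setT f (@open (Cn R n)) erefl).
move=> _ [U oU <-]; rewrite setTI.
pose B (qm : 'M[rat]_(2, n) * nat) : set (Cn R n) :=
  [set z | forall i j, `|ratr (qm.1 i j) - z i j| < qm.2.+1%:R^-1].
have -> : f @^-1` U =
    \bigcup_(qm in [set qm | B qm `<=` U]) (f @^-1` (B qm)).
  apply/seteqP; split => [y /= Uy|y [qm BU /BU]//].
  have /nbhs_ballP[e /= e0 eU] := open_nbhs_nbhs (conj oU Uy).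
  have [m me] : exists m : nat, m.+1%:R^-1 < e / 2.
    have [m _ /(_ m (leqnn m)) me] := near_infty_natSinv_lt (PosNum (divr_gt0 e0 (@ltr0n R 2))).
    by exists m.
  have ex i j : exists q : rat, `|ratr q - f y i j| < m.+1%:R^-1.
    have /rat_in_itvoo[q] : f y i j - m.+1%:R^-1 < f y i j + m.+1%:R^-1.
      by rewrite ltrD2l gtrN// invr_gt0.
    by rewrite in_itv/= => qP; exists q; rewrite ltr_distl.
  pose q : 'M[rat]_(2, n) := \matrix_(i, j) projT1 (cid (ex i j)).
  have qP i j : `|ratr (q i j) - f y i j| < m.+1%:R^-1.
    by rewrite mxE; case: cid.
  exists (q, m) => //= z Bz; apply: eU; split => // i j.
  rewrite /ball/= (le_lt_trans (ler_distD (ratr (q i j)) _ _))//.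
  rewrite [e]splitr ltrD//; last exact: lt_trans (Bz i j) _.
  by rewrite distrC (lt_trans (qP i j)).
rewrite bigcup_mkcond; apply: countable_bigcupT_measurable => // -[q m].
case: ifP => // _.
rewrite (_ : f @^-1` _ = \bigcap_(i in [set: 'I_2]) \bigcap_(j in [set: 'I_n])
   ((fun y => `|ratr (q i j) - f y i j|) @^-1` `]-oo, m.+1%:R^-1[)); last first.
  apply/seteqP; split => [y /= By i _ j _ /=|y /= By i j].
    by rewrite in_itv/=; apply: By.
  by have := By i I j I; rewrite /= in_itv/=.
apply: fin_bigcap_measurable => // i _.
apply: fin_bigcap_measurable => // j _.
rewrite -[X in measurable X]setTI.
have : measurable_fun setT (fun y => `|ratr (q i j) - f y i j|).
  apply: measurableT_comp => //; apply: measurable_funB => //; exact: mf.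
by apply => //; exact: measurable_itv.
Qed.

Lemma borel_funP (R : realType) (n : nat) (g : Cn R n -> R) :
  borel_fun g <-> measurable_fun setT (g : BCn R n -> R).
Proof.
split=> [bg _ A mA|mg A mA]; first by rewrite setTI; exact: bg.
by rewrite -[_ @^-1` _]setTI; apply: mg.
Qed.

Lemma continuous_borel (R : realType) (n : nat) (g : Cn R n -> R) :
  continuous g -> measurable_fun setT (g : BCn R n -> R).
Proof.
move=> /continuousP cg.
apply: (@measurability _ _ (BCn R n) R setT g _ (RGenOpens.measurableE R)).
move=> _ [_ [a [b ->] <-]]; rewrite setTI; apply: sub_gen_smallest.
by apply: cg; exact: interval_open.
Qed.

(** No sigma-algebra is put on sequences: measurability is tested along every measurable family of
    pairs of sequences. The condition thus survives fixing or substituting coordinates. *)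
Definition measurable_seqfun (R : realType) (F : (nat -> R) -> (nat -> R) -> \bar R) :=
  forall d (Y : measurableType d) (a b : Y -> nat -> R),
    (forall i, measurable_fun setT (a^~ i)) ->
    (forall i, measurable_fun setT (b^~ i)) ->
    measurable_fun setT (fun y => F (a y) (b y)).

Definition upd (R : realType) (k : nat) (x : R) (a : nat -> R) : nat -> R :=
  fun i => if i == k then x else a i.

Lemma measurable_upd (R : realType) d (Y : measurableType d) (k : nat)
    (x : Y -> R) (a : Y -> nat -> R) :
  measurable_fun setT x -> (forall i, measurable_fun setT (a^~ i)) ->
  forall i, measurable_fun setT (fun y => upd k (x y) (a y) i).
Proof. by move=> mx ma i; rewrite /upd; case: eqP. Qed.

Lemma measurable_seqfun_upd (R : realType) (F : (nat -> R) -> (nat -> R) -> \bar R)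
    (k : nat) (x y : R) :
  measurable_seqfun F -> measurable_seqfun (fun a b => F (upd k x a) (upd k y b)).
Proof. by move=> mF d Y a b ma mb; apply: mF; apply: measurable_upd. Qed.

(* The library's product measure loses its sigma-finiteness instance (it is
   shadowed by the one for products of subprobabilities), hence this alias. *)
Definition sfprod d1 d2 (T1 : measurableType d1) (T2 : measurableType d2)
    (R : realType) (m1 : {sigma_finite_measure set T1 -> \bar R})
    (m2 : {sigma_finite_measure set T2 -> \bar R}) : set (T1 * T2) -> \bar R :=
  (m1 \x m2)%E.

HB.instance Definition _ d1 d2 (T1 : measurableType d1) (T2 : measurableType d2)
    (R : realType) (m1 : {sigma_finite_measure set T1 -> \bar R})
    (m2 : {sigma_finite_measure set T2 -> \bar R}) :=
  Measure.copy (sfprod m1 m2) (m1 \x m2)%E.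

Lemma sfprod_sigma_finite d1 d2 (T1 : measurableType d1) (T2 : measurableType d2)
    (R : realType) (m1 : {sigma_finite_measure set T1 -> \bar R})
    (m2 : {sigma_finite_measure set T2 -> \bar R}) :
  sigma_finite setT (sfprod m1 m2).
Proof.
have /sigma_finiteP[F [FT ndF Foo]] := sigma_finiteT m1.
have /sigma_finiteP[G [GT ndG Goo]] := sigma_finiteT m2.
exists (fun n => F n `*` G n) => [|n].
  apply/seteqP; split => // -[x y] _.
  have [[i _ Fx] [k _ Gy]] : (\bigcup_i F i) x /\ (\bigcup_i G i) y.
    by rewrite -FT -GT.
  exists (maxn i k) => //; split => /=.
    by move: x Fx; apply/subsetPset/ndF/leq_maxl.
  by move: y Gy; apply/subsetPset/ndG/leq_maxr.
have [[mF Fn] [mG Gn]] := (Foo n, Goo n); split; first exact: measurableX.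
by rewrite /sfprod product_measure1E// lte_mul_pinfty// ge0_fin_numE.
Qed.

HB.instance Definition _ d1 d2 (T1 : measurableType d1) (T2 : measurableType d2)
    (R : realType) (m1 : {sigma_finite_measure set T1 -> \bar R})
    (m2 : {sigma_finite_measure set T2 -> \bar R}) :=
  Measure_isSigmaFinite.Build _ _ _ (sfprod m1 m2) (@sfprod_sigma_finite _ _ _ _ _ m1 m2).

Local Notation leb := (@lebesgue_measure _).

Section iterated.
Variable R : realType.
Local Notation LR := (measurableTypeR R).
Local Open Scope ereal_scope.

Lemma tonelli3 d (Y : measurableType d) (m : {sigma_finite_measure set Y -> \bar R})
    (f : LR * (LR * Y) -> \bar R) :
  measurable_fun setT f -> (forall p, 0 <= f p) ->
  \int[sfprod leb (sfprod leb m)]_p f p = \int[leb]_x \int[leb]_y \int[m]_w f (x, (y, w)).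
Proof.
move=> mf f0; rewrite fubini_tonelli1//=; apply: eq_integral => x _.
rewrite /fubini_F fubini_tonelli1//=.
by apply: measurableT_comp => //; exact: measurable_fun_pair.
Qed.

(** Presents the recursive [iint] as one integral, so that the theory of a single measure applies.
    The space is a point with a Dirac mass, extended at each level by two real lines. *)
Lemma iint_measure (k : nat) :
  exists d (Y : measurableType d) (m : {sigma_finite_measure set Y -> \bar R})
    (a b : Y -> nat -> R),
  [/\ forall i, measurable_fun setT (a^~ i),
      forall i, measurable_fun setT (b^~ i) &
      forall F, measurable_seqfun F -> (forall u v, 0 <= F u v) ->
        iint k F = \int[m]_y F (a y) (b y)].
Proof.
elim: k => [|k [d [Y [m [a [b [ma mb IH]]]]]]].
  exists _, unit, (dirac tt), (fun _ _ => 0%R), (fun _ _ => 0%R).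
  split; [by move=> i|by move=> i|move=> F mF F0].
  by rewrite integral_dirac//= diracT mul1e.
exists _, (LR * (LR * Y))%type, (sfprod leb (sfprod leb m)).
exists (fun p => upd k p.1 (a p.2.2)), (fun p => upd k p.2.1 (b p.2.2)).
have m1 : measurable_fun setT (fun p : LR * (LR * Y) => p.1 : R).
  exact: measurable_fst.
have m21 : measurable_fun setT (fun p : LR * (LR * Y) => p.2.1 : R).
  exact: (measurableT_comp measurable_fst measurable_snd).
have m22 : measurable_fun setT (fun p : LR * (LR * Y) => p.2.2).
  exact: measurableT_comp measurable_snd measurable_snd.
have ma' i : measurable_fun setT (fun p : LR * (LR * Y) => upd k p.1 (a p.2.2) i).
  apply: measurable_upd => [|{}i]; first exact: m1.
  exact: (measurableT_comp (ma i) m22).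
have mb' i : measurable_fun setT (fun p : LR * (LR * Y) => upd k p.2.1 (b p.2.2) i).
  apply: measurable_upd => [|{}i]; first exact: m21.
  exact: (measurableT_comp (mb i) m22).
split=> // F mF F0; rewrite tonelli3//=; last exact: mF.
apply: eq_integral => x _; apply: eq_integral => y _.
apply: (IH (fun u v => F (upd k x u) (upd k y v))) => //.
exact: measurable_seqfun_upd.
Qed.

(** Tonelli brings the plane of coordinate [j] to the inside, where theorems on one complex variable
    can act on it. *)
Lemma iint_measure_coord (k j : nat) : (j < k)%N ->
  exists d (Y : measurableType d) (m : {sigma_finite_measure set Y -> \bar R})
    (a b : Y -> nat -> R),
  [/\ forall i, measurable_fun setT (a^~ i),
      forall i, measurable_fun setT (b^~ i) &
      forall F, measurable_seqfun F -> (forall u v, 0 <= F u v) ->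
        iint k F = \int[m]_w \int[sfprod leb leb]_q
          F (upd j (q.1 : R) (a w)) (upd j (q.2 : R) (b w))].
Proof.
have mF2 d (Y : measurableType d) (a b : Y -> nat -> R) F i :
    (forall i, measurable_fun setT (a^~ i)) ->
    (forall i, measurable_fun setT (b^~ i)) -> measurable_seqfun F ->
    measurable_fun setT (fun p : Y * (LR * LR) =>
      F (upd i p.2.1 (a p.1)) (upd i p.2.2 (b p.1))).
  move=> ma mb mF; apply: mF.
    apply: measurable_upd => [|{}i].
      exact: (measurableT_comp measurable_fst measurable_snd).
    exact: (measurableT_comp (ma i) measurable_fst).
  apply: measurable_upd => [|{}i].
    exact: (measurableT_comp measurable_snd measurable_snd).
  exact: (measurableT_comp (mb i) measurable_fst).
elim: k => // k IH; rewrite ltnS leq_eqVlt => /predU1P[->|jk].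
  have [d [Y [m [a [b [ma mb E]]]]]] := iint_measure k.
  exists _, Y, m, a, b; split=> // F mF F0 /=.
  have mG := mF2 _ _ _ _ _ k ma mb mF.
  (* For [j = k] the two integrations added last are outermost in [iint]; Tonelli exchanges them
     with all the others. *)
  rewrite -(fubini_tonelli1 _ mG)// fubini_tonelli2//.
  rewrite [RHS]fubini_tonelli1/=; last 2 first.
  - exact: measurable_fun_fubini_tonelli_G.
  - by move=> q; apply: integral_ge0.
  apply: eq_integral => x _; apply: eq_integral => y _.
  apply: (E (fun u v => F (upd k x u) (upd k y v))) => //.
  exact: measurable_seqfun_upd.
have [d [Y [m [a [b [ma mb E]]]]]] := IH jk.
exists _, (LR * (LR * Y))%type, (sfprod leb (sfprod leb m)).
exists (fun p => upd k p.1 (a p.2.2)), (fun p => upd k p.2.1 (b p.2.2)).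
have m1 : measurable_fun setT (fun p : LR * (LR * Y) => p.1 : R).
  exact: measurable_fst.
have m21 : measurable_fun setT (fun p : LR * (LR * Y) => p.2.1 : R).
  exact: (measurableT_comp measurable_fst measurable_snd).
have m22 : measurable_fun setT (fun p : LR * (LR * Y) => p.2.2).
  exact: measurableT_comp measurable_snd measurable_snd.
have ma' i : measurable_fun setT (fun p : LR * (LR * Y) => upd k p.1 (a p.2.2) i).
  apply: measurable_upd => [|{}i]; first exact: m1.
  exact: (measurableT_comp (ma i) m22).
have mb' i : measurable_fun setT (fun p : LR * (LR * Y) => upd k p.2.1 (b p.2.2) i).
  apply: measurable_upd => [|{}i]; first exact: m21.
  exact: (measurableT_comp (mb i) m22).
split=> // F mF F0 /=.
rewrite tonelli3/=; last 2 first.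
- exact: (measurable_fun_fubini_tonelli_F _ (mF2 _ _ _ _ _ j ma' mb' mF)).
- by move=> p; apply: integral_ge0.
apply: eq_integral => x _; apply: eq_integral => y _.
rewrite (E (fun u v => F (upd k x u) (upd k y v)))//; last first.
  exact: measurable_seqfun_upd.
apply: eq_integral => w _; apply: eq_integral => q _.
have updC (s t : R) (c : nat -> R) : upd k s (upd j t c) = upd j t (upd k s c).
  apply/funext => i; rewrite /upd; case: eqVneq => // ->.
  by rewrite gtn_eqF.
by rewrite !updC.
Qed.

End iterated.

Definition matC (R : realType) (n : nat) (a b : nat -> R) : Cn R n :=
  \matrix_(i < 2, j < n) (if i == ord0 then a j else b j).

Definition slice (R : realType) (n : nat) (j : 'I_n) (q : R * R) (z : Cn R n) : Cn R n :=
  \matrix_(i < 2, k < n)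
    if k == j then (if i == ord0 then q.1 else q.2) else z i k.

Section measure_Cn.
Variables (R : realType) (n : nat).
Local Open Scope ereal_scope.
Implicit Types F : Cn R n -> \bar R.

Lemma measurable_matC d (Y : measurableType d) (a b : Y -> nat -> R) :
  (forall i, measurable_fun setT (a^~ i)) -> (forall i, measurable_fun setT (b^~ i)) ->
  measurable_fun setT ((fun y => matC n (a y) (b y)) : Y -> BCn R n).
Proof.
move=> ma mb; apply: measurable_fun_Cn => i j.
rewrite (_ : (fun _ => _) = fun y => if i == ord0 then a y j else b y j).
  by case: eqP.
by apply/funext => y; rewrite mxE.
Qed.

Lemma measurable_seqfun_matC F : measurable_fun setT (F : BCn R n -> \bar R) ->
  measurable_seqfun (fun a b => F (matC n a b)).
Proof.
move=> mF d Y a b ma mb.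
exact: (measurableT_comp mF (measurable_matC ma mb)).
Qed.

Lemma iint_ge0 k (G : (nat -> R) -> (nat -> R) -> \bar R) :
  (forall a b, 0 <= G a b) -> 0 <= iint k G.
Proof.
elim: k G => [|k IH] G G0; first exact: G0.
by apply: integral_ge0 => x _; apply: integral_ge0 => y _; exact: IH.
Qed.

Lemma integral_Cn_ge0 F : (forall z, 0 <= F z) -> 0 <= integral_Cn F.
Proof. by move=> F0; apply: iint_ge0 => a b. Qed.

Lemma integral_Cn_measure :
  exists d (Y : measurableType d) (m : {measure set Y -> \bar R}) (f : Y -> BCn R n),
    measurable_fun setT f /\
    forall F, measurable_fun setT (F : BCn R n -> \bar R) -> (forall z, 0 <= F z) ->
      integral_Cn F = \int[m]_y F (f y).
Proof.
have [d [Y [m [a [b [ma mb E]]]]]] := iint_measure R n.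
exists d, Y, m, (fun y => matC n (a y) (b y)); split; first exact: measurable_matC.
move=> F mF F0; apply: (E (fun u v => F (matC n u v))) => //.
exact: measurable_seqfun_matC.
Qed.

(** The space and the measure behind [integral_Cn] are only known to exist; integrating indicators
    gives a set function that does not mention them. Its additivity is read off from any
    representation as a push-forward. *)
Definition lebesgue_Cn (A : set (BCn R n)) : \bar R :=
  integral_Cn (fun z : Cn R n => (\1_A z)%:E).

Let lebesgue_Cn0 : lebesgue_Cn set0 = 0.
Proof.
have [d [Y [m [f [mf E]]]]] := integral_Cn_measure.
rewrite /lebesgue_Cn (_ : (fun z => _) = cst 0); last first.
  by apply/funext => z; rewrite indicE in_set0.
by rewrite E ?integral0.
Qed.

Let lebesgue_Cn_ge0 A : 0 <= lebesgue_Cn A.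
Proof. by apply: integral_Cn_ge0 => z; rewrite lee_fin. Qed.

Lemma lebesgue_Cn_pushforward :
  exists d (Y : measurableType d) (m : {measure set Y -> \bar R}) (f : Y -> BCn R n),
    [/\ measurable_fun setT f,
    forall A, measurable A -> lebesgue_Cn A = m (f @^-1` A) &
    forall F, measurable_fun setT (F : BCn R n -> \bar R) -> (forall z, 0 <= F z) ->
      integral_Cn F = \int[m]_y F (f y)].
Proof.
have [d [Y [m [f [mf E]]]]] := integral_Cn_measure.
exists d, Y, m, f; split => // A mA.
rewrite /lebesgue_Cn E => [||z]; last by rewrite lee_fin.
  rewrite (_ : (fun y => _) = (fun y => (\1_(f @^-1` A) y)%:E)) //.
  by rewrite integral_indic ?setIT// -[X in measurable X]setTI; exact: mf.
by apply/measurable_EFinP; exact: measurable_indic.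
Qed.

Let lebesgue_Cn_sigma_additive : semi_sigma_additive lebesgue_Cn.
Proof.
have [d [Y [m [f [mf E _]]]]] := lebesgue_Cn_pushforward.
move=> A mA tA mUA.
rewrite E//; under eq_fun do under eq_bigr do rewrite E//.
rewrite preimage_bigcup; apply: measure_semi_sigma_additive => //.
- by move=> i; rewrite -[X in measurable X]setTI; exact: mf.
- apply/trivIsetP => i j _ _ ij; rewrite -preimage_setI.
  by move/trivIsetP : tA => ->//; rewrite preimage_set0.
- by rewrite -preimage_bigcup -[X in measurable X]setTI; exact: mf.
Qed.

HB.instance Definition _ := isMeasure.Build _ _ _ lebesgue_Cn
  lebesgue_Cn0 lebesgue_Cn_ge0 lebesgue_Cn_sigma_additive.

Lemma integral_CnE F : measurable_fun setT (F : BCn R n -> \bar R) ->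
  (forall z, 0 <= F z) -> integral_Cn F = \int[lebesgue_Cn]_z F z.
Proof.
have [d [Y [m [f [mf E EF]]]]] := lebesgue_Cn_pushforward.
move=> mF F0; rewrite EF//.
rewrite -(@ge0_integral_pushforward _ _ _ _ _ f mf m setT F)//.
by apply: eq_measure_integral => A mA _ /=; rewrite /pushforward; exact/esym/E.
Qed.

Lemma integral_Cn_coord (j : 'I_n) :
  exists d (Y : measurableType d) (m : {measure set Y -> \bar R}) (f : Y -> Cn R n),
    forall F, measurable_fun setT (F : BCn R n -> \bar R) -> (forall z, 0 <= F z) ->
      integral_Cn F =
      \int[m]_y \int[sfprod (@lebesgue_measure R) (@lebesgue_measure R)]_q F (slice j q (f y)).
Proof.
have [d [Y [m [a [b [ma mb E]]]]]] := iint_measure_coord R (ltn_ord j).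
exists d, Y, m, (fun y => matC n (a y) (b y)).
move=> F mF F0; rewrite /integral_Cn E//; last exact: measurable_seqfun_matC.
apply: eq_integral => y _; apply: eq_integral => q _; congr F.
apply/matrixP => i k; rewrite !mxE /upd -val_eqE.
by case: ifP => //; case: ifP.
Qed.

(** Tonelli is applied to the positive and the negative part separately: their slice integrals
    agree, hence so do their total integrals, which are finite by integrability. *)
Lemma integral_slice_eq0 (j : 'I_n) (g : Cn R n -> R) :
  lebesgue_Cn.-integrable setT (EFin \o (g : BCn R n -> R)) ->
  (forall z, \int[sfprod (@lebesgue_measure R) (@lebesgue_measure R)]_q
               (g (slice j q z))%:E = 0) ->
  \int[lebesgue_Cn]_z (g z)%:E = 0.
Proof.
move=> /integrableP[mg gfin] g0.
have [d [Y [m [f E]]]] := integral_Cn_coord j.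
have mp : measurable_fun setT ((EFin \o (g : BCn R n -> R))^\+) by exact: measurable_funepos.
have mn : measurable_fun setT ((EFin \o (g : BCn R n -> R))^\-) by exact: measurable_funeneg.
pose gp : Cn R n -> \bar R := (EFin \o g)^\+; pose gn : Cn R n -> \bar R := (EFin \o g)^\-.
have gp0 z : 0 <= gp z by exact: funepos_ge0.
have gn0 z : 0 <= gn z by exact: funeneg_ge0.
rewrite integralE -/gp -/gn -(integral_CnE mp gp0) -(integral_CnE mn gn0).
have EE : integral_Cn gp = integral_Cn gn.
  rewrite (E gp)// (E gn)//; apply: eq_integral => y _.
  have := g0 (f y); rewrite integralE.
  set A := (X in X - _); set B := (X in _ - X) => AB.
  have A0 : 0 <= A by apply: integral_ge0 => q _; exact: funepos_ge0.
  have B0 : 0 <= B by apply: integral_ge0 => q _; exact: funeneg_ge0.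
  suff : A = B by move=> AB'; transitivity A; [apply: eq_integral => q _|rewrite AB'; apply: eq_integral => q _]; rewrite /gp /gn ?funeposE ?funenegE.
  (* In extended reals [+oo - +oo] is [-oo], so a difference equal to 0 forces both parts to be
     finite and equal. *)
  move: A0 B0 AB; clear; case: A B => [a| |] [b| |]//= _ _.
  by move=> [] /eqP; rewrite subr_eq0 => /eqP ->.
rewrite EE subee// (integral_CnE mn gn0) ge0_fin_numE; last exact: integral_ge0.
apply: le_lt_trans gfin; apply: ge0_le_integral => //.
- by apply: measurableT_comp.
- by move=> z _; rewrite -[leRHS]/((abse \o (EFin \o g)) z) fune_abse leeDr.
Qed.

End measure_Cn.

(** * Green's formula and Cauchy estimates in one variable *)

Lemma Rintegral_near d (T : measurableType d) (R : realType)
    (mu : {measure set T -> \bar R}) (A : set T) (f : T -> R) (m eta M : R) :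
  measurable A -> mu A = M%:E -> mu.-integrable A (EFin \o f) ->
  (forall x, A x -> `|f x - m| <= eta) ->
  `|\int[mu]_(x in A) f x - m * M| <= eta * M.
Proof.
move=> mA muA intf fm.
have ci (c : R) : mu.-integrable A (EFin \o cst c).
  apply: measurable_bounded_integrable => //; first by rewrite muA ltry.
  exact: bounded_cst.
have mE : m * M = \int[mu]_(x in A) m by rewrite Rintegral_cst// muA.
rewrite mE -RintegralB//; last exact: (ci m).
have intB : mu.-integrable A (EFin \o (fun x => f x - m)).
  rewrite (_ : _ \o _ = (EFin \o f) \- (EFin \o cst m))%E; last exact/funext.
  exact: integrableB.
apply: le_trans (le_normr_Rintegral mA intB) _.
rewrite (_ : eta * M = \int[mu]_(x in A) eta); last by rewrite Rintegral_cst// muA.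
apply: le_Rintegral => //; [|exact: (ci eta)].
exact: integrable_norm.
Qed.

Lemma differentiable_eps (R : realType) (V : normedModType R) (f : V -> R) (z : V) (e : R) :
  differentiable f z -> 0 < e ->
  exists2 d, 0 < d &
    forall h, `|h| <= d -> `|f (z + h) - f z - 'd f z h| <= e * `|h|.
Proof.
move=> df e0; have /eqaddoP/(_ _ e0) := diff_locally df.
rewrite near_nbhs => /nbhs_ballP[d /= d0 dP].
exists (d / 2); first by rewrite divr_gt0.
move=> h hd; have := dP h.
rewrite /= !fctE /= [z + h]addrC opprD addrA; apply.
by rewrite -ball_normE /= sub0r normrN (le_lt_trans hd)// ltr_pdivrMr// ltr_pMr// ltr1n.
Qed.

(** Goursat's nested rectangles for an abstract property that always passes to some quarter. The
    common point has the suprema of the left and of the lower end points as coordinates. *)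
Lemma bisection (R : realType) (bad : R -> R -> R -> R -> Prop) (a0 b0 c0 d0 : R) :
  a0 <= b0 -> c0 <= d0 ->
  (forall a b c d, a <= b -> c <= d -> bad a b c d ->
    [\/ bad a ((a + b) / 2) c ((c + d) / 2), bad ((a + b) / 2) b c ((c + d) / 2),
        bad a ((a + b) / 2) ((c + d) / 2) d | bad ((a + b) / 2) b ((c + d) / 2) d]) ->
  bad a0 b0 c0 d0 ->
  exists x y, forall k : nat, exists a b c d,
    [/\ bad a b c d, a0 <= a <= x /\ x <= b <= b0, c0 <= c <= y /\ y <= d <= d0 &
        b - a = (b0 - a0) / 2 ^+ k /\ d - c = (d0 - c0) / 2 ^+ k].
Proof.
move=> ab0 cd0 step bad0.
pose good (s : R * R * (R * R)) := [/\ bad s.1.1 s.1.2 s.2.1 s.2.2, s.1.1 <= s.1.2 & s.2.1 <= s.2.2].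
pose next (s t : R * R * (R * R)) := [/\ good t, s.1.1 <= t.1.1, t.1.2 <= s.1.2,
   s.2.1 <= t.2.1 & t.2.2 <= s.2.2] /\
   (t.1.2 - t.1.1 = (s.1.2 - s.1.1) / 2 /\ t.2.2 - t.2.1 = (s.2.2 - s.2.1) / 2).
have /choice[f fP] : forall s, exists t, good s -> next s t.
  move=> [[a b] [c d]].
  have [[/= bs ab cd]|ng] := pselect (good (a, b, (c, d))); last by exists (a, b, (c, d)).
  have [h|h|h|h] := step _ _ _ _ ab cd bs.
  - by exists (a, (a + b) / 2, (c, (c + d) / 2)) => _; split; [split; [split|..]|split] => //=; lra.
  - by exists ((a + b) / 2, b, (c, (c + d) / 2)) => _; split; [split; [split|..]|split] => //=; lra.
  - by exists (a, (a + b) / 2, ((c + d) / 2, d)) => _; split; [split; [split|..]|split] => //=; lra.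
  - by exists ((a + b) / 2, b, ((c + d) / 2, d)) => _; split; [split; [split|..]|split] => //=; lra.
pose s k := iter k f (a0, b0, (c0, d0)).
have gs k : good (s k).
  by elim: k => [|k IH]; [split|have [[]] := fP _ IH].
have ns k : next (s k) (s k.+1) by exact: fP.
have a_mono k m : (s k).1.1 <= (s (k + m)%N).1.1 /\ (s (k + m)%N).1.2 <= (s k).1.2.
  elim: m => [|m [IH1 IH2]]; first by rewrite addn0.
  have [[_ h1 h2 _ _] _] := ns (k + m)%N.
  by rewrite addnS; split; [exact: le_trans h1|exact: le_trans h2 _].
have c_mono k m : (s k).2.1 <= (s (k + m)%N).2.1 /\ (s (k + m)%N).2.2 <= (s k).2.2.
  elim: m => [|m [IH1 IH2]]; first by rewrite addn0.
  have [[_ _ _ h1 h2] _] := ns (k + m)%N.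
  by rewrite addnS; split; [exact: le_trans h1|exact: le_trans h2 _].
have ab k m : (s k).1.1 <= (s m).1.2.
  have [_ h _] := gs (k + m)%N.
  apply: le_trans (a_mono k m).1 (le_trans h _).
  by rewrite addnC; exact: (a_mono m k).2.
have cd k m : (s k).2.1 <= (s m).2.2.
  have [_ _ h] := gs (k + m)%N.
  apply: le_trans (c_mono k m).1 (le_trans h _).
  by rewrite addnC; exact: (c_mono m k).2.
exists (sup (range (fun k => (s k).1.1))), (sup (range (fun k => (s k).2.1))) => k.
exists (s k).1.1, (s k).1.2, (s k).2.1, (s k).2.2.
have [bk _ _] := gs k.
split => //.
- split; apply/andP; split.
  + by have [] := a_mono 0%N k.
  + apply: ub_le_sup; last by exists k.
    by exists b0 => _ [m _ <-]; exact: (ab m 0%N).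
  + apply: ge_sup; first by exists (s 0%N).1.1, 0%N.
    by move=> _ [m _ <-]; exact: ab.
  + by have [] := a_mono 0%N k.
- split; apply/andP; split.
  + by have [] := c_mono 0%N k.
  + apply: ub_le_sup; last by exists k.
    by exists d0 => _ [m _ <-]; exact: (cd m 0%N).
  + apply: ge_sup; first by exists (s 0%N).2.1, 0%N.
    by move=> _ [m _ <-]; exact: cd.
  + by have [] := c_mono 0%N k.
- elim: k {bk} => [|k [IH1 IH2]]; first by rewrite !expr0 !divr1.
  by have [_ [-> ->]] := ns k; rewrite IH1 IH2 exprSr !invfM !mulrA.
Qed.

(** * Green's formula on a rectangle *)

Section green.
Variable R : realType.
Local Notation mu := (@lebesgue_measure R).
Local Notation mu2 := (sfprod mu mu).
Local Notation LR := (measurableTypeR R).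

Lemma mu_itvoc (a b : R) : a <= b -> mu `]a, b] = (b - a)%:E.
Proof.
move=> ab; rewrite lebesgue_measure_itv/= lte_fin.
by case: ltP => // ba; congr EFin; lra.
Qed.

Lemma mu2_rect (a b c d : R) : a <= b -> c <= d ->
  mu2 (`]a, b] `*` `]c, d] : set (LR * LR)) = ((b - a) * (d - c))%:E.
Proof.
move=> ab cd; rewrite /sfprod product_measure1E// ; [|exact: measurable_itv..].
by rewrite EFinM; congr (_ * _)%E; exact: mu_itvoc.
Qed.

(** The counterclockwise line integral of [P dx + Q dy] along the boundary of the rectangle.
    Half-open intervals, here and in [rect_int], make subdivisions disjoint. *)
Definition boundary_int (P Q : R * R -> R) (a b c d : R) : R :=
  (\int[mu]_(x in `]a, b]) P (x, c) - \int[mu]_(x in `]a, b]) P (x, d)) +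
  (\int[mu]_(y in `]c, d]) Q (b, y) - \int[mu]_(y in `]c, d]) Q (a, y)).

Definition rect_int (G : R * R -> R) (a b c d : R) : R :=
  \int[mu2]_(z in (`]a, b] `*` `]c, d] : set (LR * LR))) G z.

Definition box (a b c d : R) : set (R * R) := [set z | a <= z.1 <= b /\ c <= z.2 <= d].

Lemma itvoc_cont_integrable (f : R -> R) (a b : R) :
  (forall x, a <= x <= b -> {for x, continuous f}) ->
  mu.-integrable `]a, b] (EFin \o f).
Proof.
move=> cf; apply: (@integrableS _ _ _ mu `[a, b]) => //.
  by apply: subset_itv; rewrite bnd_simp.
apply: continuous_compact_integrable; first exact: segment_compact.
apply: continuous_in_subspaceT => x; rewrite inE/= in_itv/=; exact: cf.
Qed.

Lemma itvoc_split (f : R -> R) (a e b : R) : a <= e -> e <= b ->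
  mu.-integrable `]a, b] (EFin \o f) ->
  \int[mu]_(x in `]a, b]) f x = \int[mu]_(x in `]a, e]) f x + \int[mu]_(x in `]e, b]) f x.
Proof.
move=> ae eb intf.
have E : `]a, b]%classic = `]a, e] `|` `]e, b].
  by rewrite -itv_bndbnd_setU// bnd_simp.
rewrite E Rintegral_setU -?E//.
by apply/disj_setPS => x [/=]; rewrite !in_itv/= => /andP[_ xe] /andP[]; rewrite ltNge xe.
Qed.

Lemma rect_int_splitx (G : R * R -> R) (a e b c d : R) : a <= e -> e <= b ->
  mu2.-integrable (`]a, b] `*` `]c, d]) (EFin \o G) ->
  rect_int G a b c d = rect_int G a e c d + rect_int G e b c d.
Proof.
move=> ae eb intG.
have E : `]a, b] `*` `]c, d] = (`]a, e] `*` `]c, d]) `|` (`]e, b] `*` `]c, d]).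
  have Eab : `]a, b]%classic = `]a, e] `|` `]e, b].
    by rewrite -itv_bndbnd_setU// bnd_simp.
  rewrite Eab; apply/seteqP; split => [z [[zl|zr] h]|z [[zl h]|[zr h]]].
  - by left.
  - by right.
  - by split => //; left.
  - by split => //; right.
rewrite /rect_int E Rintegral_setU -?E//.
- by apply: measurableX; exact: measurable_itv.
- by apply: measurableX; exact: measurable_itv.
- apply/disj_setPS => x [/= [+ _] [+ _]]; rewrite !in_itv/= => /andP[_ xe] /andP[].
  by rewrite ltNge xe.
Qed.

Lemma rect_int_splity (G : R * R -> R) (a b c e d : R) : c <= e -> e <= d ->
  mu2.-integrable (`]a, b] `*` `]c, d]) (EFin \o G) ->
  rect_int G a b c d = rect_int G a b c e + rect_int G a b e d.
Proof.
move=> ce ed intG.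
have E : `]a, b] `*` `]c, d] = (`]a, b] `*` `]c, e]) `|` (`]a, b] `*` `]e, d]).
  have Ecd : `]c, d]%classic = `]c, e] `|` `]e, d].
    by rewrite -itv_bndbnd_setU// bnd_simp.
  rewrite Ecd; apply/seteqP; split => [z [h [zl|zr]]|z [[h zl]|[h zr]]].
  - by left.
  - by right.
  - by split => //; left.
  - by split => //; right.
rewrite /rect_int E Rintegral_setU -?E//.
- by apply: measurableX; exact: measurable_itv.
- by apply: measurableX; exact: measurable_itv.
- apply/disj_setPS => x [/= [_ +] [_ +]]; rewrite !in_itv/= => /andP[_ xe] /andP[].
  by rewrite ltNge xe.
Qed.

Lemma ler_dist_itv (a b s x : R) : a <= s <= b -> a <= x <= b -> `|s - x| <= b - a.
Proof.
move=> /andP[s1 s2] /andP[x1 x2].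
by rewrite ler_norml; apply/andP; split; lra.
Qed.

Lemma midpoint_bounds (a b : R) : a <= b ->
  [/\ a <= (a + b) / 2, (a + b) / 2 <= b, (a + b) / 2 - a = (b - a) / 2 &
      b - (a + b) / 2 = (b - a) / 2].
Proof. by move=> ab; split; lra. Qed.

(** [A] and [B] are the contributions of the horizontal and the vertical sides, [C] is the area
    integral. The first-order terms in [p] and [q] cancel, and only the three errors remain. *)
Lemma green_arith (A B C p q e w h : R) : 0 <= e -> 0 <= w -> 0 <= h ->
  `|A - - p * h * w| <= 2 * e * (w + h) * w ->
  `|B - q * w * h| <= 2 * e * (w + h) * h ->
  `|C - (q - p) * (w * h)| <= e * (w * h) ->
  `|A + B - C| <= 3 * e * (w + h) ^+ 2.
Proof.
move=> e0 w0 h0 I1 I2 I3.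
rewrite (_ : A + B - C = (A - - p * h * w) + (B - q * w * h) -
  (C - (q - p) * (w * h))); last by ring.
apply: le_trans (ler_normB _ _) _.
apply: le_trans (lerD (le_trans (ler_normD _ _) (lerD I1 I2)) I3) _.
have wh : 0 <= e * (w * h) by rewrite !mulr_ge0.
have ww : 0 <= e * (w * w) by rewrite !mulr_ge0.
have hh : 0 <= e * (h * h) by rewrite !mulr_ge0.
by rewrite expr2; lra.
Qed.

Section green_rect.
Variables (P Q G : R * R -> R) (a0 b0 c0 d0 : R).
Hypotheses (ab0 : a0 < b0) (cd0 : c0 < d0).
Hypothesis dP : forall z, box a0 b0 c0 d0 z -> differentiable P z.
Hypothesis dQ : forall z, box a0 b0 c0 d0 z -> differentiable Q z.
Hypothesis curl : forall z, box a0 b0 c0 d0 z -> 'd Q z (1, 0) - 'd P z (0, 1) = G z.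
Hypothesis cG : forall z, box a0 b0 c0 d0 z -> {for z, continuous G}.
Hypothesis intG : mu2.-integrable (`]a0, b0] `*` `]c0, d0]) (EFin \o G).

Let cont_x (F : R * R -> R) c : (forall z, box a0 b0 c0 d0 z -> differentiable F z) ->
  c0 <= c <= d0 -> mu.-integrable `]a0, b0] (EFin \o (fun x => F (x, c))).
Proof.
move=> dF cc; apply: itvoc_cont_integrable => x xab.
have /differentiable_continuous cF : differentiable F (x, c) by apply: dF.
apply: (@continuous_comp R (R * R)%type R (fun x => (x, c)) F x) => //.
exact: (cvg_pair cvg_id (cvg_cst _)).
Qed.

Let cont_y (F : R * R -> R) a : (forall z, box a0 b0 c0 d0 z -> differentiable F z) ->
  a0 <= a <= b0 -> mu.-integrable `]c0, d0] (EFin \o (fun y => F (a, y))).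
Proof.
move=> dF aa; apply: itvoc_cont_integrable => y ycd.
have /differentiable_continuous cF : differentiable F (a, y) by apply: dF.
apply: (@continuous_comp R (R * R)%type R (fun y => (a, y)) F y) => //.
exact: (cvg_pair (cvg_cst _) cvg_id).
Qed.

Let sub_itv (f : R -> R) (a b a' b' : R) : a <= a' -> b' <= b ->
  mu.-integrable `]a, b] (EFin \o f) -> mu.-integrable `]a', b'] (EFin \o f).
Proof.
move=> aa bb; apply: integrableS => //.
by apply: subset_itv; rewrite bnd_simp.
Qed.

Let sub_rect a b c d : a0 <= a -> b <= b0 -> c0 <= c -> d <= d0 ->
  mu2.-integrable (`]a, b] `*` `]c, d]) (EFin \o G).
Proof.
move=> aa bb cc dd; apply: integrableS intG.
- by apply: measurableX; exact: measurable_itv.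
- by apply: measurableX; exact: measurable_itv.
- move=> z [/= h1 h2]; split => /=.
    by apply: subset_itv h1; rewrite bnd_simp.
  by apply: subset_itv h2; rewrite bnd_simp.
Qed.

(** The defect in Green's formula. It is additive under subdivision, since the integrals over
    interior edges cancel. *)
Let D a b c d := boundary_int P Q a b c d - rect_int G a b c d.

Let D_split a e b c f d : a0 <= a -> a <= e -> e <= b -> b <= b0 ->
  c0 <= c -> c <= f -> f <= d -> d <= d0 ->
  D a b c d = D a e c f + D e b c f + D a e f d + D e b f d.
Proof.
move=> aa ae eb bb cc cf fd dd.
have ab := le_trans ae eb; have cd := le_trans cf fd.
rewrite /D (rect_int_splitx ae eb); last exact: sub_rect.
rewrite (rect_int_splity cf fd); last by apply: sub_rect => //; exact: le_trans eb bb.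
rewrite (@rect_int_splity _ e b _ _ _ cf fd); last by apply: sub_rect => //; exact: le_trans ae.
have Px y : c0 <= y <= d0 -> \int[mu]_(x in `]a, b]) P (x, y) =
   \int[mu]_(x in `]a, e]) P (x, y) + \int[mu]_(x in `]e, b]) P (x, y).
  by move=> yy; apply: itvoc_split => //; apply: sub_itv (cont_x dP yy).
have Qy x : a0 <= x <= b0 -> \int[mu]_(y in `]c, d]) Q (x, y) =
   \int[mu]_(y in `]c, f]) Q (x, y) + \int[mu]_(y in `]f, d]) Q (x, y).
  by move=> xx; apply: itvoc_split => //; apply: sub_itv (cont_y dQ xx).
have ca : c0 <= c <= d0 by rewrite cc (le_trans cd).
have da : c0 <= d <= d0 by rewrite dd (le_trans cc).
have fa : c0 <= f <= d0 by rewrite (le_trans cc)// (le_trans fd).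
have aa' : a0 <= a <= b0 by rewrite aa (le_trans ab).
have ba' : a0 <= b <= b0 by rewrite bb (le_trans aa).
have ea' : a0 <= e <= b0 by rewrite (le_trans aa)// (le_trans eb).
by rewrite /boundary_int !Px ?Qy//; ring.
Qed.

(** On a small rectangle around [(x, y)] the forms are replaced by their differentials at that
    point, for which Green's formula is exact by [curl]. The remainders are at most [e * (w + h)]
    along sides of length [w] and [h]. *)
Let local_bound (x y e : R) : 0 < e -> box a0 b0 c0 d0 (x, y) ->
  exists2 r, 0 < r & forall a b c d,
    a0 <= a <= x -> x <= b <= b0 -> c0 <= c <= y -> y <= d <= d0 ->
    b - a <= r -> d - c <= r -> `|D a b c d| <= 3 * e * ((b - a) + (d - c)) ^+ 2.
Proof.
move=> e0 xy.
have [r1 r10 hP] := differentiable_eps (dP xy) e0.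
have [r2 r20 hQ] := differentiable_eps (dQ xy) e0.
have [r3 r30 hG] : exists2 r3, 0 < r3 & forall h : R * R, `|h| < r3 -> `|G ((x, y) + h) - G (x, y)| <= e.
  have /cvgrPdist_le/(_ _ e0) := cG xy.
  rewrite near_nbhs => /nbhs_ballP[r /= r0 rP]; exists r => // h hr.
  rewrite distrC; apply: rP; rewrite -ball_normE /=.
  by rewrite opprD addrA subrr sub0r normrN.
exists (Num.min r1 (Num.min r2 (r3 / 2))); first by rewrite !lt_min r10 r20 divr_gt0.
move=> a b c d /andP[a0a ax] /andP[xb bb] /andP[c0c cy] /andP[yd dd].
rewrite !le_min => /andP[w1 /andP[w2 w3]] /andP[h1 /andP[h2 h3]].
set w := b - a in w1 w2 w3 *; set h := d - c in h1 h2 h3 *.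
have ab : a <= b by exact: le_trans xb.
have cd : c <= d by exact: le_trans yd.
have w0 : 0 <= w by rewrite subr_ge0.
have h0 : 0 <= h by rewrite subr_ge0.
have nrm (s t : R) : a <= s <= b -> c <= t <= d ->
    `|(s - x, t - y)| <= w + h /\ (forall r, w <= r -> h <= r -> `|(s - x, t - y)| <= r).
  move=> /andP[s1 s2] /andP[t1 t2].
  have sw : `|s - x| <= w.
    by apply: ler_dist_itv; [rewrite s1|rewrite ax].
  have th : `|t - y| <= h.
    by apply: ler_dist_itv; [rewrite t1|rewrite cy].
  rewrite prod_normE/=; split => [|r wr hr]; rewrite ge_max.
    by rewrite (le_trans sw) ?(le_trans th)// (lerDl, lerDr).
  by rewrite (le_trans sw wr) (le_trans th hr).
have lin (F : R * R -> R) s t : differentiable F (x, y) ->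
    'd F (x, y) (s, t) = s * 'd F (x, y) (1, 0) + t * 'd F (x, y) (0, 1).
  move=> dF; have -> : (s, t) = s *: (1, 0) + t *: (0, 1) :> R * R.
    by apply: injective_projections => /=;
      rewrite /GRing.scale/= ?mulr1 ?mulr0 ?addr0 ?add0r.
  by rewrite linearD !linearZ.
have shift (s t : R) : (x, y) + (s - x, t - y) = (s, t).
  by congr (_, _); rewrite addrC subrK.
have bP s : a <= s <= b -> `|(P (s, c) - P (s, d)) - (- 'd P (x, y) (0, 1) * h)| <= 2 * e * (w + h).
  move=> sab.
  have [n1 n1'] := nrm s c sab (introT andP (conj (lexx c) cd)).
  have [n2 n2'] := nrm s d sab (introT andP (conj cd (lexx d))).
  have := le_trans (hP _ (n1' _ w1 h1)) (ler_wpM2l (ltW e0) n1).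
  have := le_trans (hP _ (n2' _ w1 h1)) (ler_wpM2l (ltW e0) n2).
  rewrite !shift (lin P _ (c - y)) ?(lin P _ (d - y)); [|exact: dP..] => A1 A2.
  rewrite -mulrA (_ : 2 * _ = e * (w + h) + e * (w + h)); last by rewrite mulr2n mulrDl mul1r.
  apply: le_trans (le_trans (ler_normB _ _) (lerD A2 A1)).
  by rewrite le_eqVlt; apply/predU1P; left; congr `|_|; rewrite /h; ring.
have bQ t : c <= t <= d -> `|(Q (b, t) - Q (a, t)) - 'd Q (x, y) (1, 0) * w| <= 2 * e * (w + h).
  move=> tcd.
  have [n1 n1'] := nrm a t (introT andP (conj (lexx a) ab)) tcd.
  have [n2 n2'] := nrm b t (introT andP (conj ab (lexx b))) tcd.
  have := le_trans (hQ _ (n1' _ w2 h2)) (ler_wpM2l (ltW e0) n1).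
  have := le_trans (hQ _ (n2' _ w2 h2)) (ler_wpM2l (ltW e0) n2).
  rewrite !shift (lin Q (a - x)) ?(lin Q (b - x)); [|exact: dQ..] => A1 A2.
  rewrite -mulrA (_ : 2 * _ = e * (w + h) + e * (w + h)); last by rewrite mulr2n mulrDl mul1r.
  apply: le_trans (le_trans (ler_normB _ _) (lerD A1 A2)).
  by rewrite le_eqVlt; apply/predU1P; left; congr `|_|; rewrite /w; ring.
have iP t : c0 <= t <= d0 -> mu.-integrable `]a, b] (EFin \o (fun x => P (x, t))).
  by move=> tt; apply: sub_itv (cont_x dP tt).
have iQ s : a0 <= s <= b0 -> mu.-integrable `]c, d] (EFin \o (fun x => Q (s, x))).
  by move=> tt; apply: sub_itv (cont_y dQ tt).
have cc : c0 <= c <= d0 by rewrite c0c (le_trans cd).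
have dd' : c0 <= d <= d0 by rewrite dd (le_trans c0c).
have aa : a0 <= a <= b0 by rewrite a0a (le_trans ab).
have bb' : a0 <= b <= b0 by rewrite bb (le_trans a0a).
rewrite /D /boundary_int -RintegralB//; [|exact: iP..].
rewrite -RintegralB//; [|exact: iQ..].
have I1 : `|\int[mu]_(s in `]a, b]) (P (s, c) - P (s, d)) - - 'd P (x, y) (0, 1) * h * w| <= 2 * e * (w + h) * w.
  apply: Rintegral_near => //; first exact: mu_itvoc.
    rewrite (_ : _ \o _ = (EFin \o (fun x => P (x, c))) \- (EFin \o (fun x => P (x, d))))%E; last exact/funext.
    by apply: integrableB => //; exact: iP.
  by move=> s /=; rewrite in_itv/= => /andP[/ltW s1 s2]; apply: bP; rewrite s1.
have I2 : `|\int[mu]_(t in `]c, d]) (Q (b, t) - Q (a, t)) - 'd Q (x, y) (1, 0) * w * h| <= 2 * e * (w + h) * h.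
  apply: Rintegral_near => //; first exact: mu_itvoc.
    rewrite (_ : _ \o _ = (EFin \o (fun x => Q (b, x))) \- (EFin \o (fun x => Q (a, x))))%E; last exact/funext.
    by apply: integrableB => //; exact: iQ.
  by move=> s /=; rewrite in_itv/= => /andP[/ltW s1 s2]; apply: bQ; rewrite s1.
have I3 : `|rect_int G a b c d - G (x, y) * (w * h)| <= e * (w * h).
  apply: Rintegral_near => //.
  - by apply: measurableX; exact: measurable_itv.
  - exact: mu2_rect.
  - exact: sub_rect.
  move=> [s t] [/=]; rewrite !in_itv/= => /andP[/ltW s1 s2] /andP[/ltW t1 t2].
  rewrite -(shift s t); apply: hG.
  have [|_ /(_ (r3 / 2))/(_ w3 h3) h4] := nrm s t (introT andP (conj s1 s2)).
    by rewrite t1.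
  by apply: le_lt_trans h4 _; rewrite ltr_pdivrMr// ltr_pMr// ltr1n.
rewrite -(curl xy) in I3.
exact: green_arith (ltW e0) w0 h0 I1 I2 I3.
Qed.

(* Bisection as in Goursat's theorem: only differentiability of [P] and [Q] is
   assumed, not continuity of their partial derivatives. *)
Lemma green_rect : boundary_int P Q a0 b0 c0 d0 = rect_int G a0 b0 c0 d0.
Proof.
apply/eqP; rewrite -subr_eq0 -/(D a0 b0 c0 d0); apply/negPn/negP => D0.
have {D0} : 0 < `|D a0 b0 c0 d0| by rewrite normr_gt0.
set N := `|_| => N0.
set W := b0 - a0; set H := d0 - c0.
have W0 : 0 < W by rewrite subr_gt0.
have H0 : 0 < H by rewrite subr_gt0.
(* The defect per unit of area of the whole rectangle; by additivity one of the four quarters keeps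
   at least this ratio. *)
pose eta := N / (W * H).
have eta0 : 0 < eta by rewrite divr_gt0// mulr_gt0.
pose bad a b c d := [/\ a0 <= a, b <= b0, c0 <= c, d <= d0 & eta * ((b - a) * (d - c)) <= `|D a b c d|].
have [||||x [y xyP]] := @bisection R bad a0 b0 c0 d0; rewrite ?ltW//.
- move=> a b c d ab cd [aa bb cc dd].
  set e := (a + b) / 2; set f := (c + d) / 2 => bb'.
  have [ae eb ea be] := midpoint_bounds ab; have [cf fd fc df] := midpoint_bounds cd.
  rewrite -/e -/f in ae eb ea be cf fd fc df.
  have eb0 := le_trans eb bb; have ea0 := le_trans aa ae.
  have fd0 := le_trans fd dd; have fc0 := le_trans cc cf.
  have De : D a b c d = D a e c f + D e b c f + D a e f d + D e b f d by exact: D_split.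
  have [q1|q1] := leP (eta * ((e - a) * (f - c))) `|D a e c f|.
    by apply: Or41; split.
  have [q2|q2] := leP (eta * ((b - e) * (f - c))) `|D e b c f|.
    by apply: Or42; split.
  have [q3|q3] := leP (eta * ((e - a) * (d - f))) `|D a e f d|.
    by apply: Or43; split.
  have [q4|q4] := leP (eta * ((b - e) * (d - f))) `|D e b f d|.
    by apply: Or44; split.
  exfalso; move: bb'; apply/negP; rewrite -ltNge De.
  rewrite ?ea ?be ?fc ?df in q1 q2 q3 q4.
  apply: le_lt_trans (ler_normD _ _) _.
  apply: le_lt_trans (lerD (ler_normD _ _) (lexx _)) _.
  apply: le_lt_trans (lerD (lerD (ler_normD _ _) (lexx _)) (lexx _)) _.
  apply: lt_le_trans (ltrD (ltrD (ltrD q1 q2) q3) q4) _.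
  by rewrite le_eqVlt; apply/predU1P; left; field.
- by split => //; rewrite /eta -/N mulfVK// mulf_neq0// gt_eqF.
have xy : box a0 b0 c0 d0 (x, y).
  have [a [b [c [d [_ [/andP[h1 h2] /andP[h3 h4]] [/andP[h5 h6] /andP[h7 h8]] _]]]]] := xyP 0%N.
  by split; rewrite /= ?(le_trans h1 h2) ?(le_trans h3 h4) ?(le_trans h5 h6) ?(le_trans h7 h8).
(* This ratio is the same for all halved rectangles. With [e = eta / (6 * K)] the local bound
   [3 * e * (w + h) ^+ 2] is [eta / 2] times the area, less than what [bad] demands. *)
pose K := (W + H) ^+ 2 / (W * H).
have K0 : 0 < K by rewrite divr_gt0 ?exprn_gt0 ?mulr_gt0// addr_gt0.
have e0 : 0 < eta / (6 * K) by rewrite divr_gt0// mulr_gt0.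
have [r r0 hr] := local_bound e0 xy.
have [k hk] : exists k : nat, W / 2 ^+ k <= r /\ H / 2 ^+ k <= r.
  have : (fun k : nat => (W + H) * (2^-1) ^+ k) @ \oo --> (W + H) * 0.
    apply: cvgMr; apply: cvg_expr.
    by rewrite ger0_norm// invf_lt1// ltr1n.
  rewrite mulr0 => /cvgrPdist_lt/(_ _ r0)[k _ /(_ k (leqnn k))].
  rewrite sub0r normrN ger0_norm; last first.
    by rewrite mulr_ge0 ?exprn_ge0// addr_ge0// ltW.
  rewrite exprVn => hk; exists k.
  have p0 : 0 < (2 ^+ k)^-1 :> R by rewrite invr_gt0 exprn_gt0.
  by split; apply: ltW; apply: le_lt_trans hk; rewrite ler_wpM2r ?(ltW p0)// (lerDl, lerDr) ltW.
have [a [b [c [d [[aa bb cc dd bad_] [ax xb] [cy yd] [wE hE]]]]]] := xyP k.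
rewrite -/W -/H in wE hE.
have := hr _ _ _ _ ax xb cy yd; rewrite wE hE => /(_ hk.1 hk.2).
rewrite wE hE in bad_ => hD.
have := le_trans bad_ hD.
set t := (2 ^+ k)^-1.
have t0 : 0 < t by rewrite invr_gt0 exprn_gt0.
rewrite leNgt => /negP; apply.
rewrite (_ : 3 * _ * _ = (eta / 2) * ((W / 2 ^+ k) * (H / 2 ^+ k))).
  by rewrite ltr_pM2r ?mulr_gt0// ltr_pdivrMr// ltr_pMr// ltr1n.
rewrite -/t /K; field.
by rewrite !gt_eqF// addr_gt0.
Qed.

End green_rect.
End green.

(** The product sigma-algebra of the plane is linked to the Borel one through [Cn R 1], where
    [measurable_fun_Cn] applies. *)
Lemma continuous_measurable_pair (R : realType) (f : R * R -> R) :
  continuous f ->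
  measurable_fun setT (f : measurableTypeR R * measurableTypeR R -> R).
Proof.
move=> cf.
pose m (q : measurableTypeR R * measurableTypeR R) : BCn R 1 :=
  \matrix_(i < 2, j < 1) if i == ord0 then q.1 else q.2.
pose g (z : Cn R 1) := f (z ord0 ord0, z ord_max ord0).
have mm : measurable_fun setT m.
  apply: measurable_fun_Cn => i j.
  rewrite (_ : (fun _ => _) = fun q => if i == ord0 then q.1 else q.2).
    by case: eqP => _; [exact: measurable_fst|exact: measurable_snd].
  by apply/funext => y; rewrite mxE.
have cg : continuous g.
  move=> z; apply: (@continuous_comp _ _ _ (fun z : Cn R 1 => (z ord0 ord0, z ord_max ord0)) f).
    exact: (cvg_pair (@coord_continuous _ _ _ _ _ _) (@coord_continuous _ _ _ _ _ _)).
  exact: cf.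
rewrite (_ : (f : _ -> _) = (g : BCn R 1 -> R) \o m).
  exact: (measurableT_comp (continuous_borel cg) mm).
by apply/funext => -[x y]; rewrite /g /m /= !mxE.
Qed.

(** * The Cauchy kernel as a closed real one-form *)

Definition holo (R : realType) (u v : R * R -> R) : Prop :=
  forall z, [/\ differentiable u z, differentiable v z,
    'd u z (1, 0) = 'd v z (0, 1) & 'd u z (0, 1) = - 'd v z (1, 0)].

Lemma is_diff_fst (R : realType) (z : R * R) : is_diff z fst (fst : R * R -> R).
Proof.
apply: DiffDef; first by apply: linear_differentiable => ?; exact: cvg_fst.
by rewrite diff_lin// => ?; exact: cvg_fst.
Qed.

Lemma is_diff_snd (R : realType) (z : R * R) : is_diff z snd (snd : R * R -> R).
Proof.
apply: DiffDef; first by apply: linear_differentiable => ?; exact: cvg_snd.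
by rewrite diff_lin// => ?; exact: cvg_snd.
Qed.

Lemma diff_is_derive (R : realType) (V : normedModType R) (f : V -> R) (z w : V) :
  differentiable f z -> is_derive z w f ('d f z w).
Proof. by move=> df; apply: DeriveDef; [exact: diff_derivable|exact: deriveE]. Qed.

Lemma mul_solve (F : fieldType) (r p c d N : F) : r != 0 -> N = p * c + r * d ->
  d = (N - p * c) / r.
Proof. by move=> r0 ->; rewrite addrAC subrr add0r mulrAC divff// mul1r. Qed.

Lemma cauchy_curl0 (F : fieldType) (X Y u v ux uy vx vy : F) : X * X + Y * Y != 0 ->
  ux = vy -> uy = - vx ->
  (ux * X + u * 1 + vx * Y + v * 0 -
     (u * X + v * Y) * (X * X + Y * Y)^-1 * (2 * X * 1 + 2 * Y * 0)) / (X * X + Y * Y) -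
  (vy * X + v * 0 - uy * Y - u * 1 -
     (v * X - u * Y) * (X * X + Y * Y)^-1 * (2 * X * 0 + 2 * Y * 1)) / (X * X + Y * Y) = 0.
Proof. by move=> r0 -> ->; field. Qed.

Lemma leibnizB (F : comRingType) (v X u Y dv dX du dY : F) :
  dv * X + v * dX - du * Y - u * dY = v * dX + X * dv - (u * dY + Y * du).
Proof. by ring. Qed.

Lemma leibnizD (F : comRingType) (v X u Y dv dX du dY : F) :
  dv * X + v * dX + du * Y + u * dY = v * dX + X * dv + (u * dY + Y * du).
Proof. by ring. Qed.

Section cauchy_form.
Variables (R : realType) (x0 y0 : R).
Local Notation mu := (@lebesgue_measure R).
Implicit Types u v : R * R -> R.

Definition rho (z : R * R) : R := (z.1 - x0) ^+ 2 + (z.2 - y0) ^+ 2.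
(* [cauchyP u v * dx + cauchyQ u v * dy] is the imaginary part of
   [(u + i v) dz / (z - z0)]. *)
Definition cauchyP u v (z : R * R) : R := (v z * (z.1 - x0) - u z * (z.2 - y0)) * (rho z)^-1.
Definition cauchyQ u v (z : R * R) : R := (u z * (z.1 - x0) + v z * (z.2 - y0)) * (rho z)^-1.

Lemma rho_neq0 z : z != (x0, y0) -> rho z != 0.
Proof.
case: z => x y; rewrite xpair_eqE negb_and /rho /= paddr_eq0 ?sqr_ge0// negb_and !sqrf_eq0.
by rewrite !subr_eq0.
Qed.

Lemma cauchy_form u v z : holo u v -> z != (x0, y0) ->
  [/\ differentiable (cauchyP u v) z, differentiable (cauchyQ u v) z &
    'd (cauchyQ u v) z (1, 0) - 'd (cauchyP u v) z (0, 1) = 0].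
Proof.
move=> /(_ z) [du dv cr1 cr2] z0.
have [dX dXE] := is_diffB (is_diff_fst z) (is_diff_cst x0 z).
have [dY dYE] := is_diffB (is_diff_snd z) (is_diff_cst y0 z).
set X := (X in differentiable X z) in dX dXE.
set Y := (X in differentiable X z) in dY dYE.
have rE : rho = X * X + Y * Y by apply/funext => w; rewrite /rho !expr2.
have drho : differentiable rho z.
  by rewrite rE; apply: differentiableD; apply: differentiableM.
have r0 := rho_neq0 z0.
have dri : differentiable (fun z => (rho z)^-1) z by exact: differentiableV.
have dNP : differentiable (v * X - u * Y) z.
  by apply: differentiableB; apply: differentiableM.
have dNQ : differentiable (u * X + v * Y) z.
  by apply: differentiableD; apply: differentiableM.
have dP : differentiable (cauchyP u v) z by exact: (differentiableM dNP dri).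
have dQ : differentiable (cauchyQ u v) z by exact: (differentiableM dNQ dri).
split => //.
have rho0 w : rho w = 0 -> X w = 0 /\ Y w = 0.
  move=> /eqP; have [-> _|/rho_neq0/negbTE ->//] := eqVneq w (x0, y0).
  by rewrite /X /Y /= !fctE /= !subrr.
(* The derivative of the quotient is obtained from the product rule for this identity, which holds
   at the pole too because both sides vanish there. *)
have eP : cauchyP u v * rho = v * X - u * Y.
  apply/funext => w; rewrite /cauchyP !fctE.
  have [rw|rw] := eqVneq (rho w) 0; last by rewrite mulfVK.
  by have [-> ->] := rho0 _ rw; rewrite rw !mulr0 subrr.
have eQ : cauchyQ u v * rho = u * X + v * Y.
  apply/funext => w; rewrite /cauchyQ !fctE.
  have [rw|rw] := eqVneq (rho w) 0; last by rewrite mulfVK.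
  by have [-> ->] := rho0 _ rw; rewrite rw !mulr0 addr0.
have HX w : is_derive z w X w.1.
  by apply: DeriveDef; [exact: diff_derivable|rewrite deriveE// dXE !fctE subr0].
have HY w : is_derive z w Y w.2.
  by apply: DeriveDef; [exact: diff_derivable|rewrite deriveE// dYE !fctE subr0].
have Hrho w : is_derive z w rho (2 * X z * w.1 + 2 * Y z * w.2).
  rewrite rE; have H := is_deriveD (is_deriveM (HX w) (HX w)) (is_deriveM (HY w) (HY w)).
  apply: is_derive_eq H _; rewrite /GRing.scale/=; ring.
have DP w : 'd (cauchyP u v) z w = (('d v z w * X z + v z * w.1 - 'd u z w * Y z - u z * w.2)
     - cauchyP u v z * (2 * X z * w.1 + 2 * Y z * w.2)) / rho z.
  have E1 := @derive_val _ _ _ _ _ _ _ (is_deriveM (diff_is_derive w dP) (Hrho w)).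
  have E2 := @derive_val _ _ _ _ _ _ _ (is_deriveB (is_deriveM (diff_is_derive w dv) (HX w))
    (is_deriveM (diff_is_derive w du) (HY w))).
  rewrite eP E2 /GRing.scale/= in E1; apply: (mul_solve r0); rewrite -E1.
  exact: leibnizB.
have DQ w : 'd (cauchyQ u v) z w = (('d u z w * X z + u z * w.1 + 'd v z w * Y z + v z * w.2)
     - cauchyQ u v z * (2 * X z * w.1 + 2 * Y z * w.2)) / rho z.
  have E1 := @derive_val _ _ _ _ _ _ _ (is_deriveM (diff_is_derive w dQ) (Hrho w)).
  have E2 := @derive_val _ _ _ _ _ _ _ (is_deriveD (is_deriveM (diff_is_derive w du) (HX w))
    (is_deriveM (diff_is_derive w dv) (HY w))).
  rewrite eQ E2 /GRing.scale/= in E1; apply: (mul_solve r0); rewrite -E1.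
  exact: leibnizD.
apply: etrans (congr2 (fun a b => a - b) (DQ (1, 0)) (DP (0, 1))) _.
have rzE : rho z = X z * X z + Y z * Y z by rewrite rE.
rewrite rzE in r0 *; exact: (cauchy_curl0 _ _ r0 cr1 cr2).
Qed.

End cauchy_form.

(** * Contour integrals of the Cauchy kernel *)

Lemma integrable_subr d (T : measurableType d) (R : realType)
    (mu : {measure set T -> \bar R}) (A : set T) (f g : T -> R) : measurable A ->
  mu.-integrable A (EFin \o f) -> mu.-integrable A (EFin \o g) ->
  mu.-integrable A (EFin \o (fun x => f x - g x)).
Proof.
move=> mA intf intg.
rewrite (_ : _ \o _ = (EFin \o f) \- (EFin \o g))%E; last exact/funext.
exact: integrableB.
Qed.

Section cauchy_estimate.
Variables (R : realType) (x0 y0 : R).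
Local Notation mu := (@lebesgue_measure R).
Local Notation mu2 := (sfprod mu mu).
Local Notation LR := (measurableTypeR R).
Implicit Types u v P Q : R * R -> R.

Lemma bnd_splitx P Q (a e b c d : R) : a <= e -> e <= b ->
  mu.-integrable `]a, b] (EFin \o (fun x => P (x, c))) ->
  mu.-integrable `]a, b] (EFin \o (fun x => P (x, d))) ->
  boundary_int P Q a b c d = boundary_int P Q a e c d + boundary_int P Q e b c d.
Proof.
move=> ae eb ic id; rewrite /boundary_int (itvoc_split ae eb ic) (itvoc_split ae eb id).
by ring.
Qed.

Lemma bnd_splity P Q (a b c e d : R) : c <= e -> e <= d ->
  mu.-integrable `]c, d] (EFin \o (fun y => Q (a, y))) ->
  mu.-integrable `]c, d] (EFin \o (fun y => Q (b, y))) ->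
  boundary_int P Q a b c d = boundary_int P Q a b c e + boundary_int P Q a b e d.
Proof.
move=> ce ed ia ib; rewrite /boundary_int (itvoc_split ce ed ia) (itvoc_split ce ed ib).
by ring.
Qed.

Lemma cauchyP_integrable u v (a b c : R) : holo u v -> c != y0 ->
  mu.-integrable `]a, b] (EFin \o (fun x => cauchyP x0 y0 u v (x, c))).
Proof.
move=> huv cy; apply: itvoc_cont_integrable => x _.
have [|/differentiable_continuous cF _ _] := @cauchy_form R x0 y0 u v (x, c) huv.
  by rewrite xpair_eqE negb_and cy orbT.
apply: (@continuous_comp R (R * R)%type R (fun x => (x, c)) _ x) => //.
exact: (cvg_pair cvg_id (cvg_cst _)).
Qed.

Lemma cauchyQ_integrable u v (c d a : R) : holo u v -> a != x0 ->
  mu.-integrable `]c, d] (EFin \o (fun y => cauchyQ x0 y0 u v (a, y))).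
Proof.
move=> huv ax; apply: itvoc_cont_integrable => y _.
have [|_ /differentiable_continuous cF _] := @cauchy_form R x0 y0 u v (a, y) huv.
  by rewrite xpair_eqE negb_and ax.
apply: (@continuous_comp R (R * R)%type R (fun y => (a, y)) _ y) => //.
exact: (cvg_pair (cvg_cst _) cvg_id).
Qed.

Local Notation cauchy_boundary u v := (boundary_int (cauchyP x0 y0 u v) (cauchyQ x0 y0 u v)).

Lemma bnd_cauchy0 u v (a b c d : R) : holo u v -> a < b -> c < d ->
  [\/ b < x0, x0 < a, d < y0 | y0 < c] -> cauchy_boundary u v a b c d = 0.
Proof.
move=> huv ab cd out.
have n0 z : box a b c d z -> z != (x0, y0).
  move=> [/andP[z1 z2] /andP[z3 z4]]; apply/eqP => zE; move: z1 z2 z3 z4; rewrite zE /=.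
  move: out => [h|h|h|h]; lra.
rewrite (@green_rect _ _ _ (cst 0))//.
- by rewrite /rect_int Rintegral_cst// ?mul0r//; apply: measurableX; exact: measurable_itv.
- by move=> z /n0/(cauchy_form huv)[].
- by move=> z /n0/(cauchy_form huv)[].
- by move=> z /n0/(cauchy_form huv)[].
- by move=> z _; exact: cvg_cst.
- exact: (@integrable0 _ _ _ mu2).
Qed.

(** The strips to the left, to the right, below and above are cut off in turn. None of them contains
    the pole, so each has contour integral 0. *)
Lemma bnd_cauchy_shrink u v (a a' b' b c c' d' d : R) : holo u v ->
  a < a' -> a' < x0 -> x0 < b' -> b' < b ->
  c < c' -> c' < y0 -> y0 < d' -> d' < d ->
  cauchy_boundary u v a b c d = cauchy_boundary u v a' b' c' d'.
Proof.
move=> huv aa ax xb bb cc cy yd dd.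
have cy0 : c != y0 by rewrite lt_eqF// (lt_trans cc).
have dy0 : d != y0 by rewrite gt_eqF// (lt_trans _ dd).
have ax0 : a' != x0 by rewrite lt_eqF.
have bx0 : b' != x0 by rewrite gt_eqF.
have ab' : a' < b' by exact: lt_trans xb.
have cd' : c' < d' by exact: lt_trans yd.
have cd : c < d by rewrite (lt_trans cc)// (lt_trans cd').
rewrite (@bnd_splitx _ _ a a' b); [|by lra|by lra|exact: cauchyP_integrable..].
rewrite (@bnd_cauchy0 u v a a')//; last exact: Or41.
rewrite (@bnd_splitx _ _ a' b' b); [|by lra|by lra|exact: cauchyP_integrable..].
rewrite (@bnd_cauchy0 u v b' b)//; last exact: Or42.
rewrite (@bnd_splity _ _ a' b' c c' d); [|by lra|by lra|exact: cauchyQ_integrable..].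
rewrite (@bnd_cauchy0 u v a' b' c c')//; last exact: Or43.
rewrite (@bnd_splity _ _ a' b' c' d' d); [|by lra|by lra|exact: cauchyQ_integrable..].
rewrite (@bnd_cauchy0 u v a' b' d' d)//; last exact: Or44.
by rewrite !add0r !addr0.
Qed.

Lemma Rintegral_itvoc_ge (f : R -> R) (a b m : R) : a <= b ->
  mu.-integrable `]a, b] (EFin \o f) -> (forall x, a <= x <= b -> m <= f x) ->
  m * (b - a) <= \int[mu]_(x in `]a, b]) f x.
Proof.
move=> ab intf mf.
have -> : m * (b - a) = \int[mu]_(x in `]a, b]) m.
  by rewrite Rintegral_cst// [X in fine X](mu_itvoc ab).
apply: le_Rintegral => //.
  apply: measurable_bounded_integrable => //; last exact: bounded_cst.
  by rewrite [ltLHS](mu_itvoc ab) ltry.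
by move=> x /=; rewrite in_itv/= => /andP[/ltW xa xb]; apply: mf; rewrite xa.
Qed.

(** Pairs the kernel at opposite points of the small square: the [v] terms cancel up to [U / 2 * e],
    the [u] terms add up to at least [3 / 2 * U * e], and the denominator is at most
    [2 * e ^+ 2]. *)
Lemma small_arith (e t U V uR uL vR vL : R) : 0 < e -> `|t| <= e -> 0 < U ->
  `|uR - U| <= U / 4 -> `|uL - U| <= U / 4 -> `|vR - V| <= U / 4 -> `|vL - V| <= U / 4 ->
  U / (2 * e) <= (uR * e + vR * t) * (e ^+ 2 + t ^+ 2)^-1 - (vL * t - uL * e) * (e ^+ 2 + t ^+ 2)^-1.
Proof.
move=> e0 te U0 h1 h2 h3 h4.
have t2 : t ^+ 2 <= e ^+ 2.
  by rewrite -(real_normK (num_real t)) lerXn2r ?nnegrE// ltW.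
have r0 : 0 < e ^+ 2 + t ^+ 2 by rewrite ltr_wpDr ?sqr_ge0// exprn_gt0.
rewrite -mulrBl ler_pdivlMr// mulrAC ler_pdivrMr ?mulr_gt0//.
have A : e * U <= uR * e + vR * t - (vL * t - uL * e).
  have B : (vL - vR) * t <= (U / 2) * e.
    apply: le_trans (ler_norm _) _; rewrite normrM; apply: ler_pM => //.
    rewrite (_ : vL - vR = (vL - V) - (vR - V)); last by ring.
    apply: le_trans (ler_normB _ _) _; lra.
  move: h1 h2; rewrite !ler_norml => /andP[h1 _] /andP[h2 _].
  have := ler_wpM2l (ltW e0) h1; have := ler_wpM2l (ltW e0) h2; lra.
apply: (@le_trans _ _ (U * (2 * e ^+ 2))).
  by rewrite ler_wpM2l ?(ltW U0)//; lra.
rewrite (_ : U * _ = (e * U) * (2 * e)); last by ring.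
by rewrite ler_wpM2r// mulr_ge0// ltW.
Qed.

(** The exact limit over small squares is 2 pi times [u] at the centre. The weaker factor 2 needs no
    trigonometric integral: each of the two pairs of opposite sides has length [2 * e] and paired
    integrand at least [u / (2 * e)]. *)
Lemma bnd_cauchy_small u v (r : R) : holo u v -> 0 < u (x0, y0) -> 0 < r ->
  exists2 e, 0 < e < r &
    2 * u (x0, y0) <= cauchy_boundary u v (x0 - e) (x0 + e) (y0 - e) (y0 + e).
Proof.
move=> huv u0 r0; have [du dv _ _] := huv (x0, y0).
have u40 : 0 < u (x0, y0) / 4 by rewrite divr_gt0.
have : \forall z \near (x0, y0), `|u z - u (x0, y0)| <= u (x0, y0) / 4 /\
    `|v z - v (x0, y0)| <= u (x0, y0) / 4.
  apply: filterI.
    have /cvgrPdist_le/(_ _ u40) := differentiable_continuous du.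
    by apply: filterS => z; rewrite distrC.
  have /cvgrPdist_le/(_ _ u40) := differentiable_continuous dv.
  by apply: filterS => z; rewrite distrC.
move=> /nbhs_ballP[r1 /= r10 hr1].
pose e := Num.min (r / 2) (r1 / 2).
have e0 : 0 < e by rewrite lt_min !divr_gt0.
exists e; first by rewrite e0 /e gt_min ltr_pdivrMr// ltr_pMr// ltr1n.
have er1 : e < r1 by rewrite /e gt_min orbC ltr_pdivrMr// ltr_pMr// ltr1n.
have near_ x y : `|x - x0| <= e -> `|y - y0| <= e ->
    `|u (x, y) - u (x0, y0)| <= u (x0, y0) / 4 /\ `|v (x, y) - v (x0, y0)| <= u (x0, y0) / 4.
  move=> hx hy; apply: hr1; split => /=; rewrite /ball/= distrC; exact: le_lt_trans er1.
have xR : (x0 + e) - x0 = e by ring.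
have xL : (x0 - e) - x0 = - e by ring.
have yR : (y0 + e) - y0 = e by ring.
have yL : (y0 - e) - y0 = - e by ring.
have ne : `|e| <= e by rewrite ger0_norm// ltW.
have nNe : `|- e| <= e by rewrite normrN.
have nxR : `|x0 + e - x0| <= e by rewrite xR.
have nxL : `|x0 - e - x0| <= e by rewrite xL.
have nyR : `|y0 + e - y0| <= e by rewrite yR.
have nyL : `|y0 - e - y0| <= e by rewrite yL.
have xRn : x0 + e != x0 by rewrite -subr_eq0 xR gt_eqF.
have xLn : x0 - e != x0 by rewrite -subr_eq0 xL oppr_eq0 gt_eqF.
have yRn : y0 + e != y0 by rewrite -subr_eq0 yR gt_eqF.
have yLn : y0 - e != y0 by rewrite -subr_eq0 yL oppr_eq0 gt_eqF.
rewrite /boundary_int -RintegralB//; [|exact: cauchyP_integrable..].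
rewrite -RintegralB//; [|exact: cauchyQ_integrable..].
have len (x : R) : x + e - (x - e) = 2 * e by ring.
have half : u (x0, y0) = u (x0, y0) / (2 * e) * (2 * e) by rewrite mulfVK// gt_eqF// mulr_gt0.
rewrite mulr2n mulrDl mul1r lerD//.
  rewrite [leLHS]half -(len x0); apply: Rintegral_itvoc_ge; first by lra.
    by apply: integrable_subr => //; exact: cauchyP_integrable.
  move=> x /andP[hx1 hx2]; rewrite len.
  have hx : `|x - x0| <= e by rewrite ler_distl hx1.
  have [h1 h2] := near_ x (y0 - e) hx nyL.
  have [h3 h4] := near_ x (y0 + e) hx nyR.
  apply: le_trans (small_arith e0 hx u0 h1 h3 h2 h4) _.
  rewrite /cauchyP /rho /= yL yR sqrrN [e ^+ 2 + _]addrC mulrN opprK.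
  by rewrite [X in X * _ - _]addrC.
rewrite [leLHS]half -(len y0); apply: Rintegral_itvoc_ge; first by lra.
  by apply: integrable_subr => //; exact: cauchyQ_integrable.
move=> y /andP[hy1 hy2]; rewrite len.
have hy : `|y - y0| <= e by rewrite ler_distl hy1.
have [h1 h2] := near_ (x0 + e) y nxR hy.
have [h3 h4] := near_ (x0 - e) y nxL hy.
apply: le_trans (small_arith e0 hy u0 h1 h3 h2 h4) _.
rewrite /cauchyQ /rho /= xL xR sqrrN mulrN.
by rewrite [X in _ - X * _]addrC.
Qed.

Lemma cauchy_kernel_le (a b X Y r : R) : 0 < r -> r <= `|X| ->
  `|(a * X + b * Y) * (X ^+ 2 + Y ^+ 2)^-1| <= r^-1 * (`|a| + `|b|).
Proof.
move=> r0 rX.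
have X0 : 0 < `|X| by exact: lt_le_trans rX.
have q0 : 0 < X ^+ 2 + Y ^+ 2 by rewrite ltr_wpDr ?sqr_ge0// -real_normK ?num_real// exprn_gt0.
rewrite normrM normfV (gtr0_norm q0) ler_pdivrMr// mulrAC -mulrA ler_pdivlMl//.
apply: le_trans (ler_wpM2l (ltW r0) (ler_normD _ _)) _.
rewrite !normrM mulrDr [leRHS]mulrC mulrDl.
have q1 : r * `|X| <= X ^+ 2 + Y ^+ 2.
  apply: le_trans (ler_wpM2r (normr_ge0 _) rX) _.
  by rewrite -expr2 real_normK ?num_real// lerDl sqr_ge0.
have q2 : r * `|Y| <= X ^+ 2 + Y ^+ 2.
  apply: le_trans (ler_wpM2r (normr_ge0 _) rX) _.
  rewrite -(real_normK (num_real X)) -(real_normK (num_real Y)).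
  have := sqr_ge0 (`|X| - `|Y|); have := sqr_ge0 (`|X|); have := sqr_ge0 (`|Y|); rewrite sqrrB; lra.
by apply: lerD; rewrite mulrCA ler_wpM2l.
Qed.

End cauchy_estimate.

(** * From contour integrals to area means *)

Section cauchy_area.
Variable R : realType.
Local Notation mu := (@lebesgue_measure R).
Local Notation mu2 := (sfprod mu mu).
Local Notation LR := (measurableTypeR R).
Implicit Types u v : R * R -> R.

Lemma line_bound (f W : R -> R) (A : set R) (r : R) : 0 < r -> measurable A ->
  mu.-integrable A (EFin \o f) -> (forall x, A x -> `|f x| <= r^-1 * W x) ->
  (forall x, 0 <= W x) -> measurable_fun setT W ->
  ((`|\int[mu]_(x in A) f x|)%:E <= (r^-1)%:E * \int[mu]_x (W x)%:E)%E.
Proof.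
move=> r0 mA intf fW W0 mW.
have mfA : measurable_fun A f by apply/measurable_EFinP; case/integrableP : intf.
rewrite EFin_normr_Rintegral//.
apply: le_trans; first by apply: le_abse_integral => //; exact/measurable_EFinP.
have mWE : measurable_fun setT (fun x => (W x)%:E) by exact/measurable_EFinP.
have r1 : (0 <= (r^-1)%:E)%E by rewrite lee_fin invr_ge0 ltW.
rewrite -ge0_integralZl//; last by move=> x _; rewrite lee_fin.
apply: (@le_trans _ _ (\int[mu]_(x in A) ((r^-1)%:E * (W x)%:E))%E).
  apply: ge0_le_integral => //.
  - by apply: measurableT_comp => //; exact/measurable_EFinP.
  - apply: measurable_funeM; exact: measurable_funTS.
apply: ge0_subset_integral => //; first exact: measurable_funeM.
by move=> x _; rewrite mule_ge0// lee_fin.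
Qed.

(** [s] stands for the sides other than the one being averaged; it may be infinite, or already
    exceed [K], and these cases are settled separately. *)
Lemma average_bound (V : R -> \bar R) (a r K : R) (s : \bar R) : 0 < r ->
  (forall x, (0 <= V x)%E) -> measurable_fun setT V -> (0 <= s)%E ->
  (forall x, a <= x <= a + r -> (K%:E <= V x + s)%E) ->
  (K%:E <= (r^-1)%:E * \int[mu]_x V x + s)%E.
Proof.
move=> r0 V0 mV s0 KV.
have iV0 : (0 <= \int[mu]_x V x)%E by exact: integral_ge0.
have ab : a <= a + r by rewrite lerDl ltW.
case: s s0 KV => [s| |] // s0 KV; last first.
  by rewrite addey ?leey// gt_eqF// (lt_le_trans (ltNyr 0))// mule_ge0// lee_fin invr_ge0 ltW.
have [Ks|sK] := leP K s.
  by rewrite (le_trans (_ : _ <= s%:E)%E) ?lee_fin// leeDr// mule_ge0// lee_fin invr_ge0 ltW.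
rewrite -leeBlDr// -EFinB -[(K - s)%:E]mul1e -[X in (X%:E * _)%E](@mulVf _ r) ?gt_eqF//.
rewrite EFinM -muleA lee_pmul2l// ?lte_fin ?invr_gt0//.
have -> : (r%:E * (K - s)%:E = \int[mu]_(x in `]a, (a + r)%R]) (K - s)%:E)%E.
  have muE : mu `]a, (a + r)%R] = r%:E by rewrite (mu_itvoc ab) addrAC subrr add0r.
  by rewrite integral_cst//; apply: etrans (congr1 (mule (K - s)%:E) (esym muE)); rewrite muleC.
apply: (@le_trans _ _ (\int[mu]_(x in `]a, (a + r)%R]) V x)%E).
  apply: ge0_le_integral => //.
  - by move=> x _; rewrite lee_fin subr_ge0 ltW.
  - exact: measurable_funTS.
  - move=> x /=; rewrite in_itv/= => /andP[/ltW xa xb].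
    by rewrite EFinB leeBlDr// KV// xa.
exact: ge0_subset_integral.
Qed.

Definition sq_box (x0 y0 r : R) : set (LR * LR) :=
  `[x0 - 2 * r, x0 + 2 * r] `*` `[y0 - 2 * r, y0 + 2 * r].

Lemma diffN_val u z w : differentiable u z -> 'd (- u) z w = - 'd u z w.
Proof. by move=> du; rewrite diffN. Qed.

Lemma holoN u v : holo u v -> holo (- u) (- v).
Proof.
move=> huv z; have [du dv c1 c2] := huv z.
split; [exact: differentiableN|exact: differentiableN|..].
  exact: etrans (diffN_val _ du) (etrans (congr1 -%R c1) (esym (diffN_val _ dv))).
apply: etrans (diffN_val _ du) _; congr (- _).
exact: etrans c2 (esym (diffN_val _ dv)).
Qed.

Lemma holo_rot u v : holo u v -> holo v (- u).
Proof.
move=> huv z; have [du dv c1 c2] := huv z.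
split; [exact: dv|exact: differentiableN|..].
  exact: etrans (esym (opprK _)) (etrans (congr1 -%R (esym c2)) (esym (diffN_val _ du))).
have E := diffN_val (1, 0) du.
by rewrite -c1 -[LHS]opprK; congr (- _); exact: esym E.
Qed.

Lemma cauchy_sides u v (x0 y0 r a b c d : R) : holo u v -> 0 < r -> 0 < u (x0, y0) ->
  a <= x0 - r -> x0 + r <= b -> c <= y0 - r -> y0 + r <= d ->
  2 * u (x0, y0) <= `|\int[mu]_(y in `]c, d]) cauchyQ x0 y0 u v (b, y)| +
    (`|\int[mu]_(y in `]c, d]) cauchyQ x0 y0 u v (a, y)| +
    (`|\int[mu]_(x in `]a, b]) cauchyP x0 y0 u v (x, c)| +
     `|\int[mu]_(x in `]a, b]) cauchyP x0 y0 u v (x, d)|)).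
Proof.
move=> huv r0 u0 ha hb hc hd.
have [e /andP[e0 er] he] := bnd_cauchy_small huv u0 r0.
have a1 : a < x0 - e by lra.
have a2 : x0 - e < x0 by lra.
have b2 : x0 < x0 + e by lra.
have b1 : x0 + e < b by lra.
have c1 : c < y0 - e by lra.
have c2 : y0 - e < y0 by lra.
have d2 : y0 < y0 + e by lra.
have d1 : y0 + e < d by lra.
rewrite -(bnd_cauchy_shrink huv a1 a2 b2 b1 c1 c2 d2 d1) in he.
apply: le_trans he _; rewrite /boundary_int addrC.
apply: le_trans (ler_norm _) _; apply: le_trans (ler_normD _ _) _.
apply: le_trans (lerD (ler_normB _ _) (ler_normB _ _)) _.
by rewrite -addrA.
Qed.

(** The cut-off lets a side of the contour be bounded by an integral over the whole line carrying
    it. That bound depends only on the position of the line, so averaging over positions yields the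
    area integral. *)
Definition cauchy_W u v (x0 y0 r : R) (z : R * R) : R :=
  (`|u z| + `|v z|) * \1_(sq_box x0 y0 r) z.

Lemma cauchy_W_ge0 u v x0 y0 r z : 0 <= cauchy_W u v x0 y0 r z.
Proof. by rewrite mulr_ge0 ?addr_ge0. Qed.

Lemma cauchy_WE u v x0 y0 r x y : x0 - 2 * r <= x <= x0 + 2 * r ->
  y0 - 2 * r <= y <= y0 + 2 * r -> cauchy_W u v x0 y0 r (x, y) = `|u (x, y)| + `|v (x, y)|.
Proof.
by move=> hx hy; rewrite /cauchy_W indicE mem_set ?mulr1//; split; rewrite /= in_itv.
Qed.

Lemma measurable_cauchy_W u v x0 y0 r : holo u v ->
  measurable_fun setT (cauchy_W u v x0 y0 r : LR * LR -> R).
Proof.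
move=> huv; apply: measurable_funM.
  have cu : continuous u by move=> z; apply: differentiable_continuous; have [] := huv z.
  have cv : continuous v by move=> z; apply: differentiable_continuous; have [] := huv z.
  by apply: measurable_funD; apply: measurableT_comp => //; exact: continuous_measurable_pair.
by apply: measurable_indic; apply: measurableX; exact: measurable_itv.
Qed.

Lemma cauchyQ_line u v (x0 y0 r x c d : R) : holo u v -> 0 < r -> r <= `|x - x0| ->
  x0 - 2 * r <= x <= x0 + 2 * r -> y0 - 2 * r <= c -> d <= y0 + 2 * r ->
  ((`|\int[mu]_(y in `]c, d]) cauchyQ x0 y0 u v (x, y)|)%:E <=
   (r^-1)%:E * \int[mu]_y (cauchy_W u v x0 y0 r (x, y))%:E)%E.
Proof.
move=> huv r0 rx hx hc hd.
have xx0 : x != x0.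
  by rewrite -subr_eq0 -normr_gt0 (lt_le_trans r0).
apply: (line_bound r0 _ (cauchyQ_integrable _ _ _ huv xx0)).
- exact: measurable_itv.
- move=> y /=; rewrite in_itv/= => /andP[/ltW y1 y2].
  rewrite cauchy_WE//; last by rewrite (le_trans hc)// (le_trans y2).
  by rewrite /cauchyQ /rho /=; exact: cauchy_kernel_le.
- by move=> y; exact: cauchy_W_ge0.
- exact: (measurable_fun_pair2 x (measurable_cauchy_W x0 y0 r huv)).
Qed.

Lemma cauchyP_line u v (x0 y0 r y a b : R) : holo u v -> 0 < r -> r <= `|y - y0| ->
  y0 - 2 * r <= y <= y0 + 2 * r -> x0 - 2 * r <= a -> b <= x0 + 2 * r ->
  ((`|\int[mu]_(x in `]a, b]) cauchyP x0 y0 u v (x, y)|)%:E <=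
   (r^-1)%:E * \int[mu]_x (cauchy_W u v x0 y0 r (x, y))%:E)%E.
Proof.
move=> huv r0 ry hy ha hb.
have yy0 : y != y0.
  by rewrite -subr_eq0 -normr_gt0 (lt_le_trans r0).
apply: (line_bound r0 _ (cauchyP_integrable _ _ _ huv yy0)).
- exact: measurable_itv.
- move=> x /=; rewrite in_itv/= => /andP[/ltW x1 x2].
  rewrite cauchy_WE//; last by rewrite (le_trans ha)// (le_trans x2).
  rewrite /cauchyP /rho /= -mulNr addrC [_ ^+ 2 + _]addrC -(normrN (u (x, y))).
  exact: cauchy_kernel_le.
- by move=> x; exact: cauchy_W_ge0.
- exact: (measurable_fun_pair1 y (measurable_cauchy_W x0 y0 r huv)).
Qed.

Lemma cauchy_main u v (x0 y0 r a b c d : R) : holo u v -> 0 < r -> 0 < u (x0, y0) ->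
  x0 - 2 * r <= a <= x0 - r -> x0 + r <= b <= x0 + 2 * r ->
  y0 - 2 * r <= c <= y0 - r -> y0 + r <= d <= y0 + 2 * r ->
  ((2 * u (x0, y0))%:E <= (r^-1)%:E * \int[mu]_y (cauchy_W u v x0 y0 r (b, y))%:E +
   ((r^-1)%:E * \int[mu]_y (cauchy_W u v x0 y0 r (a, y))%:E +
   ((r^-1)%:E * \int[mu]_x (cauchy_W u v x0 y0 r (x, c))%:E +
    (r^-1)%:E * \int[mu]_x (cauchy_W u v x0 y0 r (x, d))%:E)))%E.
Proof.
move=> huv r0 u0 /andP[a1 a2] /andP[b1 b2] /andP[c1 c2] /andP[d1 d2].
have ra : r <= `|a - x0| by rewrite ler0_norm ?opprB; lra.
have rb : r <= `|b - x0| by rewrite ger0_norm; lra.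
have rc : r <= `|c - y0| by rewrite ler0_norm ?opprB; lra.
have rd : r <= `|d - y0| by rewrite ger0_norm; lra.
have ia : x0 - 2 * r <= a <= x0 + 2 * r by apply/andP; split; lra.
have ib : x0 - 2 * r <= b <= x0 + 2 * r by apply/andP; split; lra.
have ic : y0 - 2 * r <= c <= y0 + 2 * r by apply/andP; split; lra.
have id : y0 - 2 * r <= d <= y0 + 2 * r by apply/andP; split; lra.
apply: le_trans (leeD (cauchyQ_line huv r0 rb ib c1 d2)
  (leeD (cauchyQ_line huv r0 ra ia c1 d2)
  (leeD (cauchyP_line huv r0 rc ic a1 b2) (cauchyP_line huv r0 rd id a1 b2)))).
have := cauchy_sides huv r0 u0 a2 b1 c2 d1.
by rewrite -!EFinD lee_fin.
Qed.

(* Average [cauchy_main] over [a], [b], [c], [d]: the four sides sweep the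
   region between the squares of half-sides [r] and [2 * r]. *)
Lemma cauchy_area_pos u v (x0 y0 r : R) : holo u v -> 0 < r -> 0 < u (x0, y0) ->
  ((u (x0, y0))%:E <= (2 / r ^+ 2)%:E *
    \int[mu]_x \int[mu]_y (cauchy_W u v x0 y0 r (x, y))%:E)%E.
Proof.
move=> huv r0 u0.
set W := cauchy_W u v x0 y0 r.
have W0 z : 0 <= W z by exact: cauchy_W_ge0.
have mW := measurable_cauchy_W x0 y0 r huv.
have mWE : measurable_fun setT (EFin \o (W : LR * LR -> R)) by exact/measurable_EFinP.
pose T := (\int[mu]_x \int[mu]_y (W (x, y))%:E)%E.
have TE : T = (\int[mu]_y \int[mu]_x (W (x, y))%:E)%E.
  by apply: (@fubini_tonelli _ _ LR LR R mu mu _ mWE) => z; rewrite lee_fin.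
pose V x := ((r^-1)%:E * \int[mu]_y (W (x, y))%:E)%E.
pose H y := ((r^-1)%:E * \int[mu]_x (W (x, y))%:E)%E.
have r1 : (0 <= (r^-1)%:E)%E by rewrite lee_fin invr_ge0 ltW.
have WE0 z : (0 <= (W z)%:E)%E by rewrite lee_fin.
have VV0 x : (0 <= \int[mu]_y (W (x, y))%:E)%E by apply: integral_ge0 => y _; exact: WE0.
have HH0 y : (0 <= \int[mu]_x (W (x, y))%:E)%E by apply: integral_ge0 => x _; exact: WE0.
have V0 x : (0 <= V x)%E by apply: mule_ge0; [exact: r1|exact: VV0].
have H0 y : (0 <= H y)%E by apply: mule_ge0; [exact: r1|exact: HH0].
have mV0 : measurable_fun setT (fun x : LR => \int[mu]_y (W (x, y))%:E)%E.
  exact: (measurable_fun_fubini_tonelli_F _ mWE).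
have mH0 : measurable_fun setT (fun y : LR => \int[mu]_x (W (x, y))%:E)%E.
  exact: (measurable_fun_fubini_tonelli_G _ mWE).
have mV : measurable_fun setT V by exact: measurable_funeM.
have mH : measurable_fun setT H by exact: measurable_funeM.
have iV : (\int[mu]_x V x = (r^-1)%:E * T)%E.
  apply: ge0_integralZl; [exact: measurableT|exact: mV0|by move=> x _; exact: VV0|exact: r1].
have iH : (\int[mu]_y H y = (r^-1)%:E * T)%E.
  rewrite TE; apply: ge0_integralZl;
    [exact: measurableT|exact: mH0|by move=> y _; exact: HH0|exact: r1].
have main a b c d : x0 - 2 * r <= a <= x0 - r -> x0 + r <= b <= x0 + 2 * r ->
    y0 - 2 * r <= c <= y0 - r -> y0 + r <= d <= y0 + 2 * r ->
    ((2 * u (x0, y0))%:E <= V b + (V a + (H c + H d)))%E.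
  exact: cauchy_main.
have T0 : (0 <= T)%E by apply: integral_ge0 => x _; exact: VV0.
change ((u (x0, y0))%:E <= (2 / r ^+ 2)%:E * T)%E.
clearbody T.
(* Each of the four averagings replaces one side by [t], that is [T / r ^+ 2]; the outcome is
   [2 * u <= 4 * t]. *)
pose t := ((r^-1)%:E * ((r^-1)%:E * T))%E.
have t0 : (0 <= t)%E by apply: mule_ge0; [exact: r1|apply: mule_ge0; [exact: r1|exact: T0]].
have avV a K s : (0 <= s)%E -> (forall x, a <= x <= a + r -> (K%:E <= V x + s)%E) ->
    (K%:E <= t + s)%E.
  by move=> s0 Vs; rewrite /t -iV; exact: average_bound Vs.
have avH a K s : (0 <= s)%E -> (forall x, a <= x <= a + r -> (K%:E <= H x + s)%E) ->
    (K%:E <= t + s)%E.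
  by move=> s0 Vs; rewrite /t -iH; exact: average_bound Vs.
have itv1 s x : s - 2 * r <= x <= s - 2 * r + r -> s - 2 * r <= x <= s - r.
  by move=> /andP[? ?]; apply/andP; split; lra.
have itv2 s x : s + r <= x <= s + r + r -> s + r <= x <= s + 2 * r.
  by move=> /andP[? ?]; apply/andP; split; lra.
have s1 a c d : x0 - 2 * r <= a <= x0 - r -> y0 - 2 * r <= c <= y0 - r ->
    y0 + r <= d <= y0 + 2 * r -> ((2 * u (x0, y0))%:E <= t + (V a + (H c + H d)))%E.
  move=> ha hc hd; apply: (avV (x0 + r)) => [|b /itv2 hb]; first by rewrite !adde_ge0.
  exact: main.
have s2 c d : y0 - 2 * r <= c <= y0 - r -> y0 + r <= d <= y0 + 2 * r ->
    ((2 * u (x0, y0))%:E <= t + (t + (H c + H d)))%E.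
  move=> hc hd; apply: (avV (x0 - 2 * r)) => [|a /itv1 ha]; first by rewrite !adde_ge0.
  by rewrite addeCA; exact: s1.
have s3 d : y0 + r <= d <= y0 + 2 * r -> ((2 * u (x0, y0))%:E <= t + (t + (t + H d)))%E.
  move=> hd; apply: (avH (y0 - 2 * r)) => [|c /itv1 hc]; first by rewrite !adde_ge0.
  by move: (s2 c d hc hd); rewrite addeA addeCA -addeA.
have h : ((2 * u (x0, y0))%:E <= t + (t + (t + t)))%E.
  apply: (avH (y0 + r)) => [|d /itv2 hd]; first by rewrite !adde_ge0.
  by rewrite addeC -!addeA; exact: s3.
have -> : ((2 / r ^+ 2)%:E * T = t + t)%E.
  rewrite /t muleA -EFinM -ge0_muleDl ?lee_fin ?mulr_ge0// -EFinD; congr (_%:E * _)%E.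
  by rewrite expr2 invfM mulr2n mulrDl mul1r.
have : ((2 * u (x0, y0))%:E <= 2%:E * (t + t))%E.
  by rewrite (_ : 2%:E = 1%:E + 1%:E :> \bar R)%E// ge0_muleDl// !mul1e -addeA.
by rewrite EFinM lee_pmul2l// lte_fin.
Qed.

Lemma cauchy_area u v (x0 y0 r : R) : holo u v -> 0 < r ->
  ((`|u (x0, y0)|)%:E <= (2 / r ^+ 2)%:E *
    \int[mu]_x \int[mu]_y (cauchy_W u v x0 y0 r (x, y))%:E)%E.
Proof.
move=> huv r0; have [u0|u0|u0] := ltgtP (u (x0, y0)) 0.
- have := @cauchy_area_pos (- u) (- v) x0 y0 r (holoN huv) r0.
  rewrite !fctE ltr0_norm// oppr_gt0 => /(_ u0).
  rewrite (_ : cauchy_W (- u) (- v) x0 y0 r = cauchy_W u v x0 y0 r)//.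
  apply/funext => z; rewrite /cauchy_W -[(- u) z]/(- u z) -[(- v) z]/(- v z).
  by rewrite !normrN.
- by rewrite gtr0_norm//; exact: cauchy_area_pos.
- rewrite u0 normr0; apply: mule_ge0.
    by rewrite lee_fin divr_ge0// exprn_ge0// ltW.
  apply: integral_ge0 => x _; apply: integral_ge0 => y _.
  by rewrite lee_fin cauchy_W_ge0.
Qed.

Lemma cr_sqr1 (a b ux uy vx vy : R) : ux = vy -> uy = - vx ->
  2 * (a * ux - b * vx) = 2 * (a * vy + b * uy).
Proof. by move=> -> ->; rewrite mulrN. Qed.

Lemma cr_sqr2 (a b ux uy vx vy : R) : ux = vy -> uy = - vx ->
  2 * (a * uy - b * vy) = - (2 * (a * vx + b * ux)).
Proof. by move=> -> ->; ring. Qed.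

Lemma leibniz_sqr (a b da db : R) :
  a * da + a * da - (b * db + b * db) = 2 * (a * da - b * db).
Proof. by ring. Qed.

Lemma holo_sqr u v : holo u v -> holo (u * u - v * v) (2 *: (u * v)).
Proof.
move=> huv z; have [du dv c1 c2] := huv z.
have duu : differentiable (u * u) z by exact: differentiableM.
have dvv : differentiable (v * v) z by exact: differentiableM.
have duv : differentiable (u * v) z by exact: differentiableM.
have E1 w : 'd (u * u - v * v) z w = 2 * (u z * 'd u z w - v z * 'd v z w).
  apply: etrans (esym (deriveE w (differentiableB duu dvv))) _.
  have H := is_deriveB (is_deriveM (diff_is_derive w du) (diff_is_derive w du))
     (is_deriveM (diff_is_derive w dv) (diff_is_derive w dv)).
  exact: etrans (@derive_val _ _ _ _ _ _ _ H) (leibniz_sqr _ _ _ _).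
have E2 w : 'd (2 *: (u * v)) z w = 2 * (u z * 'd v z w + v z * 'd u z w).
  apply: etrans (esym (deriveE w (differentiableZ 2 duv))) _.
  have H := is_deriveZ 2 (is_deriveM (diff_is_derive w du) (diff_is_derive w dv)).
  exact: (@derive_val _ _ _ _ _ _ _ H).
split; [exact: differentiableB|exact: differentiableZ|..].
  exact: etrans (E1 _) (etrans (cr_sqr1 _ _ c1 c2) (esym (E2 _))).
exact: etrans (E1 _) (etrans (cr_sqr2 _ _ c1 c2) (congr1 -%R (esym (E2 _)))).
Qed.

(** This is |f|^2 = |f^2| <= |Re f^2| + |Im f^2|. Squaring the holomorphic function passes from
    first to second powers without an inequality between means. *)
Lemma sqr_add_le (a b : R) : a ^+ 2 + b ^+ 2 <= `|a * a - b * b| + `|2 * (a * b)|.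
Proof.
rewrite -ler_sqr ?nnegrE ?addr_ge0 ?sqr_ge0// [leRHS]sqrrD !real_normK ?num_real//.
have h : 0 <= `|a * a - b * b| * `|2 * (a * b)| by rewrite mulr_ge0.
have -> : (a ^+ 2 + b ^+ 2) ^+ 2 = (a * a - b * b) ^+ 2 + (2 * (a * b)) ^+ 2 by ring.
by rewrite addrAC lerDl mulrn_wge0.
Qed.

(* [cauchy_area] applied to the real and imaginary parts of [(u + i v)^2]. *)
Lemma cauchy_area_sqr u v (x0 y0 r : R) : holo u v -> 0 < r ->
  ((u (x0, y0) ^+ 2 + v (x0, y0) ^+ 2)%:E <= (8 / r ^+ 2)%:E *
    \int[mu]_x \int[mu]_y ((u (x, y) ^+ 2 + v (x, y) ^+ 2) * \1_(sq_box x0 y0 r) (x, y))%:E)%E.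
Proof.
move=> huv r0; set I := (X in (_ <= _ * X)%E).
have hs := holo_sqr huv.
have mW : measurable_fun setT ((fun z => (u z ^+ 2 + v z ^+ 2) * \1_(sq_box x0 y0 r) z) : LR * LR -> R).
  apply: measurable_funM.
    have cu : continuous u by move=> z; apply: differentiable_continuous; have [] := huv z.
    have cv : continuous v by move=> z; apply: differentiable_continuous; have [] := huv z.
    by apply: measurable_funD; apply: measurable_funX; exact: continuous_measurable_pair.
  by apply: measurable_indic; apply: measurableX; exact: measurable_itv.
have W0 z : 0 <= (u z ^+ 2 + v z ^+ 2) * \1_(sq_box x0 y0 r) z.
  by rewrite mulr_ge0// addr_ge0// sqr_ge0.
have I0 : (0 <= I)%E.
  by apply: integral_ge0 => x _; apply: integral_ge0 => y _; rewrite lee_fin.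
(* The factor 2 in the premise turns the constant 2 of [cauchy_area] into 4; the real and the
   imaginary part of the square together give 8. *)
have bound f g : holo f g -> (forall z, `|f z| + `|g z| <= 2 * (u z ^+ 2 + v z ^+ 2)) ->
    ((`|f (x0, y0)|)%:E <= (4 / r ^+ 2)%:E * I)%E.
  move=> hfg fguv; apply: le_trans (cauchy_area x0 y0 hfg r0) _.
  have -> : ((4 / r ^+ 2)%:E * I = (2 / r ^+ 2)%:E * (2%:E * I))%E.
    by rewrite muleA -EFinM; congr (_%:E * _)%E; ring.
  apply: lee_wpmul2l; first by rewrite lee_fin divr_ge0// exprn_ge0// ltW.
  have mI : measurable_fun setT (fun x : LR => \int[mu]_y ((u (x, y) ^+ 2 + v (x, y) ^+ 2) * \1_(sq_box x0 y0 r) (x, y))%:E)%E.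
    by move/measurable_EFinP in mW; exact: (measurable_fun_fubini_tonelli_F _ mW).
  rewrite -ge0_integralZl//; last by move=> x _; apply: integral_ge0 => y _; rewrite lee_fin.
  apply: ge0_le_integral => //.
  - by move=> x _; apply: integral_ge0 => y _; rewrite lee_fin cauchy_W_ge0.
  - have /measurable_EFinP mfg := measurable_cauchy_W x0 y0 r hfg.
    apply: (measurable_fun_fubini_tonelli_F _ mfg) => z.
    by rewrite lee_fin cauchy_W_ge0.
  - exact: measurable_funeM.
  move=> x _; rewrite -ge0_integralZl//; last 2 first.
  - by apply/measurable_EFinP; exact: (measurable_fun_pair2 x mW).
  - by move=> y _; rewrite lee_fin.
  apply: ge0_le_integral => //.
  - by move=> y _; rewrite lee_fin cauchy_W_ge0.
  - by apply/measurable_EFinP; exact: (measurable_fun_pair2 x (measurable_cauchy_W x0 y0 r hfg)).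
  - apply: measurable_funeM; apply/measurable_EFinP; exact: (measurable_fun_pair2 x mW).
  by move=> y _; rewrite -EFinM lee_fin /cauchy_W mulrA ler_wpM2r.
have key (a b : R) : `|a * a - b * b| + `|2 * (a * b)| <= 2 * (a ^+ 2 + b ^+ 2).
  have h1 : `|a * a - b * b| <= a ^+ 2 + b ^+ 2.
    by rewrite ler_norml -!expr2; have := sqr_ge0 a; have := sqr_ge0 b; move=> ? ?; apply/andP; split; lra.
  have h2 : `|2 * (a * b)| <= a ^+ 2 + b ^+ 2.
    rewrite ler_norml; have := sqr_ge0 (a - b); have := sqr_ge0 (a + b).
    by rewrite sqrrB sqrrD !mulr2n => ? ?; apply/andP; split; lra.
  lra.
have b1 := bound _ _ hs (fun z => key (u z) (v z)).
have b2 : ((`|(2 *: (u * v)) (x0, y0)|)%:E <= (4 / r ^+ 2)%:E * I)%E.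
  apply: (bound _ _ (holo_rot hs)) => z.
  change (`|2 * (u z * v z)| + `|- (u z * u z - v z * v z)| <= 2 * (u z ^+ 2 + v z ^+ 2)).
  by rewrite normrN addrC; exact: key.
have -> : ((8 / r ^+ 2)%:E * I = (4 / r ^+ 2)%:E * I + (4 / r ^+ 2)%:E * I)%E.
  rewrite -ge0_muleDl// ?lee_fin ?divr_ge0 ?exprn_ge0// ?ltW//.
  by rewrite -EFinD; congr (_%:E * _)%E; ring.
apply: le_trans (leeD b1 b2); rewrite -EFinD lee_fin !fctE; exact: sqr_add_le.
Qed.

End cauchy_area.

(** * Green's formula against a compactly supported function *)

Section weak_green.
Variable R : realType.
Local Notation mu := (@lebesgue_measure R).
Local Notation mu2 := (sfprod mu mu).
Local Notation LR := (measurableTypeR R).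

Lemma mvt_linear (f df : R -> R) (s t m e : R) :
  (forall x : R, is_derive x (1 : R) f (df x)) ->
  (forall c : R, `|c - s| <= `|t - s| -> `|df c - m| <= e) ->
  `|f t - f s - m * (t - s)| <= e * `|t - s|.
Proof.
move=> fdf dfm.
have cf : continuous f.
  by move=> x; apply: differentiable_continuous; apply/derivable1_diffP; have [] := fdf x.
have [st|/ltW ts] := leP s t.
  have [c cst ->] := MVT_segment st (fun x _ => fdf x) (continuous_subspaceT cf).
  rewrite -mulrBl normrM ler_wpM2r// dfm//.
  move: cst; rewrite in_itv/= => /andP[sc ct].
  by rewrite !ger0_norm ?subr_ge0// lerD2r.
have [c cst E] := MVT_segment ts (fun x _ => fdf x) (continuous_subspaceT cf).
have E' : f t - f s = df c * (t - s) by rewrite -opprB E -mulrN opprB.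
rewrite E' -mulrBl normrM ler_wpM2r// dfm//.
move: cst; rewrite in_itv/= => /andP[sc ct].
by rewrite !ler0_norm ?subr_le0// lerN2 lerD2r.
Qed.

Definition C1_partials (psi px py : R * R -> R) : Prop :=
  [/\ forall x y : R, is_derive x (1 : R) (fun t : R => psi (t, y)) (px (x, y)),
      forall x y : R, is_derive y (1 : R) (fun t : R => psi (x, t)) (py (x, y)),
      continuous px & continuous py].

(** [smooth] provides continuous partial derivatives, whereas [green_rect] asks for
    differentiability; the mean value theorem in each variable bridges the two. *)
Lemma C1_differentiable (psi px py : R * R -> R) (z : R * R) : C1_partials psi px py ->
  differentiable psi z /\ forall w, 'd psi z w = px z * w.1 + py z * w.2.
Proof.
move=> [dx dy cx cy].
pose L : {linear (R * R)%type -> R} := (px z \*: (fst : R * R -> R)) \+ (py z \*: (snd : R * R -> R)).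
have cL : continuous L.
  move=> w; apply: cvgD; apply: cvgZl_tmp; [exact: cvg_fst|exact: cvg_snd].
have E : psi \o shift z = cst (psi z) + L +o_ (0 : R * R) id.
  apply/eqaddoP => e e0.
  have e2 : 0 < e / 2 by rewrite divr_gt0.
  have : \forall w \near z, `|px w - px z| <= e / 2 /\ `|py w - py z| <= e / 2.
    apply: filterI.
      by have /cvgrPdist_le/(_ _ e2) := cx z; apply: filterS => w; rewrite distrC.
    by have /cvgrPdist_le/(_ _ e2) := cy z; apply: filterS => w; rewrite distrC.
  move=> /nbhs_ballP[d /= d0 hd].
  apply/nbhs_ballP; exists d => //= h; rewrite -ball_normE /= sub0r normrN prod_normE /= gt_max => /andP[h1 h2].
  rewrite !fctE; case: z h h1 h2 hd L cL => x y [h k] /= h1 h2 hd _ _.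
  have N1 : `|h| <= Num.max `|h| `|k| by rewrite le_max lexx.
  have N2 : `|k| <= Num.max `|h| `|k| by rewrite le_max lexx orbT.
  set N := Num.max _ _ in N1 N2 *.
  have E1 : `|psi (h + x, k + y) - psi (x, k + y) - px (x, y) * (h + x - x)| <= e / 2 * `|h + x - x|.
    apply: (@mvt_linear (fun t => psi (t, k + y)) (fun t => px (t, k + y))) => // c.
    rewrite addrK => hc; apply: (hd (c, k + y) _).1; split; rewrite /= /ball/= distrC.
      exact: le_lt_trans hc h1.
    by rewrite addrK.
  have E2 : `|psi (x, k + y) - psi (x, y) - py (x, y) * (k + y - y)| <= e / 2 * `|k + y - y|.
    apply: (@mvt_linear (fun t => psi (x, t)) (fun t => py (x, t))) => // c.
    rewrite addrK => hc; apply: (hd (x, c) _).2; split; rewrite /= /ball/= distrC.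
      by rewrite subrr normr0.
    exact: le_lt_trans hc h2.
  rewrite !addrK in E1 E2.
  have -> : psi (h + x, k + y) - (psi (x, y) + (px (x, y) * h + py (x, y) * k)) =
    (psi (h + x, k + y) - psi (x, k + y) - px (x, y) * h) +
    (psi (x, k + y) - psi (x, y) - py (x, y) * k) by ring.
  apply: le_trans (ler_normD _ _) _; apply: le_trans (lerD E1 E2) _.
  rewrite -mulrDr mulrAC ler_pdivrMr// -mulrA ler_wpM2l ?(ltW e0)//.
  by rewrite mulr2n mulrDr mulr1 lerD.
have dE := diff_unique cL E.
split; last by move=> w; rewrite dE.
by apply/diff_locallyP; rewrite dE.
Qed.

Lemma continuous_rect_integrable (G : R * R -> R) (a b c d : R) : a <= b -> c <= d ->
  continuous G -> mu2.-integrable (`]a, b] `*` `]c, d]) (EFin \o G).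
Proof.
move=> ab cd cG; apply: measurable_bounded_integrable.
- by apply: measurableX; exact: measurable_itv.
- by rewrite [ltLHS](mu2_rect ab cd) ltry.
- by apply: measurable_funTS; exact: continuous_measurable_pair.
have cpt : compact (`[a, b] `*` `[c, d]) by apply: compact_setX; exact: segment_compact.
have [M [Mr hM]] := compact_bounded (continuous_compact (continuous_subspaceT cG) cpt).
exists M; split => // x Mx y /= [y1 y2]; apply: hM Mx _ _; exists y => //; split => /=.
  by apply: subset_itv y1; rewrite bnd_simp.
by apply: subset_itv y2; rewrite bnd_simp.
Qed.

Lemma C1_partials_supp (psi px py : R * R -> R) (M : R) : C1_partials psi px py ->
  (forall x y, M < `|x| \/ M < `|y| -> psi (x, y) = 0) ->
  forall x y, M < `|x| \/ M < `|y| -> px (x, y) = 0 /\ py (x, y) = 0.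
Proof.
move=> [dx dy _ _] psi0 x y Mxy.
have near_gt (t : R) : M < `|t| -> \forall s \near t, M < `|s|.
  move=> Mt; have cn : (Num.norm s @[s --> t] --> `|t|) by exact: norm_continuous.
  exact: (cvgr_gt _ cn).
have nx : \forall t \near x, psi (t, y) = cst 0 t.
  case: Mxy => [/near_gt|My].
    by apply: filterS => t Mt; apply: psi0; left.
  by exists 1 => //= t _; apply: psi0; right.
have ny : \forall t \near y, psi (x, t) = cst 0 t.
  case: Mxy => [Mx|/near_gt].
    by exists 1 => //= t _; apply: psi0; left.
  by apply: filterS => t Mt; apply: psi0; right.
split.
  have h := @derive_val _ _ _ _ _ _ _ (dx x y).
  by rewrite -h (near_eq_derive _ nx) derive_cst.
have h := @derive_val _ _ _ _ _ _ _ (dy x y).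
by rewrite -h (near_eq_derive _ ny) derive_cst.
Qed.

(** Green's formula for [psi * P] and [psi * Q] on a square beyond the support: the boundary
    integral vanishes, and the product rule leaves only the terms with derivatives of [psi], since
    [P dx + Q dy] is closed. *)
Lemma weak_green (P Q psi px py : R * R -> R) (M : R) :
  (forall z, differentiable P z) -> (forall z, differentiable Q z) ->
  (forall z, 'd Q z (1, 0) = 'd P z (0, 1)) ->
  C1_partials psi px py -> (forall x y, M < `|x| \/ M < `|y| -> psi (x, y) = 0) ->
  (\int[mu2]_z (px z * Q z - py z * P z)%:E = 0)%E.
Proof.
move=> dP dQ dPQ psi1 psi0.
have [dx dy cx cy] := psi1.
have pxy0 := C1_partials_supp psi1 psi0.
(* Larger than [M], so [psi] vanishes on the boundary, and positive even when [M] is negative. *)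
pose N := `|M| + 1.
have MN : M < N by rewrite /N (le_lt_trans (ler_norm M))// ltrDl.
have N0 : 0 < N by rewrite /N ltr_wpDl.
have NN : - N < N by rewrite gtrN.
have cP : continuous P by move=> z; exact: differentiable_continuous.
have cQ : continuous Q by move=> z; exact: differentiable_continuous.
pose G z := px z * Q z - py z * P z.
have cG : continuous G.
  by move=> z; apply: cvgB; apply: cvgM; [exact: cx|exact: cQ|exact: cy|exact: cP].
have intG := continuous_rect_integrable (ltW NN) (ltW NN) cG.
have dpsi z := (C1_differentiable z psi1).1.
have dpsiE z := (C1_differentiable z psi1).2.
have green : boundary_int (fun z => psi z * P z) (fun z => psi z * Q z) (- N) N (- N) N =
    rect_int G (- N) N (- N) N.
  apply: green_rect => //.
  - by move=> z _; apply: differentiableM.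
  - by move=> z _; apply: differentiableM.
  - move=> z _.
    have E (F : R * R -> R) (w : R * R) : differentiable F z ->
        'd (fun z => psi z * F z) z w = psi z * 'd F z w + F z * 'd psi z w.
      move=> dF; apply: etrans (esym (deriveE w (differentiableM (dpsi z) dF))) _.
      exact: (@derive_val _ _ _ _ _ _ _ (is_deriveM (diff_is_derive w (dpsi z)) (diff_is_derive w dF))).
    apply: etrans (congr2 (fun a b => a - b) (E _ _ (dQ z)) (E _ _ (dP z))) _.
    apply: etrans (congr2 (fun a b => _ + _ * a - (_ + _ * b)) (dpsiE z (1, 0)) (dpsiE z (0, 1))) _.
    apply: etrans (congr1 (fun a => _ * a + _ - _) (dPQ z)) _.
    by rewrite /G /= !mulr1 !mulr0 addr0 add0r opprD addrACA subrr add0r [Q z * _]mulrC [P z * _]mulrC.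
  - by move=> z _; exact: cG.
have b0 : boundary_int (fun z => psi z * P z) (fun z => psi z * Q z) (- N) N (- N) N = 0.
  have z1 F (s : R) : `|s| = N ->
      (\int[mu]_(x in `](- N), N]) (psi (x, s) * F (x, s)) = 0) *
      (\int[mu]_(x in `](- N), N]) (psi (s, x) * F (s, x)) = 0).
    move=> sN; split.
      have -> : (fun x => psi (x, s) * F (x, s)) = cst 0.
        by apply/funext => x; rewrite psi0 ?mul0r//; right; rewrite sN.
      by rewrite Rintegral_cst ?mul0r.
    have -> : (fun x => psi (s, x) * F (s, x)) = cst 0.
      by apply/funext => x; rewrite psi0 ?mul0r//; left; rewrite sN.
    by rewrite Rintegral_cst ?mul0r.
  have nN : `|N| = N by rewrite gtr0_norm.
  have nNN : `|- N| = N by rewrite normrN.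
  by rewrite /boundary_int !z1// !subrr addr0.
have GE : (fun z : LR * LR => (G z)%:E) = (EFin \o G) \_ (`](- N), N] `*` `](- N), N]).
  apply/funext => -[x y]; rewrite patchE; case: ifPn => // /negP xy.
  have : M < `|x| \/ M < `|y|.
    apply: contrapT => /not_orP[/negP + /negP]; rewrite -!leNgt => hx hy; apply: xy.
    rewrite inE; split; rewrite /= in_itv/=.
      by have /ltr_normlP[h1 h2] := le_lt_trans hx MN; rewrite (ltW h2) ltrNl h1.
    by have /ltr_normlP[h1 h2] := le_lt_trans hy MN; rewrite (ltW h2) ltrNl h1.
  by move=> /pxy0[e1 e2]; rewrite /G e1 e2 !mul0r subrr.
rewrite -/(G _) GE -integral_mkcond -[LHS]fineK.
  by congr EFin; rewrite -[LHS]/(rect_int G (- N) N (- N) N) -green b0.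
apply: integrable_fin_num => //.
by apply: measurableX; exact: measurable_itv.
Qed.

End weak_green.

(** * Sub-mean value estimate and weak Cauchy-Riemann equations on C^n *)

Section slices.
Variables (R : realType) (n : nat).
Implicit Types z : Cn R n.

Lemma slice_id (j : 'I_n) z : slice j (z ord0 j, z ord_max j) z = z.
Proof.
apply/matrixP => i k; rewrite mxE /=; case: eqP => // ->.
by case: i => -[|[|//]] hi; rewrite -val_eqE /=; congr (z _ _); exact: val_inj.
Qed.

Lemma slice_scale (j : 'I_n) (q w : R * R) z (h : R) :
  slice j (h *: w + q) z = h *: slice j w 0 + slice j q z.
Proof.
apply/matrixP => i k; rewrite !mxE; case: ifP => _; last by rewrite mulr0 add0r.
by case: ifP.
Qed.

Lemma slice_delta0 (j : 'I_n) : slice j ((1 : R), 0) 0 = delta_mx ord0 j.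
Proof.
by apply/matrixP => i k; rewrite !mxE andbC; case: eqP => //= _; case: eqP.
Qed.

Lemma slice_delta1 (j : 'I_n) : slice j (0, (1 : R)) 0 = delta_mx ord_max j.
Proof.
apply/matrixP => i k; rewrite !mxE andbC; case: eqP => //= _.
by case: i => -[|[|//]].
Qed.

Lemma slice_differentiable (j : 'I_n) z q : differentiable (fun q : R * R => slice j q z) q.
Proof.
have E : (fun q : R * R => slice j q z) =
    (fun q : R * R => q.1 *: slice j (1, 0) 0 + q.2 *: slice j (0, 1) 0) + cst (slice j (0, 0) z).
  apply/funext => -[x y]; rewrite !fctE /=; apply/matrixP => i k; rewrite !mxE /=.
  case: ifP => _; last by rewrite !mulr0 !add0r.
  by case: ifP => _; rewrite ?mulr0 ?mulr1 ?addr0 ?add0r.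
rewrite E; apply: differentiableD => //; apply: differentiableD.
  have := @differentiable_comp _ _ _ _ (fst : R * R -> R) ( *:%R ^~ (slice j (1, 0) 0 : Cn R n)) q.
  by apply => //; have [] := is_diff_fst q.
have := @differentiable_comp _ _ _ _ (snd : R * R -> R) ( *:%R ^~ (slice j (0, 1) 0 : Cn R n)) q.
by apply => //; have [] := is_diff_snd q.
Qed.

(** The difference quotients of [g \o F] and of [g] coincide, so this chain rule works with a mere
    directional derivative, which is what [smooth] gives. *)
Lemma is_derive_affine (U V : normedModType R) (F : U -> V) (g : V -> R) (x w : U) (v : V) :
  (forall h : R, F (h *: w + x) = h *: v + F x) -> derivable g (F x) v ->
  is_derive x w (g \o F) ('D_v g (F x)).
Proof.
move=> FE dg.
have E : (fun h : R => h^-1 *: (((g \o F) \o shift x) (h *: w) - (g \o F) x)) =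
         (fun h : R => h^-1 *: ((g \o shift (F x)) (h *: v) - g (F x))).
  by apply/funext => h /=; rewrite FE.
by apply: DeriveDef; rewrite /derivable /derive E.
Qed.

Lemma holo_slice (h : Cn R n -> R[i]) (j : 'I_n) z : entire h ->
  holo (fun q => complex.Re (h (slice j q z))) (fun q => complex.Im (h (slice j q z))).
Proof.
move=> [dh cr] q.
have [du dv] := dh (slice j q z); have [c1 c2] := cr (slice j q z) j.
have dU : differentiable (fun q => complex.Re (h (slice j q z))) q.
  exact: (@differentiable_comp _ _ _ _ (fun q => slice j q z) _ q (slice_differentiable j z q) du).
have dV : differentiable (fun q => complex.Im (h (slice j q z))) q.
  exact: (@differentiable_comp _ _ _ _ (fun q => slice j q z) _ q (slice_differentiable j z q) dv).
have E (f : Cn R n -> R) (w : R * R) (v : Cn R n) : differentiable f (slice j q z) ->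
    differentiable (fun q => f (slice j q z)) q -> slice j w 0 = v ->
    'd (fun q => f (slice j q z)) q w = 'D_v f (slice j q z).
  move=> df dF wv; apply: etrans (esym (deriveE w dF)) _.
  apply: (@derive_val _ _ _ _ _ _ _ (@is_derive_affine _ _ (fun q => slice j q z) f q w v _ _)).
    by move=> s; rewrite slice_scale wv.
  exact: diff_derivable.
split => //.
  exact: etrans (E _ _ _ du dU (slice_delta0 j)) (etrans c1 (esym (E _ _ _ dv dV (slice_delta1 j)))).
exact: etrans (E _ _ _ du dU (slice_delta1 j))
  (etrans c2 (congr1 -%R (esym (E _ _ _ dv dV (slice_delta0 j))))).
Qed.

Lemma C1_slice (phi : Cn R n -> R) (j : 'I_n) z :
  (forall w d, derivable phi w (delta_mx d.1 d.2)) ->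
  (forall d, continuous (pd phi d)) ->
  C1_partials (fun q => phi (slice j q z)) (fun q => pd phi (ord0, j) (slice j q z))
    (fun q => pd phi (ord_max, j) (slice j q z)).
Proof.
move=> dphi cphi.
have cs : continuous (fun q : R * R => slice j q z).
  by move=> q; apply: differentiable_continuous; exact: slice_differentiable.
split.
- move=> x y.
  apply: (@is_derive_affine _ _ (fun t : R => slice j (t, y) z) phi x 1 (delta_mx ord0 j)).
    move=> h; rewrite -slice_delta0 -slice_scale; congr (slice j _ z).
    by apply: injective_projections => //=; rewrite /GRing.scale /= mulr0 add0r.
  exact: (dphi _ (ord0, j)).
- move=> x y.
  apply: (@is_derive_affine _ _ (fun t : R => slice j (x, t) z) phi y 1 (delta_mx ord_max j)).
    move=> h; rewrite -slice_delta1 -slice_scale; congr (slice j _ z).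
    by apply: injective_projections => //=; rewrite /GRing.scale /= mulr0 add0r.
  exact: (dphi _ (ord_max, j)).
- by move=> q; apply: (@continuous_comp _ _ _ (fun q => slice j q z)); [exact: cs|exact: cphi].
- by move=> q; apply: (@continuous_comp _ _ _ (fun q => slice j q z)); [exact: cs|exact: cphi].
Qed.

End slices.

(** * Sub-mean value estimate over a product of squares *)

Section box_estimate.
Variables (R : realType) (n : nat).
Local Notation mu := (@lebesgue_measure R).
Local Notation LR := (measurableTypeR R).
Implicit Types a b c d : nat -> R.

Lemma abs2_ge0 (x : R[i]) : 0 <= abs2 x.
Proof. by rewrite addr_ge0 ?sqr_ge0. Qed.

Definition rowC (i0 : 'I_2) (z : Cn R n) : nat -> R :=
  fun i => oapp (fun j : 'I_n => z i0 j) 0 (insub i).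

Lemma rowCE i0 z (j : 'I_n) : rowC i0 z j = z i0 j.
Proof. by rewrite /rowC valK. Qed.

Lemma matC_rowC z : matC n (rowC ord0 z) (rowC ord_max z) = z.
Proof.
apply/matrixP => i k; rewrite mxE !rowCE.
by case: i => -[|[|//]] hi; rewrite -val_eqE /=; congr (z _ _); exact: val_inj.
Qed.

Lemma matC_upd (j : 'I_n) (x y : R) a b :
  matC n (upd j x a) (upd j y b) = slice j (x, y) (matC n a b).
Proof.
apply/matrixP => i k; rewrite !mxE /upd -val_eqE /=.
by case: ifP => _; case: ifP.
Qed.

Lemma measurable_iint_upd (k : nat) (F : (nat -> R) -> (nat -> R) -> \bar R) :
  measurable_seqfun F -> (forall a b, (0 <= F a b)%E) ->
  measurable_fun setT (fun q : LR * LR => iint k (fun a b => F (upd k q.1 a) (upd k q.2 b))).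
Proof.
move=> mF F0; have [dd [Y [m [a [b [ma mb E]]]]]] := iint_measure R k.
have E' (q : LR * LR) : iint k (fun a b => F (upd k q.1 a) (upd k q.2 b)) =
    (\int[m]_y F (upd k q.1 (a y)) (upd k q.2 (b y)))%E.
  by apply: (E (fun a b => F (upd k q.1 a) (upd k q.2 b))) => //; exact: measurable_seqfun_upd.
rewrite (funext E').
apply: (@measurable_fun_fubini_tonelli_F _ _ (LR * LR)%type Y R m
  (fun p : (LR * LR) * Y => F (upd k p.1.1 (a p.2)) (upd k p.1.2 (b p.2)))) => //.
apply: mF.
  apply: measurable_upd => [|i]; last exact: (measurableT_comp (ma i) measurable_snd).
  exact: (measurableT_comp measurable_fst measurable_fst).
apply: measurable_upd => [|i]; last exact: (measurableT_comp (mb i) measurable_snd).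
exact: (measurableT_comp measurable_snd measurable_fst).
Qed.

Definition box_ind (r : R) (k : nat) c d a b : R :=
  \prod_(i < k) \1_(sq_box (c i) (d i) r) (a i, b i).

Lemma box_ind_ge0 r k c d a b : 0 <= box_ind r k c d a b.
Proof. by apply: prodr_ge0 => i _. Qed.

Lemma measurable_box_ind r k c d dd (Y : measurableType dd) (a b : Y -> nat -> R) :
  (forall i, measurable_fun setT (a^~ i)) -> (forall i, measurable_fun setT (b^~ i)) ->
  measurable_fun setT (fun y => box_ind r k c d (a y) (b y)).
Proof.
move=> ma mb; rewrite /box_ind.
elim: k => [|k IH].
  by rewrite (_ : (fun _ => _) = cst 1)//; apply/funext => y; rewrite big_ord0.
rewrite (_ : (fun _ => _) = (fun y => (\prod_(i < k) \1_(sq_box (c i) (d i) r) (a y i, b y i)) *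
    (\1_(sq_box (c k) (d k) r) (a y k, b y k) : R))); last first.
  by apply/funext => y; rewrite big_ord_recr.
apply: measurable_funM => //.
have mB : measurable (sq_box (c k) (d k) r) by apply: measurableX; exact: measurable_itv.
have mq : measurable_fun setT (fun y => (a y k, b y k) : LR * LR).
  by apply: measurable_fun_pair; [exact: ma|exact: mb].
have mI : measurable_fun setT (\1_(sq_box (c k) (d k) r) : LR * LR -> R).
  exact: measurable_indic.
exact: (measurableT_comp mI mq).
Qed.

Definition merge (k : nat) a b : nat -> R := fun i => if (i < k)%N then a i else b i.

Lemma merge_upd k x a b : merge k.+1 (upd k x a) b = merge k a (upd k x b).
Proof.
apply/funext => i; rewrite /merge /upd ltnS.
by case: (ltngtP i k) => //= [ik|->]; rewrite ?eqxx.
Qed.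

(* One variable at a time: [a], [b] are the coordinates not yet averaged. *)
Lemma iint_submean (G : (nat -> R) -> (nat -> R) -> R) (C r : R) c d (m k : nat) :
  0 <= C -> measurable_seqfun (fun a b => (G a b)%:E) -> (forall a b, 0 <= G a b) ->
  (forall i a b, (i < m)%N -> a i = c i -> b i = d i ->
    ((G a b)%:E <= C%:E * \int[mu]_x \int[mu]_y
      (G (upd i x a) (upd i y b) * \1_(sq_box (c i) (d i) r) (x, y))%:E)%E) ->
  (k <= m)%N -> forall a b, (forall i, (i < k)%N -> a i = c i /\ b i = d i) ->
  ((G a b)%:E <= (C ^+ k)%:E * iint k (fun a' b' =>
     (G (merge k a' a) (merge k b' b) * box_ind r k c d a' b')%:E))%E.
Proof.
move=> C0 mG G0 sub; elim: k => [|k IH] km a b ab.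
  rewrite /= expr0 mul1e /box_ind big_ord0 mulr1 /merge.
  by rewrite (_ : (fun i => _) = a)// (_ : (fun i => _) = b).
have [ak bk] := ab k (ltnSn k).
pose F a' b' := (G (merge k.+1 a' a) (merge k.+1 b' b) * box_ind r k.+1 c d a' b')%:E.
have F0 a' b' : (0 <= F a' b')%E by rewrite lee_fin mulr_ge0// box_ind_ge0.
have mF : measurable_seqfun F.
  move=> dd Y a' b' ma mb; apply/measurable_EFinP; apply: measurable_funM.
    apply/measurable_EFinP; apply: mG => i.
      by rewrite /merge; case: (i < k.+1)%N.
    by rewrite /merge; case: (i < k.+1)%N.
  exact: measurable_box_ind.
have mI := measurable_iint_upd k mF F0.
pose I (x y : R) := iint k (fun a' b' => F (upd k x a') (upd k y b')).
have I0 x y : (0 <= I x y)%E by apply: iint_ge0.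
have Ck : (0 <= (C ^+ k)%:E)%E by rewrite lee_fin exprn_ge0.
have mIx (x : R) : measurable_fun setT (fun y : LR => I x y).
  exact: (measurable_fun_pair2 x mI).
have mII : measurable_fun setT (fun x : LR => \int[mu]_y I x y)%E.
  by apply: (measurable_fun_fubini_tonelli_F _ mI) => q; exact: iint_ge0.
have mGu : measurable_fun setT (fun q : LR * LR =>
    (G (upd k q.1 a) (upd k q.2 b) * \1_(sq_box (c k) (d k) r) (q.1, q.2))%:E).
  apply/measurable_EFinP; apply: measurable_funM.
    apply/measurable_EFinP; apply: mG => i.
      by apply: measurable_upd => [|{}i]; [exact: measurable_fst|exact: measurable_cst].
    by apply: measurable_upd => [|{}i]; [exact: measurable_snd|exact: measurable_cst].
  rewrite (_ : (fun x => _) = \1_(sq_box (c k) (d k) r)); last by apply/funext => -[].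
  by apply: measurable_indic; apply: measurableX; exact: measurable_itv.
(* Variable [k] is averaged first. The induction hypothesis is then used with [(x, y)] in place of
   that coordinate; the coordinates below [k] still sit at the centre. *)
apply: le_trans (sub k a b km ak bk) _.
rewrite exprS EFinM -muleA; apply: lee_wpmul2l; first by rewrite lee_fin.
have -> : iint k.+1 (fun a' b' => F a' b') = (\int[mu]_x \int[mu]_y I x y)%E by [].
have Gu0 x y : (0 <= (G (upd k x a) (upd k y b) * \1_(sq_box (c k) (d k) r) (x, y))%:E)%E.
  by rewrite lee_fin mulr_ge0.
rewrite -ge0_integralZl//; last by move=> x _; apply: integral_ge0 => y _; exact: I0.
apply: ge0_le_integral => //.
- by move=> x _; apply: integral_ge0 => y _; exact: Gu0.
- by apply: (measurable_fun_fubini_tonelli_F _ mGu) => -[x y]; exact: Gu0.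
- exact: measurable_funeM.
move=> x _.
have <- : (\int[mu]_y ((C ^+ k)%:E * I x y) = (C ^+ k)%:E * \int[mu]_y I x y)%E.
  by apply: ge0_integralZl; [exact: measurableT|exact: mIx|move=> y _; exact: I0|exact: Ck].
apply: ge0_le_integral => //.
- exact: (measurable_fun_pair2 x mGu).
- by apply: measurable_funeM; exact: mIx.
move=> y _.
have [xy|xy] := boolP ((x, y) \in sq_box (c k) (d k) r); last first.
  by rewrite indicE (negbTE xy) mulr0; apply: mule_ge0 => //; exact: I0.
rewrite indicE xy mulr1.
have upd_ab i : (i < k)%N -> upd k x a i = c i /\ upd k y b i = d i.
  by move=> ik; rewrite /upd ltn_eqF//; apply: ab; exact: ltnW.
apply: le_trans (IH (ltnW km) _ _ upd_ab) _.
rewrite le_eqVlt; apply/predU1P; left; congr (_ * iint k _)%E.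
apply/funext => a'; apply/funext => b'; rewrite /F !merge_upd; congr ((_ * _)%:E).
have updk (s : R) (e : nat -> R) : upd k s e k = s by rewrite /upd eqxx.
rewrite /box_ind big_ord_recr /= !updk indicE xy mulr1.
by apply: eq_bigr => i _; rewrite /upd !ltn_eqF.
Qed.

Lemma entire_continuous (h : Cn R n -> R[i]) : entire h ->
  continuous (fun z => complex.Re (h z)) /\ continuous (fun z => complex.Im (h z)).
Proof.
by move=> [dh _]; split => z; apply: differentiable_continuous; have [] := dh z.
Qed.

Lemma entire_submean (h : Cn R n -> R[i]) (z : Cn R n) (r : R) : entire h -> 0 < r ->
  ((abs2 (h z))%:E <= ((8 / r ^+ 2) ^+ n)%:E * integral_Cn (fun w : Cn R n =>
    (abs2 (h w) * box_ind r n (rowC ord0 z) (rowC ord_max z) (rowC ord0 w) (rowC ord_max w))%:E))%E.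
Proof.
move=> eh r0.
pose G a b := abs2 (h (matC n a b)).
have [cu cv] := entire_continuous eh.
have mh : measurable_fun setT (fun z : BCn R n => (abs2 (h z))%:E).
  apply/measurable_EFinP; rewrite /abs2; apply: measurable_funD;
  by apply: measurable_funX; exact: continuous_borel.
have mG : measurable_seqfun (fun a b => (G a b)%:E).
  exact: (measurable_seqfun_matC mh).
have GE : G (rowC ord0 z) (rowC ord_max z) = abs2 (h z) by rewrite /G matC_rowC.
rewrite -GE; apply: le_trans.
apply: (@iint_submean G (8 / r ^+ 2) r (rowC ord0 z) (rowC ord_max z) n n _ mG) => //.
- by rewrite divr_ge0// exprn_ge0// ltW.
- by move=> a b; exact: abs2_ge0.
- move=> i a b im ai bi.
  have := cauchy_area_sqr (rowC ord0 z i) (rowC ord_max z i) (holo_slice (Ordinal im) (matC n a b) eh) r0.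
  rewrite -ai -bi.
  have sE : slice (Ordinal im) (a i, b i) (matC n a b) = matC n a b.
    have := slice_id (Ordinal im) (matC n a b); rewrite !mxE /=.
    exact.
  rewrite sE => H.
  have -> : (fun x : LR => \int[mu]_y (G (upd i x a) (upd i y b) *
       \1_(sq_box (a i) (b i) r) (x, y))%:E)%E =
     (fun x : LR => \int[mu]_y (abs2 (h (slice (Ordinal im) (x, y) (matC n a b))) *
       \1_(sq_box (a i) (b i) r) (x, y))%:E)%E.
    apply/funext => x; congr (integral _ _ _); apply/funext => y.
    by rewrite /G -(matC_upd (Ordinal im)).
  exact: H.
rewrite le_eqVlt; apply/predU1P; left; congr (_ * _)%E.
rewrite /integral_Cn; congr (iint n _); apply/funext => a; apply/funext => b.
rewrite -/(matC n a b); congr ((_ * _)%:E).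
  rewrite /G; congr (abs2 (h _)); apply/matrixP => i k.
  by rewrite !mxE /merge ltn_ord.
apply: eq_bigr => i _; congr (\1__ (_, _)).
  by rewrite rowCE mxE.
by rewrite rowCE mxE.
Qed.

End box_estimate.
Lemma cvg_sumr (R : realType) (T I : Type) (F : set_system T) {FF : Filter F}
    (r : seq I) (f : I -> T -> R) (l : I -> R) :
  (forall i, f i @ F --> l i) ->
  (fun x => \sum_(i <- r) f i x) @ F --> \sum_(i <- r) l i.
Proof.
move=> fl; elim: r => [|i r IH].
  rewrite big_nil (_ : (fun x => _) = cst 0); first exact: cvg_cst.
  by apply/funext => x; rewrite big_nil.
rewrite big_cons (_ : (fun x => _) = (fun x => f i x + \sum_(i <- r) f i x)).
  exact: cvgD.
by apply/funext => x; rewrite big_cons.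
Qed.

(** * Integrability of exponentially decaying functions *)

Section exponential_decay.
Variables (R : realType) (n : nat).
Local Notation mu := (@lebesgue_measure R).
Local Notation LR := (measurableTypeR R).

Lemma measurable_expRN (k : R) : measurable_fun setT (fun x : R => expR (- (k * `|x|))).
Proof.
apply: measurableT_comp => //; apply: measurableT_comp => //.
by apply: measurable_funM => //; exact: measurableT_comp.
Qed.

Lemma integral_expRN_lty (k : R) : 0 < k -> (\int[mu]_x (expR (- (k * `|x|)))%:E < +oo)%E.
Proof.
move=> k0.
pose f (x : R) : \bar R := (expR (- (k * `|x|)))%:E.
have mf : measurable_fun setT f by apply/measurable_EFinP; exact: measurable_expRN.
have f0 x : (0 <= f x)%E by rewrite lee_fin expR_ge0.
have pos : (\int[mu]_(x in `[0%R, +oo[) f x < +oo)%E.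
  apply: (@le_lt_trans _ _ (\int[mu]_x ((k^-1)%:E * (exponential_pdf k x)%:E))%E).
    rewrite integral_mkcond; apply: ge0_le_integral => //.
    - by move=> x _; rewrite patchE; case: ifP.
    - by apply/(measurable_restrictT f) => //; exact: measurable_funTS.
    - apply: measurable_funeM; apply/measurable_EFinP; exact: measurable_exponential_pdf.
    move=> x _; rewrite patchE; case: ifPn => [|_]; last first.
      by rewrite -EFinM lee_fin mulr_ge0 ?invr_ge0 ?exponential_pdf_ge0// ltW.
    rewrite inE/= in_itv/= andbT => x0.
    rewrite exponential_pdfE// /f -EFinM lee_fin.
    by rewrite mulrA mulVf ?gt_eqF// mul1r ger0_norm// mulNr.
  rewrite ge0_integralZl//; last 3 first.
  - by apply/measurable_EFinP; exact: measurable_exponential_pdf.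
  - by move=> x _; rewrite lee_fin exponential_pdf_ge0// ltW.
  - by rewrite lee_fin invr_ge0 ltW.
  by rewrite integral_exponential_pdf// mule1 ltry.
have neg : (\int[mu]_(x in `]-oo, 0%R]) f x < +oo)%E.
  apply: le_lt_trans pos; rewrite (@ge0_integration_by_substitution0 R f)//.
  rewrite le_eqVlt; apply/predU1P; left; apply: eq_integral => x _.
  by rewrite /f normrN.
have TE : [set: R] = `]-oo, 0%R] `|` `]0%R, +oo[.
  apply/seteqP; split => // x _; have [x0|x0] := leP x 0; [left|right];
  by rewrite /= in_itv/= ?andbT.
rewrite -[X in (X < _)%E]/(\int[mu]_x f x)%E TE ge0_integral_setU//; first last.
- apply/disj_setPS => x [/=]; rewrite !in_itv/= andbT => x0 x1.
  by move: x1; rewrite ltNge x0.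
- by rewrite -TE.
apply: lte_add_pinfty => //; apply: le_lt_trans pos.
apply: ge0_subset_integral => //; first exact: measurable_funTS.
by move=> x /=; rewrite !in_itv/= !andbT => /ltW.
Qed.

Lemma iint_expRN_lty (k : R) (m : nat) : 0 < k ->
  (iint m (fun a b => (expR (- (k * \sum_(i < m) (`|a i| + `|b i|))))%:E) < +oo)%E.
Proof.
move=> k0.
pose F (m : nat) (a b : nat -> R) : \bar R := (expR (- (k * \sum_(i < m) (`|a i| + `|b i|))))%:E.
have mF l : measurable_seqfun (F l).
  move=> d Y a b ma mb; apply/measurable_EFinP; apply: measurableT_comp => //.
  apply: measurableT_comp => //; apply: measurable_funM => //.
  by apply: measurable_sum => i; apply: measurable_funD; apply: measurableT_comp.
have F0 l a b : (0 <= F l a b)%E by rewrite lee_fin expR_ge0.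
rewrite -/(F m); elim: m => [|m IH]; first by rewrite /= ltry.
have I0 : (0 <= iint m (F m))%E by exact: iint_ge0.
pose e (x : R) := expR (- (k * `|x|)).
have e0 x : 0 <= e x by exact: expR_ge0.
pose I := (\int[mu]_x (e x)%:E)%E.
have Ioo : (I < +oo)%E := integral_expRN_lty k0.
have II0 : (0 <= I)%E by apply: integral_ge0 => x _; rewrite lee_fin.
have me : measurable_fun setT (EFin \o e) by apply/measurable_EFinP; exact: measurable_expRN.
have step x y : iint m (fun a b => F m.+1 (upd m x a) (upd m y b)) =
    ((e x)%:E * ((e y)%:E * iint m (F m)))%E.
  have [d [Y [nu [a [b [ma mb E]]]]]] := iint_measure R m.
  rewrite (E (fun a b => F m.+1 (upd m x a) (upd m y b)))//; last first.
    exact: measurable_seqfun_upd.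
  rewrite (E (F m))// muleA -EFinM -ge0_integralZl//; last 2 first.
  - exact: mF.
  - by rewrite lee_fin mulr_ge0.
  apply: eq_integral => w _; rewrite /F /e -EFinM -!expRD; congr ((expR _)%:E).
  rewrite big_ord_recr /= /upd !eqxx -!opprD -!mulrDr; congr (- (k * _)).
  rewrite addrC; congr (_ + _); apply: eq_bigr => i _.
  by rewrite !ltn_eqF.
pose J := iint m (F m).
have E1 : (\int[mu]_y (J * (e y)%:E) = J * I)%E.
  by apply: ge0_integralZl => //; move=> y _; rewrite lee_fin.
have E2 x : (\int[mu]_y ((e x)%:E * (J * (e y)%:E)) = (e x)%:E * (J * I))%E.
  rewrite -E1; apply: ge0_integralZl => //.
  - exact: measurable_funeM.
  - by move=> y _; rewrite mule_ge0// lee_fin.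
  - by rewrite lee_fin.
have E3 : (\int[mu]_x ((J * I) * (e x)%:E) = (J * I) * I)%E.
  by apply: ge0_integralZl => //; [move=> y _; rewrite lee_fin|exact: mule_ge0].
have -> : iint m.+1 (F m.+1) = ((J * I) * I)%E.
  rewrite -E3; apply: eq_integral => x _; rewrite muleC -E2.
  by apply: eq_integral => y _; rewrite [(J * _)%E]muleC; exact: step.
have JI0 : (0 <= J * I)%E by exact: mule_ge0.
have JI : (J * I < +oo)%E by apply: lte_mul_pinfty => //; rewrite ge0_fin_numE.
by apply: lte_mul_pinfty => //; rewrite ge0_fin_numE.
Qed.

(** The sum norm is chosen because [expR (- (k * norm1 z))] is a product of functions of one real
    coordinate each. *)
Definition norm1 (z : Cn R n) : R := \sum_(j < n) (`|z ord0 j| + `|z ord_max j|).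

Lemma norm1_ge0 z : 0 <= norm1 z.
Proof. by apply: sumr_ge0 => j _; rewrite addr_ge0. Qed.

Lemma norm1_continuous : continuous norm1.
Proof.
move=> z; apply: (@cvg_sumr R (Cn R n) 'I_n (nbhs z) _ (index_enum 'I_n)
  (fun j (w : Cn R n) => `|w ord0 j| + `|w ord_max j|)
  (fun j => `|z ord0 j| + `|z ord_max j|)) => j.
by apply: cvgD; apply: cvg_norm; exact: coord_continuous.
Qed.

Lemma measurable_expRN1 (k : R) :
  measurable_fun setT (fun z : BCn R n => (expR (- (k * norm1 z)))%:E).
Proof.
apply/measurable_EFinP; apply: measurableT_comp => //.
apply: measurableT_comp => //; apply: measurable_funM => //.
by apply: continuous_borel; exact: norm1_continuous.
Qed.

Lemma integral_Cn_expRN_lty (k : R) : 0 < k ->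
  (\int[@lebesgue_Cn R n]_z (expR (- (k * norm1 z)))%:E < +oo)%E.
Proof.
move=> k0; rewrite -integral_CnE; [|exact: measurable_expRN1|by move=> z; rewrite lee_fin expR_ge0].
rewrite /integral_Cn /norm1; have := iint_expRN_lty n k0.
congr (_ < _)%E; congr (iint n _); apply/funext => a; apply/funext => b.
congr ((expR (- (k * _)))%:E); apply: eq_bigr => i _.
by rewrite !mxE.
Qed.

End exponential_decay.

(** * Compact sets, compact supports and weak Cauchy-Riemann equations *)

Section compactness.
Variables (R : realType) (n : nat).
Implicit Types z : Cn R n.

Lemma coord_le_enorm z i j : `|z i j| <= enorm z.
Proof.
rewrite -[`|_|]ger0_norm// -sqrtr_sqr ler_wsqrtr// real_normK ?num_real//.
rewrite (bigD1 i)//= (bigD1 j)//= -addrA lerDl addr_ge0//.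
  by apply: sumr_ge0 => k _; exact: sqr_ge0.
by apply: sumr_ge0 => k _; apply: sumr_ge0 => l _; exact: sqr_ge0.
Qed.

Lemma norm1_le_enorm z : norm1 z <= n%:R * (2 * enorm z).
Proof.
apply: (@le_trans _ _ (\sum_(j < n) (2 * enorm z))).
  by apply: ler_sum => j _; rewrite mulr2n mulrDl mul1r lerD// coord_le_enorm.
by rewrite sumr_const card_ord -[X in X <= _]mulr_natl.
Qed.

Lemma enorm_continuous : continuous (@enorm R n).
Proof.
move=> z; apply: (@continuous_comp _ _ _ _ (@Num.sqrt R)); last exact: sqrt_continuous.
apply: (@cvg_sumr R (Cn R n) 'I_2 (nbhs z) _ (index_enum 'I_2)
  (fun i (w : Cn R n) => \sum_(j < n) w i j ^+ 2) (fun i => \sum_(j < n) z i j ^+ 2)) => i.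
apply: (@cvg_sumr R (Cn R n) 'I_n (nbhs z) _ (index_enum 'I_n)
  (fun j (w : Cn R n) => w i j ^+ 2) (fun j => z i j ^+ 2)) => j.
have c := @coord_continuous R 2 n i j z.
rewrite expr2; under eq_fun do rewrite expr2.
exact: cvgM.
Qed.

Lemma box_compact (N : R) : compact [set z : Cn R n | forall i j, `|z i j| <= N].
Proof.
pose A := [set v : 'rV[R]_(2 * n) | forall i, `[- N, N]%classic (v ord0 i)].
have cA : compact A by apply: (@rV_compact R _ (fun=> `[- N, N]%classic)) => i; exact: segment_compact.
have cv : continuous (@vec_mx R 2 n).
  move=> v B /nbhs_ballP[e /= e0 eB]; apply/nbhs_ballP; exists e => //= w [_ vw].
  by apply: eB; split => // i j; rewrite !mxE; exact: vw.
have -> : [set z : Cn R n | forall i j, `|z i j| <= N] = @vec_mx R 2 n @` A.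
  apply/seteqP; split => [z zN|_ [v vA <-] i j].
    exists (mxvec z); last by rewrite mxvecK.
    move=> i; case/mxvec_indexP: i => i j; rewrite mxvecE /= in_itv/=.
    by rewrite -ler_norml.
  by have := vA (mxvec_index i j); rewrite /= in_itv/= mxE ler_norml.
by apply: continuous_compact => //; exact: continuous_subspaceT.
Qed.

Lemma usc_open (p : Cn R n -> R) (c : R) : upper_semicontinuous p ->
  open [set z | p z < c].
Proof.
move=> up; rewrite openE => z /= pz; rewrite /interior.
have : 0 < c - p z by rewrite subr_gt0.
by move=> /(up z); apply: filterS => w; rewrite addrC subrK.
Qed.

(** Near any [w] the values stay below [p w + 1], hence below every large integer; compactness makes
    that integer uniform. *)
Lemma usc_bounded (p : Cn R n -> R) (N : R) : upper_semicontinuous p ->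
  exists K, forall z, (forall i j, `|z i j| <= N) -> p z <= K.
Proof.
move=> up; have /compact_near_coveringP := @box_compact N.
move=> /(_ nat \oo (fun k z => p z < k%:R) _).
case=> [z _|k _ /(_ k (leqnn k)) hk]; last first.
  by exists k%:R => z zN; apply: ltW; exact: hk.
exists ([set w | p w < p z + 1], [set k | p z + 1 < k%:R]) => /=.
  by split; [exact: up|exact: nbhs_infty_gtr].
by move=> [w k] /= [h1 h2]; exact: lt_trans h2.
Qed.

Lemma continuous_bounded (g : Cn R n -> R) (N : R) : continuous g ->
  exists K, forall z, (forall i j, `|z i j| <= N) -> `|g z| <= K.
Proof.
move=> cg; apply: usc_bounded => a e e0.
have cn : continuous (fun z => `|g z|).
  move=> z; apply: (@continuous_comp _ _ _ g (@Num.norm R R)); first exact: cg.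
  exact: norm_continuous.
have ae : `|g a| < `|g a| + e by rewrite ltrDl.
exact: (cvgr_lt _ (cn a) _ ae).
Qed.

(** A bounded function of compact support is dominated by a multiple of an exponential already known
    to be integrable, which avoids computing the measure of balls. *)
Lemma compact_support_bounded (g : Cn R n -> R) (M : R) : continuous g ->
  (forall z, M < enorm z -> g z = 0) ->
  exists2 K, 0 <= K & forall z, `|g z| <= K * expR (- (1 * norm1 z)).
Proof.
move=> cg g0; have [K hK] := continuous_bounded M cg.
exists (`|K| * expR (n%:R * (2 * `|M|))); first by rewrite mulr_ge0// expR_ge0.
move=> z; have [zM|Mz] := leP (enorm z) M; last by rewrite g0// normr0 !mulr_ge0// expR_ge0.
rewrite -mulrA -expRD.
apply: le_trans (hK z (fun i j => le_trans (coord_le_enorm z i j) zM)) _.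
apply: le_trans (ler_norm _) _; rewrite ler_peMr//.
rewrite -[X in X <= _]expR0 ler_expR mul1r subr_ge0.
apply: le_trans (norm1_le_enorm z) _.
by rewrite ler_wpM2l// ler_wpM2l// (le_trans zM)// ler_norm.
Qed.

Lemma compact_support_integrable (g : Cn R n -> R) (M : R) : continuous g ->
  (forall z, M < enorm z -> g z = 0) ->
  (@lebesgue_Cn R n).-integrable setT (EFin \o (g : BCn R n -> R)).
Proof.
move=> cg g0; have [K K0 hK] := compact_support_bounded cg g0.
apply: (@le_integrable _ _ _ (@lebesgue_Cn R n) setT measurableT _
   (fun z : BCn R n => (K * expR (- (1 * norm1 z)))%:E)).
- by apply/measurable_EFinP; exact: continuous_borel.
- move=> z _; rewrite /= lee_fin [leRHS]ger0_norm; first exact: hK.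
  by rewrite mulr_ge0// expR_ge0.
under eq_fun do rewrite EFinM.
apply: (@integrableZl _ _ _ (@lebesgue_Cn R n) setT measurableT K
  (fun z : BCn R n => (expR (- (1 * norm1 z)))%:E)).
apply/integrableP; split; first exact: measurable_expRN1.
under eq_integral do rewrite abse_EFin ger0_norm ?expR_ge0//.
exact: integral_Cn_expRN_lty.
Qed.

Lemma pd_support (g : Cn R n -> R) (M : R) d :
  (forall z, M < enorm z -> g z = 0) -> forall z, M < enorm z -> pd g d z = 0.
Proof.
move=> g0 z Mz; rewrite /pd (@near_eq_derive _ _ _ g (cst 0)) ?derive_cst//.
have H : \forall w \near z, M < enorm w by exact: (cvgr_gt _ (@enorm_continuous z) _ Mz).
by apply: (filterS _ H) => w /g0 ->.
Qed.

(** For real [psi] the two integrands are the imaginary and the real part of [2 * h * dzbar psi j].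
    Each has integral 0 on every slice, by [weak_green] with [(P, Q)] equal to [(- Re h, Im h)] and
    [(Im h, Re h)]. *)
Lemma entire_weak (h : Cn R n -> R[i]) (psi : Cn R n -> R) (j : 'I_n) (M : R) :
  entire h -> smooth psi -> (forall z, M < enorm z -> psi z = 0) ->
  (\int[@lebesgue_Cn R n]_z (complex.Im (h z) * pd psi (ord0, j) z +
                complex.Re (h z) * pd psi (ord_max, j) z)%:E = 0)%E /\
  (\int[@lebesgue_Cn R n]_z (complex.Re (h z) * pd psi (ord0, j) z -
                complex.Im (h z) * pd psi (ord_max, j) z)%:E = 0)%E.
Proof.
move=> eh spsi psi0.
have [cu cv] := entire_continuous eh.
have dpsi : forall w d, derivable psi w (delta_mx d.1 d.2) by have [] := spsi [::].
have cpsi d : continuous (pd psi d) by have [] := spsi [:: d].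
have pd0 d := @pd_support psi M d psi0.
have sl0 z x y : M < `|x| \/ M < `|y| -> psi (slice j (x, y) z) = 0.
  move=> [Mx|My]; apply: psi0.
    apply: lt_le_trans Mx _; apply: le_trans (coord_le_enorm (slice j (x, y) z) ord0 j).
    by rewrite mxE eqxx.
  apply: lt_le_trans My _; apply: le_trans (coord_le_enorm (slice j (x, y) z) ord_max j).
  by rewrite mxE eqxx.
split.
  apply: (@integral_slice_eq0 _ _ j (fun z => complex.Im (h z) * pd psi (ord0, j) z +
                complex.Re (h z) * pd psi (ord_max, j) z)).
    apply: (@compact_support_integrable _ M) => [z|z Mz]; last by rewrite !pd0// !mulr0 addr0.
    exact: (cvgD (cvgM (cv z) (cpsi _ z)) (cvgM (cu z) (cpsi _ z))).
  move=> z; have hUV := holo_slice j z eh.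
  have C := C1_slice j z dpsi cpsi.
  have := @weak_green R (fun q => - complex.Re (h (slice j q z))) (fun q => complex.Im (h (slice j q z)))
    _ _ _ M _ _ _ C (sl0 z).
  move=> H; rewrite -[RHS]H.
  - apply: eq_integral => q _; congr EFin.
    by rewrite mulrN opprK mulrC; congr (_ + _); rewrite mulrC.
  - by move=> q; apply: differentiableN; have [] := hUV q.
  - by move=> q; have [] := hUV q.
  - move=> q; have [du dv c1 c2] := hUV q.
    apply: etrans _ (esym (diffN_val _ du)).
    exact: etrans (esym (opprK _)) (congr1 -%R (esym c2)).
apply: (@integral_slice_eq0 _ _ j (fun z => complex.Re (h z) * pd psi (ord0, j) z -
              complex.Im (h z) * pd psi (ord_max, j) z)).
  apply: (@compact_support_integrable _ M) => [z|z Mz]; last by rewrite !pd0// !mulr0 subr0.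
  exact: (cvgB (cvgM (cu z) (cpsi _ z)) (cvgM (cv z) (cpsi _ z))).
move=> z; have hUV := holo_slice j z eh.
have C := C1_slice j z dpsi cpsi.
have := @weak_green R (fun q => complex.Im (h (slice j q z))) (fun q => complex.Re (h (slice j q z)))
  _ _ _ M _ _ _ C (sl0 z).
move=> H; rewrite -[RHS]H.
- apply: eq_integral => q _; congr EFin.
  by rewrite mulrC; congr (_ - _); rewrite mulrC.
- by move=> q; have [] := hUV q.
- by move=> q; have [] := hUV q.
- by move=> q; have [] := hUV q.
Qed.

End compactness.

(** * Projection onto the closure of a subspace *)

Section projection.
Variables (R : realType) (V : lmodType R).

Definition submodule_pred (L : V -> Prop) : Prop :=
  L 0 /\ forall (a : R) u v, L u -> L v -> L (a *: u + v).

(** Only semidefinite, because functions equal almost everywhere are not identified; relative to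
    [L], because the integrals are well behaved only on square-integrable functions. *)
Definition semi_inner (L : V -> Prop) (B : V -> V -> R) : Prop :=
  [/\ forall u v, L u -> L v -> B u v = B v u,
      forall (a : R) u v w, L u -> L v -> L w -> B (a *: u + v) w = a * B u w + B v w &
      forall u, L u -> 0 <= B u u].

Variables (L : V -> Prop) (B : V -> V -> R).
Hypotheses (sL : submodule_pred L) (iB : semi_inner L B).

Lemma submodule_sub u v : L u -> L v -> L (u - v).
Proof. by move=> Lu Lv; rewrite addrC -scaleN1r; apply: sL.2. Qed.

Lemma submodule_scale a u : L u -> L (a *: u).
Proof. by move=> Lu; rewrite -[_ *: _]addr0; apply: sL.2 => //; case: sL. Qed.

Lemma semi_innerC u v : L u -> L v -> B u v = B v u.
Proof. by case: iB => + _ _; apply. Qed.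

Lemma semi_inner_linl a u v w : L u -> L v -> L w ->
  B (a *: u + v) w = a * B u w + B v w.
Proof. by case: iB => _ + _; apply. Qed.

Lemma semi_innerBl u v w : L u -> L v -> L w -> B (u - v) w = B u w - B v w.
Proof. by move=> Lu Lv Lw; rewrite addrC -scaleN1r semi_inner_linl// mulN1r addrC. Qed.

Lemma semi_inner_sqr a u v : L u -> L v ->
  B (a *: u + v) (a *: u + v) = a ^+ 2 * B u u + 2 * a * B u v + B v v.
Proof.
move=> Lu Lv; have Luv : L (a *: u + v) by apply: sL.2.
rewrite semi_inner_linl// (semi_innerC Lu Luv) (semi_innerC Lv Luv).
rewrite !semi_inner_linl// (semi_innerC Lv Lu).
ring.
Qed.

Lemma quadratic_ge0 (a b c : R) : 0 <= a ->
  (forall t, 0 <= t ^+ 2 * a + 2 * t * b + c) -> b ^+ 2 <= a * c.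
Proof.
rewrite le_eqVlt => /predU1P[<-|a0] h.
  rewrite mul0r; have [->|b0] := eqVneq b 0; first by rewrite expr0n.
  (* For [a = 0] the polynomial is affine in [t], and at this point it takes the value -1. *)
  have := h (- (c + 1) / (2 * b)).
  have -> : 2 * (- (c + 1) / (2 * b)) * b = - (c + 1) by field.
  by rewrite mulr0 add0r opprD addrAC addNr add0r oppr_ge0 ler10.
have := h (- b / a).
have -> : (- b / a) ^+ 2 * a + 2 * (- b / a) * b + c = (a * c - b ^+ 2) / a.
  by field; rewrite gt_eqF.
by rewrite ler_pdivlMr// mul0r subr_ge0.
Qed.

Lemma cauchy_schwarz u v : L u -> L v -> B u v ^+ 2 <= B u u * B v v.
Proof.
case: (iB) => _ _ Bge0 Lu Lv; apply: quadratic_ge0; first exact: Bge0.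
by move=> t; rewrite -semi_inner_sqr//; apply/Bge0/sL.2.
Qed.

Lemma sqr_le_harmonic_eq0 (x c : R) : (forall l : nat, x ^+ 2 <= c * l.+1%:R^-1) -> x = 0.
Proof.
move=> h; apply/eqP; rewrite -sqrf_eq0 eq_le sqr_ge0 andbT.
have cv : (fun l : nat => c * l.+1%:R^-1) @ \oo --> c * 0.
  exact: (cvgM (cvg_cst c) (@cvg_harmonic R)).
by rewrite -(mulr0 c); apply: (cvgr_to_ge cv); apply: nearW => l; exact: h.
Qed.

Lemma sqrD_le (x y a b : R) : x ^+ 2 <= a -> y ^+ 2 <= b -> (x - y) ^+ 2 <= 2 * (a + b).
Proof.
move=> xa yb; apply: (@le_trans _ _ (2 * (x ^+ 2 + y ^+ 2))); last by rewrite ler_wpM2l// lerD.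
rewrite -subr_ge0 (_ : _ - _ = (x + y) ^+ 2) ?sqr_ge0//.
ring.
Qed.

Variable K : V -> Prop.
Hypotheses (sK : submodule_pred K) (KL : forall u, K u -> L u).

Lemma minimizing_sequence u : L u -> exists h : nat -> V,
  (forall l, K (h l)) /\
  forall l k, K k -> B k (u - h l) ^+ 2 <= B k k * l.+1%:R^-1.
Proof.
move=> Lu; have [_ _ Bge0] := iB.
pose D := [set B (u - k) (u - k) | k in K].
have lbD : lbound D 0 by move=> _ [k Kk <-]; apply/Bge0/submodule_sub/KL.
have iD : has_inf D.
  by split; [exists (B (u - 0) (u - 0)); exists 0 => //; case: sK|exists 0].
have /choice[h hP] : forall l : nat, exists k, K k /\ B (u - k) (u - k) < inf D + l.+1%:R^-1.
  move=> l; have l0 : 0 < l.+1%:R^-1 :> R by rewrite invr_gt0.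
  by have [_ [k Kk <-] kl] := inf_adherent l0 iD; exists k.
exists h; split => [l|l k Kk]; first by case: (hP l).
have [Kh hl] := hP l; have Lk := KL Kk; have Lh := KL Kh.
have Luh := submodule_sub Lu Lh.
apply: quadratic_ge0; first exact: Bge0.
move=> t.
have : inf D <= B (t *: k + (u - h l)) (t *: k + (u - h l)).
  apply: ge_inf; first by exists 0.
  exists (- t *: k + h l); first exact: sK.2.
  by rewrite scaleNr opprD opprK addrCA.
rewrite semi_inner_sqr// => /le_trans/(_ (lerD (lexx _) (ltW hl))).
by rewrite addrCA lerDl.
Qed.

(** Completeness is asked only for the explicit rate that minimizing sequences have, and the limit
    is placed in [L], not in [K]. *)
Hypothesis complete : forall h : nat -> V, (forall l, K (h l)) ->
  (forall l m, (l <= m)%N -> B (h m - h l) (h m - h l) <= 4 * l.+1%:R^-1) ->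
  exists P, L P /\ forall l, B (P - h l) (P - h l) <= 4 * l.+1%:R^-1.

(* [P] is the orthogonal projection of [u] on the closure of [K]; its
   membership in that closure is recorded as [P] being in the double
   orthogonal of [K]. *)
Lemma orthogonal_projection u : L u -> exists P,
  [/\ L P, forall k, K k -> B (u - P) k = 0,
      B (u - P) (u - P) <= B u u &
      forall g, L g -> (forall k, K k -> B k g = 0) -> B P g = 0].
Proof.
move=> Lu; have [_ _ Bge0] := iB.
have [h [Kh hB]] := minimizing_sequence Lu.
have Lh l := KL (Kh l).
have Luh l := submodule_sub Lu (Lh l).
(* With [k = h m - h l], [B k k] is the difference of two nearly vanishing products of [k] with
   [u - h l] and [u - h m]; its square is at most [B k k] times the wanted rate, and one factor
   [B k k] cancels. *)
have cauchy l m : (l <= m)%N -> B (h m - h l) (h m - h l) <= 4 * l.+1%:R^-1.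
  move=> lm; set k := h m - h l.
  have Kk : K k by rewrite /k addrC -scaleN1r; exact: sK.2.
  have Lk := KL Kk.
  have Ek : B k k = B k (u - h l) - B k (u - h m).
    rewrite -(semi_innerC (Luh l) Lk) -(semi_innerC (Luh m) Lk) -semi_innerBl//.
    by rewrite /k opprB [in RHS]addrC subrKA.
  have := sqrD_le (hB l _ Kk) (hB m _ Kk); rewrite -Ek -mulrDr mulrCA => H.
  have [kk0|kk0] := eqVneq (B k k) 0; first by rewrite kk0 mulr_ge0.
  have kk_gt0 : 0 < B k k by rewrite lt_neqAle eq_sym kk0 Bge0.
  move: H; rewrite expr2 ler_pM2l// => /le_trans; apply.
  have -> : 4 * l.+1%:R^-1 = 2 * (l.+1%:R^-1 + l.+1%:R^-1) :> R by ring.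
  by rewrite ler_wpM2l// lerD// lef_pV2 ?posrE// ler_nat.
have [P [LP PB]] := complete Kh cauchy.
have LPh l := submodule_sub LP (Lh l).
have LuP := submodule_sub Lu LP.
have close l g : L g -> B (P - h l) g ^+ 2 <= 4 * B g g * l.+1%:R^-1.
  move=> Lg; apply: le_trans (cauchy_schwarz _ Lg) _ => //.
  by rewrite [leRHS]mulrAC ler_wpM2r// Bge0.
have PO g : L g -> (forall k, K k -> B k g = 0) -> B P g = 0.
  move=> Lg gK; apply: (@sqr_le_harmonic_eq0 _ (4 * B g g)) => l.
  have -> : B P g = B (P - h l) g by rewrite semi_innerBl// (gK (h l))// subr0.
  exact: close.
have orth k : K k -> B (u - P) k = 0.
  move=> Kk; have Lk := KL Kk.
  apply: (@sqr_le_harmonic_eq0 _ (2 * (B k k + 4 * B k k))) => l.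
  have -> : B (u - P) k = B k (u - h l) - B (P - h l) k.
    rewrite (semi_innerC Lk (Luh l)) -semi_innerBl//.
    by rewrite opprB addrC subrKA addrC.
  apply: le_trans (sqrD_le (hB l _ Kk) (close l _ Lk)) _.
  by rewrite -mulrDl mulrA.
exists P; split => //.
(* [u - P] is orthogonal to [K], so the double orthogonality of [P] applies to it; Pythagoras then
   bounds [u - P] by [u]. *)
have uP0 : B P (u - P) = 0.
  by apply: PO => // k Kk; rewrite (semi_innerC (KL Kk) LuP) orth.
have := semi_inner_sqr 1 LP LuP.
rewrite scale1r addrC subrK uP0 mulr0 addr0 expr1n mul1r => ->.
by rewrite lerDr Bge0.
Qed.

End projection.

(** * Weighted L2 spaces *)

Section weighted_L2.
Variables (R : realType) (n : nat) (p : Cn R n -> R) (s : R).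
Hypothesis up : upper_semicontinuous p.
Local Notation mu := (@lebesgue_Cn R n).
Local Notation W := (weight p s).
Implicit Types (a b : Cn R n -> R) (u v : Cn R n -> Rcomplex R).

Lemma usc_measurable : measurable_fun setT (p : BCn R n -> R).
Proof.
apply: (@measurability _ _ (BCn R n) R setT p _ (RGenInftyO.measurableE R)).
move=> _ [_ [c ->] <-]; rewrite setTI; apply: sub_gen_smallest.
rewrite (_ : p @^-1` _ = [set z | p z < c]); first exact: usc_open.
by apply/seteqP; split => z /=; rewrite in_itv.
Qed.

Lemma weight_ge0 z : 0 <= W z. Proof. exact: expR_ge0. Qed.

Lemma sqW_ge0 a z : 0 <= a z ^+ 2 * W z.
Proof. by rewrite mulr_ge0 ?sqr_ge0 ?weight_ge0. Qed.

Lemma weight_measurable : measurable_fun setT (W : BCn R n -> R).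
Proof.
apply: measurableT_comp => //; apply: measurableT_comp => //.
by apply: measurable_funM => //; exact: usc_measurable.
Qed.

Lemma rintegral_CnE a : mu.-integrable setT (EFin \o (a : BCn R n -> R)) ->
  rintegral_Cn a = \int[mu]_z a z.
Proof.
move=> ia; have ma : measurable_fun setT (a : BCn R n -> R).
  by apply/measurable_EFinP; exact: measurable_int ia.
rewrite /rintegral_Cn /Rintegral (integralE mu setT) fineB; last 2 first.
- exact: integrable_pos_fin_num.
- exact: integrable_neg_fin_num.
congr (fine _ - fine _); rewrite integral_CnE.
- by apply: eq_integral => z _; rewrite funeposE EFin_max.
- by apply/measurable_EFinP; exact: measurable_maxr.
- by move=> z; rewrite lee_fin le_max lexx orbT.
- by apply: eq_integral => z _; rewrite funenegE EFin_max.
- by apply/measurable_EFinP; apply: measurable_maxr => //; exact: measurableT_comp.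
- by move=> z; rewrite lee_fin le_max lexx orbT.
Qed.

Definition sqint a : Prop := measurable_fun setT (a : BCn R n -> R) /\
  (\int[mu]_z (a z ^+ 2 * W z)%:E < +oo)%E.

Definition wdot a b : R := \int[mu]_z (a z * b z * W z).

Lemma sqint_integrable a : sqint a ->
  mu.-integrable setT (EFin \o (fun z : BCn R n => a z ^+ 2 * W z)).
Proof.
move=> [ma fa]; apply/integrableP; split.
  apply/measurable_EFinP; apply: measurable_funM; last exact: weight_measurable.
  exact: measurable_funX.
under eq_integral do rewrite abse_EFin (ger0_norm (sqW_ge0 _ _)).
exact: fa.
Qed.

Lemma mul_le_sqrD (x y : R) : `|x * y| <= x ^+ 2 + y ^+ 2.
Proof.
rewrite normrM -[x ^+ 2]real_normK ?num_real// -[y ^+ 2]real_normK ?num_real//.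
move: `|x| `|y| (normr_ge0 x) (normr_ge0 y) => {}x {}y x0 y0.
have := sqr_ge0 (x - y); have : 0 <= x * y by exact: mulr_ge0.
by rewrite !expr2 => ? ?; lra.
Qed.

Lemma wdot_integrable a b : sqint a -> sqint b ->
  mu.-integrable setT (EFin \o (fun z : BCn R n => a z * b z * W z)).
Proof.
move=> sa sb; have [ma _] := sa; have [mb _] := sb.
apply: (le_integrable measurableT _ _
  (integrableD measurableT (sqint_integrable sa) (sqint_integrable sb))).
  apply/measurable_EFinP; apply: measurable_funM; last exact: weight_measurable.
  exact: measurable_funM.
move=> z _; rewrite /= lee_fin -mulrDl !normrM (ger0_norm (weight_ge0 z)).
rewrite ler_wpM2r ?weight_ge0// -normrM.
by apply: le_trans (mul_le_sqrD _ _) _; exact: ler_norm.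
Qed.

Lemma sqint0 : sqint (fun=> 0).
Proof.
split; first exact: measurable_cst.
under eq_integral do rewrite expr0n mul0r.
by rewrite integral0.
Qed.

Lemma sqint_lin c a b : sqint a -> sqint b -> sqint (fun z => c * a z + b z).
Proof.
move=> sa sb; have [ma _] := sa; have [mb _] := sb.
have mab : measurable_fun setT (fun z : BCn R n => c * a z + b z).
  by apply: measurable_funD => //; apply: measurable_funM.
split; first exact: mab.
pose g (z : BCn R n) := 2 * (c ^+ 2 * (a z ^+ 2 * W z) + b z ^+ 2 * W z).
have ig : mu.-integrable setT (EFin \o g).
  have := integrableZl measurableT 2 (integrableD measurableT
    (integrableZl measurableT (c ^+ 2) (sqint_integrable sa)) (sqint_integrable sb)).
  by apply: eq_integrable => // z _.
have [_ gfin] := integrableP _ _ _ ig.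
apply: le_lt_trans gfin; apply: ge0_le_integral => //.
- by move=> z _; rewrite lee_fin mulr_ge0 ?sqr_ge0 ?weight_ge0.
- apply/measurable_EFinP; apply: measurable_funM; last exact: weight_measurable.
  exact: measurable_funX.
- by apply/measurable_EFinP; apply: measurableT_comp => //; apply/measurable_EFinP; exact: measurable_int ig.
move=> z _; rewrite /= lee_fin; apply: le_trans _ (ler_norm _).
rewrite /g mulrA -mulrDl mulrA ler_wpM2r ?weight_ge0//.
rewrite -exprMn; move: (c * a z) (b z) => x y.
rewrite -subr_ge0 (_ : _ - _ = (x - y) ^+ 2) ?sqr_ge0//.
ring.
Qed.

Lemma wdotC a b : wdot a b = wdot b a.
Proof. by apply: eq_Rintegral => z _; rewrite (mulrC (a z)). Qed.

Lemma wdot_linl c a b g : sqint a -> sqint b -> sqint g ->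
  wdot (fun z => c * a z + b z) g = c * wdot a g + wdot b g.
Proof.
move=> sa sb sg; have iag := wdot_integrable sa sg; have ibg := wdot_integrable sb sg.
rewrite /wdot -RintegralZl// -RintegralD//; last first.
  by have := integrableZl measurableT c iag; apply: eq_integrable => // z _.
by apply: eq_Rintegral => z _; rewrite !mulrDl !mulrA.
Qed.

Lemma wdot_ge0 a : 0 <= wdot a a.
Proof.
apply: Rintegral_ge0 => z _.
by rewrite -expr2 mulr_ge0 ?sqr_ge0 ?weight_ge0.
Qed.

Lemma wdotE a : sqint a -> (wdot a a)%:E = (\int[mu]_z (a z ^+ 2 * W z)%:E)%E.
Proof.
move=> sa; rewrite /wdot /Rintegral fineK //.
exact: integrable_fin_num (wdot_integrable sa sa).
Qed.

End weighted_L2.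

(** * Complex weighted L2 as a real semi-inner product space *)

Section complex_L2.
Variables (R : realType) (n : nat) (p : Cn R n -> R) (s : R).
Hypothesis up : upper_semicontinuous p.
Local Notation mu := (@lebesgue_Cn R n).
Implicit Types (u v h : Cn R n -> Rcomplex R).

Definition reF u : Cn R n -> R := fun z => complex.Re (u z).
Definition imF u : Cn R n -> R := fun z => complex.Im (u z).

(** The real part of the hermitian product. Its imaginary part is the real product with [mulI v],
    that is with i times [v], so the projection theorem is only needed over the reals. *)
Definition rdot u v : R := wdot p s (reF u) (reF v) + wdot p s (imF u) (imF v).

Definition mulI u : Cn R n -> Rcomplex R := fun z => Complex (- imF u z) (reF u z).

Lemma reF_lin a u v : reF (a *: u + v) = (fun z => a * reF u z + reF v z).
Proof. by apply/funext => z; rewrite /reF /GRing.add/= /GRing.scale/=; case: (u z); case: (v z). Qed.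

Lemma imF_lin a u v : imF (a *: u + v) = (fun z => a * imF u z + imF v z).
Proof. by apply/funext => z; rewrite /imF /GRing.add/= /GRing.scale/=; case: (u z); case: (v z). Qed.

Lemma normsq_integral u : measurable_fun setT (reF u : BCn R n -> R) ->
  measurable_fun setT (imF u : BCn R n -> R) ->
  normsq p s u = (\int[mu]_z (reF u z ^+ 2 * weight p s z)%:E +
    \int[mu]_z (imF u z ^+ 2 * weight p s z)%:E)%E.
Proof.
move=> mr mi.
have mW := weight_measurable s up.
have mr2 : measurable_fun setT (fun z : BCn R n => reF u z ^+ 2 * weight p s z).
  by apply: measurable_funM mW; exact: measurable_funX.
have mi2 : measurable_fun setT (fun z : BCn R n => imF u z ^+ 2 * weight p s z).
  by apply: measurable_funM mW; exact: measurable_funX.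
rewrite -ge0_integralD//; last 4 first.
- by move=> z _; rewrite lee_fin sqW_ge0.
- exact/measurable_EFinP.
- by move=> z _; rewrite lee_fin sqW_ge0.
- exact/measurable_EFinP.
rewrite /normsq integral_CnE.
- by apply: eq_integral => z _; rewrite -EFinD -mulrDl.
- apply/measurable_EFinP; rewrite (_ : (fun _ => _) =
    (fun z => reF u z ^+ 2 * weight p s z + imF u z ^+ 2 * weight p s z)); last first.
    by apply/funext => z; rewrite -mulrDl.
  exact: measurable_funD.
- by move=> z; rewrite lee_fin mulr_ge0 ?abs2_ge0 ?weight_ge0.
Qed.

Lemma inL2P u : inL2 p s u <-> sqint p s (reF u) /\ sqint p s (imF u).
Proof.
split=> [[/borel_funP mr [/borel_funP mi]]|[[mr fr] [mi fi]]].
  rewrite normsq_integral// => fin; split; split => //; apply: le_lt_trans fin.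
    by rewrite leeDl// integral_ge0// => z _; rewrite lee_fin sqW_ge0.
  by rewrite leeDr// integral_ge0// => z _; rewrite lee_fin sqW_ge0.
split; first exact/borel_funP; split; first exact/borel_funP.
by rewrite normsq_integral// lte_add_pinfty.
Qed.

Lemma normsqE u : inL2 p s u -> normsq p s u = (rdot u u)%:E.
Proof.
move=> /inL2P[sr si]; rewrite normsq_integral; [|by case: sr|by case: si].
by rewrite /rdot EFinD !wdotE.
Qed.

Lemma inL2_submodule : submodule_pred (inL2 p s : (Cn R n -> Rcomplex R) -> Prop).
Proof.
split; first by apply/inL2P; split; exact: sqint0.
move=> a u v /inL2P[? ?] /inL2P[? ?]; apply/inL2P; rewrite reF_lin imF_lin.
by split; exact: sqint_lin.
Qed.

Lemma rdot_semi_inner : semi_inner (inL2 p s : (Cn R n -> Rcomplex R) -> Prop) rdot.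
Proof.
split=> [u v _ _|a u v w /inL2P[? ?] /inL2P[? ?] /inL2P[? ?]|u _].
- by rewrite /rdot wdotC; congr (_ + _); exact: wdotC.
- by rewrite /rdot reF_lin imF_lin !wdot_linl// mulrDr addrACA.
- by rewrite /rdot addr_ge0// wdot_ge0.
Qed.

Lemma inL2_mulI u : inL2 p s u -> inL2 p s (mulI u).
Proof.
move=> /inL2P[sr si]; apply/inL2P; split; last exact: sr.
have := sqint_lin up (-1) si (sqint0 p s).
by congr sqint; apply/funext => z; rewrite mulN1r addr0.
Qed.

Lemma innerE u v : inL2 p s u -> inL2 p s v ->
  inner p s u v = Complex (rdot u v) (rdot u (mulI v)).
Proof.
move=> Lu Lv; have /inL2P[ur ui] := Lu; have /inL2P[vr vi] := Lv.
have /inL2P[ivr ivi] := inL2_mulI Lv.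
have E w : inL2 p s w -> rintegral_Cn
   (fun z => (reF u z * reF w z + imF u z * imF w z) * weight p s z) = rdot u w.
  move=> /inL2P[wr wi]; rewrite /rdot /wdot.
  rewrite -RintegralD//; [|exact: wdot_integrable..].
  have EF : (fun z => (reF u z * reF w z + imF u z * imF w z) * weight p s z) =
      (fun z => reF u z * reF w z * weight p s z + imF u z * imF w z * weight p s z).
    by apply/funext => z; rewrite mulrDl.
  rewrite rintegral_CnE; first by rewrite EF.
  rewrite EF; exact: (integrableD measurableT (wdot_integrable up ur wr) (wdot_integrable up ui wi)).
rewrite /inner /cintegral_Cn -(E _ Lv) -(E _ (inL2_mulI Lv)); congr Complex.
  congr rintegral_Cn; apply/funext => z; rewrite /reF /imF.
  by case: (u z) (v z) => a b [c d] /=; rewrite mulr0 subr0 mulrN opprK.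
congr rintegral_Cn; apply/funext => z; rewrite /mulI /reF /imF.
case: (u z) (v z) => a b [c d] /=; rewrite mulr0 add0r.
by rewrite !mulrN.
Qed.

End complex_L2.

(** * The space of entire functions and its pointwise bound *)

Section entire_space.
Variables (R : realType) (n : nat).
Implicit Types (u v h : Cn R n -> Rcomplex R).

Lemma pd_lin (a : R) (f g : Cn R n -> R) d z : derivable f z (delta_mx d.1 d.2) ->
  derivable g z (delta_mx d.1 d.2) ->
  pd (fun w => a * f w + g w) d z = a * pd f d z + pd g d z.
Proof.
move=> df dg; rewrite /pd.
have H1 := deriveD (@derivableZ _ _ _ _ a _ _ df) dg; have H2 := @deriveZ _ _ _ _ a _ _ df.
by apply: etrans H1 _; rewrite H2.
Qed.

Lemma entire_lin a u v : entire u -> entire v -> entire (a *: u + v).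
Proof.
move=> [du cu] [dv cv]; split=> z; rewrite -/(reF _) -/(imF _) reF_lin imF_lin.
  have [dur dui] := du z; have [dvr dvi] := dv z.
  by split; apply: differentiableD => //; exact: differentiableZ.
move=> j; have [du1 du2] := du z; have [dv1 dv2] := dv z.
have [cu1 cu2] := cu z j; have [cv1 cv2] := cv z j.
rewrite !pd_lin; try exact: diff_derivable.
by rewrite cu1 cv1 cu2 cv2 mulrN opprD.
Qed.

Lemma entire0 : entire (0 : Cn R n -> Rcomplex R).
Proof.
split=> [z|z j]; first by split; exact: differentiable_cst.
by rewrite /pd !derive_cst oppr0.
Qed.

Lemma entire_mulI u : entire u -> entire (mulI u).
Proof.
move=> [du cu]; split=> [z|z j].
  by have [d1 d2] := du z; split => //; exact: differentiableN.
have [c1 c2] := cu z j; have [d1 d2] := du z.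
have N d : pd (fun w => - complex.Im (u w)) d z = - pd (fun w => complex.Im (u w)) d z.
  by have := deriveN (@diff_derivable _ _ _ _ _ (delta_mx d.1 d.2) d2).
rewrite !N; split; first by rewrite -[RHS]/(pd (fun w => complex.Re (u w)) _ _) c2.
by rewrite -c1.
Qed.

Lemma abs2_re_im u z : abs2 (u z) = reF u z ^+ 2 + imF u z ^+ 2.
Proof. by []. Qed.

Lemma entire_abs2_measurable u : entire u ->
  measurable_fun setT ((fun z => abs2 (u z)) : BCn R n -> R).
Proof.
move=> /entire_continuous[cr ci].
by apply: measurable_funD; apply: measurable_funX; exact: continuous_borel.
Qed.

Variables (p : Cn R n -> R) (s : R).
Hypotheses (up : upper_semicontinuous p) (s0 : 0 < s).

Lemma inA2_submodule : submodule_pred (inA2 p s : (Cn R n -> Rcomplex R) -> Prop).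
Proof.
have [L0 Llin] := inL2_submodule s up.
split; first by split; [exact: entire0|exact: L0].
by move=> a u v [eu Lu] [ev Lv]; split; [exact: entire_lin|exact: Llin].
Qed.

Lemma inA2_mulI u : inA2 p s u -> inA2 p s (mulI u).
Proof. by move=> [eu Lu]; split; [exact: entire_mulI|exact: inL2_mulI]. Qed.

(** Upper semicontinuity bounds [p] on the unit ball around [z], so the [sup] in [ptilde] is a true
    upper bound and not a default value. *)
Lemma le_ptilde z w : enorm (w - z) <= 1 -> p w <= ptilde p z.
Proof.
move=> wz; apply: ub_le_sup; last by exists (w - z) => //; rewrite addrC subrK.
have [K hK] := usc_bounded (enorm z + 1) up.
exists K => _ [zeta /= z1 <-]; apply: hK => i j; rewrite mxE.
apply: le_trans (ler_normD _ _) _; apply: lerD; first exact: coord_le_enorm.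
exact: le_trans (coord_le_enorm _ _ _) z1.
Qed.

(** Squares of half-side [2 * box_radius] in every coordinate must fit in the Euclidean unit ball:
    there are [2 * n] real coordinates, and [2 * n <= (2 * n.+1) ^ 2]. The successor keeps the
    denominator nonzero for [n = 0]. *)
Definition box_radius : R := (4 * n.+1%:R)^-1.

Lemma box_radius_gt0 : 0 < box_radius.
Proof. by rewrite invr_gt0 mulr_gt0. Qed.

Lemma enorm_box (z : Cn R n) : (forall i j, `|z i j| <= 2 * box_radius) -> enorm z <= 1.
Proof.
move=> hz; rewrite -[leRHS]sqrtr1 ler_wsqrtr//.
apply: (@le_trans _ _ (\sum_(i < 2) \sum_(j < n) (2 * box_radius) ^+ 2)).
  by apply: ler_sum => i _; apply: ler_sum => j _; rewrite -[leLHS]real_normK ?num_real// lerXn2r ?nnegrE ?normr_ge0 ?hz// mulr_ge0// ltW// box_radius_gt0.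
rewrite !sumr_const !card_ord -mulrnA.
have -> : (2 * box_radius) ^+ 2 = (4 * n.+1%:R ^+ 2)^-1.
  rewrite /box_radius; have : n.+1%:R != 0 :> R by rewrite pnatr_eq0.
  by move: (n.+1%:R) => x x0; field.
rewrite -[leLHS]mulr_natl ler_pdivrMr ?mulr_gt0 ?exprn_gt0// mul1r -natrX -natrM ler_nat.
rewrite !expnS expn0; lia.
Qed.

Definition point_bound (z : Cn R n) : R :=
  (8 / box_radius ^+ 2) ^+ n * expR (2 * s * ptilde p z).

Lemma box_ind_supp (z w : Cn R n) r :
  box_ind r n (rowC ord0 z) (rowC ord_max z) (rowC ord0 w) (rowC ord_max w) != 0 ->
  box_ind r n (rowC ord0 z) (rowC ord_max z) (rowC ord0 w) (rowC ord_max w) = 1 /\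
  forall i j, `|(w - z) i j| <= 2 * r.
Proof.
move=> b0; have H (j : 'I_n) : (rowC ord0 w j, rowC ord_max w j) \in
    sq_box (rowC ord0 z j) (rowC ord_max z j) r.
  apply: contra_neqT b0 => h; rewrite /box_ind (bigD1 j)//= indicE (negbTE h).
  by rewrite mul0r.
split; first by rewrite /box_ind big1// => j _; rewrite indicE H.
move=> i j; have := H j; rewrite inE /sq_box /= !in_itv/= !rowCE => -[].
rewrite -!ler_distl => h1 h2; rewrite !mxE.
case: (unliftP ord0 i) => [i' ->|-> //].
by rewrite (_ : lift ord0 i' = ord_max)//; apply: ord_inj; case: i' => -[].
Qed.

Lemma measurable_rowC i0 k : measurable_fun setT ((fun w => rowC i0 w k) : BCn R n -> R).
Proof.
rewrite /rowC; case: insubP => [j _ _|_]; last exact: measurable_cst.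
by apply: continuous_borel; exact: coord_continuous.
Qed.

(** On the box around [z] one has [p w <= ptilde p z], hence [1 <= expR (2 * s * ptilde p z) *
    weight p s w]; inserting this factor turns the unweighted mean into the weighted norm. *)
Lemma A2_point_bound h z : inA2 p s h -> abs2 (h z) <= point_bound z * rdot p s h h.
Proof.
move=> [eh Lh]; have r0 := box_radius_gt0.
pose C := (8 / box_radius ^+ 2) ^+ n.
have C0 : 0 <= C by rewrite exprn_ge0// divr_ge0// exprn_ge0// ltW.
have mh := entire_abs2_measurable eh.
have mW := weight_measurable s up.
rewrite -lee_fin; apply: le_trans (entire_submean z eh r0) _.
have -> : (point_bound z * rdot p s h h)%:E =
    (C%:E * ((expR (2 * s * ptilde p z))%:E * (rdot p s h h)%:E))%E.
  by rewrite -!EFinM mulrA.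
apply: lee_wpmul2l; first by rewrite lee_fin.
rewrite -(normsqE up Lh) /normsq.
have mhW : measurable_fun setT (fun w : BCn R n => (abs2 (h w) * weight p s w)%:E).
  by apply/measurable_EFinP; exact: measurable_funM.
have hW0 (w : Cn R n) : (0 <= (abs2 (h w) * weight p s w)%:E)%E.
  by rewrite lee_fin mulr_ge0 ?abs2_ge0 ?weight_ge0.
have mb : measurable_fun setT (fun w : BCn R n => (abs2 (h w) *
    box_ind box_radius n (rowC ord0 z) (rowC ord_max z) (rowC ord0 w) (rowC ord_max w))%:E).
  apply/measurable_EFinP; apply: measurable_funM => //.
  by apply: measurable_box_ind => k; exact: measurable_rowC.
have b0 (w : Cn R n) : (0 <= (abs2 (h w) *
    box_ind box_radius n (rowC ord0 z) (rowC ord_max z) (rowC ord0 w) (rowC ord_max w))%:E)%E.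
  by rewrite lee_fin mulr_ge0 ?abs2_ge0 ?box_ind_ge0.
have e0 : (0 <= (expR (2 * s * ptilde p z))%:E :> \bar R)%E by rewrite lee_fin expR_ge0.
rewrite (integral_CnE mb b0) (integral_CnE mhW hW0).
rewrite -(ge0_integralZl (@lebesgue_Cn R n) measurableT mhW (fun w _ => hW0 w) e0).
apply: ge0_le_integral => //.
  by apply: measurable_funeM.
move=> w _; rewrite -EFinM lee_fin mulrCA ler_wpM2l ?abs2_ge0//.
have [->|] := eqVneq
  (box_ind box_radius n (rowC ord0 z) (rowC ord_max z) (rowC ord0 w) (rowC ord_max w)) 0; first by rewrite mulr_ge0 ?expR_ge0.
move=> /box_ind_supp[-> wz]; rewrite /weight -expRD -[leLHS]expR0 ler_expR.
rewrite subr_ge0; apply: ler_wpM2l; first by rewrite mulr_ge0// ltW.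
by apply: le_ptilde; apply: enorm_box.
Qed.

End entire_space.

(** * Limits of Cauchy sequences of entire functions *)

Section completeness.
Variables (R : realType) (n : nat) (p : Cn R n -> R) (s : R).
Hypotheses (up : upper_semicontinuous p) (s0 : 0 < s).
Local Notation mu := (@lebesgue_Cn R n).
Implicit Types (u v : Cn R n -> Rcomplex R).

Lemma sqr_cauchy_cvg (a : nat -> R) (c : R) :
  (forall l m, (l <= m)%N -> (a m - a l) ^+ 2 <= c * l.+1%:R^-1) -> cvg (a @ \oo).
Proof.
move=> ha; apply: cauchy_cvg; apply: cauchy_exP => e e0.
have cv : (fun l : nat => c * l.+1%:R^-1) @ \oo --> c * 0.
  exact: (cvgM (cvg_cst c) (@cvg_harmonic R)).
rewrite mulr0 in cv.
have [N _ /(_ N (leqnn N)) hN] := cvgr_lt _ cv _ (exprn_gt0 2 e0).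
exists (a N); exists N => // m /= Nm; rewrite /ball/= distrC.
have : `|a m - a N| ^+ 2 < e ^+ 2.
  by rewrite real_normK ?num_real// (le_lt_trans (ha _ _ Nm)).
by rewrite ltr_pXn2r// nnegrE// ltW.
Qed.

Lemma normsq_fatou (g : nat -> Cn R n -> Rcomplex R) u (c : R) (l : nat) :
  (forall m, inL2 p s (g m)) ->
  (forall z, reF (g m) z @[m --> \oo] --> reF u z) ->
  (forall z, imF (g m) z @[m --> \oo] --> imF u z) ->
  (forall m, (l <= m)%N -> (normsq p s (g m) <= c%:E)%E) ->
  inL2 p s u /\ (normsq p s u <= c%:E)%E.
Proof.
move=> Lg cr ci hc.
have mr m : measurable_fun setT (reF (g m) : BCn R n -> R) by have /(inL2P s up)[[]] := Lg m.
have mi m : measurable_fun setT (imF (g m) : BCn R n -> R) by have /(inL2P s up)[_ []] := Lg m.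
have mru : measurable_fun setT (reF u : BCn R n -> R).
  by apply: (measurable_fun_cvg (h := fun m => reF (g m) : BCn R n -> R)) => // z _; exact: cr.
have miu : measurable_fun setT (imF u : BCn R n -> R).
  by apply: (measurable_fun_cvg (h := fun m => imF (g m) : BCn R n -> R)) => // z _; exact: ci.
have mW := weight_measurable s up.
pose F v : BCn R n -> \bar R := fun z => (abs2 (v z) * weight p s z)%:E.
have F0 v z : (0 <= F v z)%E by rewrite lee_fin mulr_ge0 ?abs2_ge0 ?weight_ge0.
have mF v : measurable_fun setT (reF v : BCn R n -> R) ->
    measurable_fun setT (imF v : BCn R n -> R) -> measurable_fun setT (F v).
  move=> h1 h2; apply/measurable_EFinP; apply: measurable_funM mW.
  by apply: measurable_funD; exact: measurable_funX.
have nE v : measurable_fun setT (reF v : BCn R n -> R) ->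
    measurable_fun setT (imF v : BCn R n -> R) -> normsq p s v = (\int[mu]_z F v z)%E.
  by move=> h1 h2; exact: integral_CnE (mF v h1 h2) (F0 v).
have le_c : (normsq p s u <= c%:E)%E.
  rewrite nE//.
  have := @fatou _ _ _ mu setT measurableT (fun m => F (g m))
    (fun m => mF _ (mr m) (mi m)) (fun m z _ => F0 _ z).
  have -> : (\int[mu]_z limn_einf (fun m => F (g m) z) = \int[mu]_z F u z)%E.
    apply: eq_integral => z _.
    have cF : F (g m) z @[m --> \oo] --> F u z.
      apply: cvg_EFin; first by apply: nearW => m; rewrite /F.
      apply: cvgM; last exact: cvg_cst.
      by apply: cvgD; rewrite expr2; under eq_fun do rewrite expr2; apply: cvgM; [exact: cr|exact: cr|exact: ci|exact: ci].
    by rewrite is_cvg_limn_einfE; [exact: cvg_lim cF|exact: cvgP cF].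
  move=> /le_trans; apply; rewrite limn_einf_lim; apply: lime_le; first exact: is_cvg_einfs.
  exists l => // m /= lm; apply: le_trans (hc _ lm).
  by rewrite nE//; apply: ereal_inf_lbound; exists m => /=.
split => //; split; first exact/borel_funP; split; first exact/borel_funP.
by rewrite (le_lt_trans le_c) ?ltry.
Qed.

(** The pointwise bound upgrades a Cauchy sequence in norm to one that converges at every point, so
    the limit is measurable. Fatou's lemma applied to [h m - h l] gives square-integrability and the
    rate. *)
Lemma inA2_complete (h : nat -> Cn R n -> Rcomplex R) : (forall l, inA2 p s (h l)) ->
  (forall l m, (l <= m)%N -> rdot p s (h m - h l) (h m - h l) <= 4 * l.+1%:R^-1) ->
  exists P, inL2 p s P /\ forall l, rdot p s (P - h l) (P - h l) <= 4 * l.+1%:R^-1.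
Proof.
move=> Ah hh; have [_ Alin] := inA2_submodule s up.
have sL := inL2_submodule s up.
have Lh l : inL2 p s (h l) by case: (Ah l).
have reB u v z : reF (u - v) z = reF u z - reF v z.
  by rewrite addrC -scaleN1r reF_lin mulN1r addrC.
have imB u v z : imF (u - v) z = imF u z - imF v z.
  by rewrite addrC -scaleN1r imF_lin mulN1r addrC.
have bd z l m : (l <= m)%N -> (reF (h m) z - reF (h l) z) ^+ 2 <= point_bound p s z * 4 * l.+1%:R^-1 /\
    (imF (h m) z - imF (h l) z) ^+ 2 <= point_bound p s z * 4 * l.+1%:R^-1.
  move=> lm; have Aml : inA2 p s (h m - h l) by rewrite addrC -scaleN1r; exact: Alin.
  have H : abs2 ((h m - h l : Cn R n -> Rcomplex R) z) <= point_bound p s z * 4 * l.+1%:R^-1.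
    apply: le_trans (A2_point_bound up s0 z Aml) _; rewrite -mulrA ler_wpM2l ?hh//.
    by rewrite mulr_ge0 ?expR_ge0// exprn_ge0// divr_ge0// exprn_ge0// ltW// box_radius_gt0.
  by rewrite -reB -imB; split; apply: le_trans H; rewrite abs2_re_im ?lerDl ?lerDr sqr_ge0.
have cr z : cvg (reF (h m) z @[m --> \oo]).
  by apply: (@sqr_cauchy_cvg _ (point_bound p s z * 4)) => l m /(bd z)[].
have ci z : cvg (imF (h m) z @[m --> \oo]).
  by apply: (@sqr_cauchy_cvg _ (point_bound p s z * 4)) => l m /(bd z)[].
pose P : Cn R n -> Rcomplex R := fun z => Complex (limn (fun m => reF (h m) z)) (limn (fun m => imF (h m) z)).
have PL l : inL2 p s (P - h l) /\ (normsq p s (P - h l)%R <= (4 * l.+1%:R^-1)%:E)%E.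
  apply: (@normsq_fatou (fun m => h m - h l) _ _ l) => [m|z|z|m lm].
  - exact: submodule_sub.
  - rewrite reB; under eq_fun do rewrite reB.
    by apply: cvgB; [exact: cr|exact: cvg_cst].
  - rewrite imB; under eq_fun do rewrite imB.
    by apply: cvgB; [exact: ci|exact: cvg_cst].
  - by rewrite normsqE ?lee_fin ?hh//; exact: submodule_sub.
exists P; split.
  rewrite -[P](subrK (h 0%N)) -[X in X + _]scale1r; apply: sL.2 => //; exact: (PL 0%N).1.
by move=> l; have [L1 L2] := PL l; rewrite -lee_fin -normsqE.
Qed.

End completeness.

(** * The canonical solution *)

Section test_functions.
Variables (R : realType) (n : nat).
Implicit Types (f g : Cn R n -> R) (i : 'I_2) (k : 'I_n) (d : 'I_2 * 'I_n).

Lemma coord_derive i k d z : is_derive z (delta_mx d.1 d.2) (fun w : Cn R n => w i k)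
  (((i, k) == d)%:R : R).
Proof.
have H := @derivable_id R (Cn R n) z (delta_mx d.1 d.2).
have D : derivable (fun w : Cn R n => w i k) z (delta_mx d.1 d.2).
  by have /derivable_mxP := H; apply.
split => //; have := derive_mx H; rewrite derive_id => /matrixP/(_ i k).
by rewrite !mxE => <-; rewrite -pair_eqE /= /pair_eq.
Qed.

Lemma coord_mul_derive i k g1 g2 d z :
  derivable g1 z (delta_mx d.1 d.2) -> derivable g2 z (delta_mx d.1 d.2) ->
  is_derive z (delta_mx d.1 d.2) (fun w : Cn R n => w i k * g1 w + g2 w)
    (z i k * pd g1 d z + (((i, k) == d)%:R * g1 z + pd g2 d z)).
Proof.
move=> D1 D2; have Dx := coord_derive i k d z.
have I1 : is_derive z (delta_mx d.1 d.2) g1 (pd g1 d z) by exact: DeriveDef.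
have I2 : is_derive z (delta_mx d.1 d.2) g2 (pd g2 d z) by exact: DeriveDef.
have [Id Iv] := is_deriveD (is_deriveM Dx I1) I2.
split; first exact: Id.
apply: etrans Iv _.
by rewrite addrA; congr (_ + _ + _); rewrite /GRing.scale /= mulrC.
Qed.

Lemma dpart_rcons l d g : dpart (rcons l d) g = dpart l (pd g d).
Proof. by elim: l => //= d' l ->. Qed.

Lemma smooth_pd g d : smooth g -> smooth (pd g d).
Proof. by move=> sg l; rewrite -dpart_rcons; exact: sg. Qed.

Lemma dpart_lin a f g l : smooth f -> smooth g ->
  dpart l (fun z => a * f z + g z) = (fun z => a * dpart l f z + dpart l g z).
Proof.
move=> sf sg; elim: l => //= d l ->; apply/funext => z.
by apply: pd_lin; [have [_] := sf l|have [_] := sg l]; apply.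
Qed.

Lemma smooth_lin a f g : smooth f -> smooth g -> smooth (fun z => a * f z + g z).
Proof.
move=> sf sg l; rewrite dpart_lin//; have [cf df] := sf l; have [cg dg] := sg l.
split=> [z|z d]; first exact: (cvgD (cvgM (cvg_cst a) (cf z)) (cg z)).
exact: (derivableD (@derivableZ _ _ _ _ a _ _ (df z d)) (dg z d)).
Qed.

(** Expressions of this shape are stable under partial derivatives, so the induction generalizes
    over [g1] and [g2]. It peels the list from its end because that entry is the derivative taken
    first. *)
Lemma smooth_coord_mul i k g1 g2 : smooth g1 -> smooth g2 ->
  smooth (fun z => z i k * g1 z + g2 z).
Proof.
move=> s1 s2 l; elim/last_ind: l g1 g2 s1 s2 => [|l d IH] g1 g2 s1 s2.
  have [c1 d1] := s1 [::]; have [c2 d2] := s2 [::].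
  split=> [z|z d] /=; last first.
    by have [] := coord_mul_derive i k (d1 z d) (d2 z d).
  exact: (cvgD (cvgM (@coord_continuous R 2 n i k z) (c1 z)) (c2 z)).
rewrite dpart_rcons.
have -> : pd (fun z => z i k * g1 z + g2 z) d =
    (fun z => z i k * pd g1 d z + (((i, k) == d)%:R * g1 z + pd g2 d z)).
  apply/funext => z; have [_ d1] := s1 [::]; have [_ d2] := s2 [::].
  by have [] := coord_mul_derive i k (d1 z d) (d2 z d).
exact: (IH _ _ (smooth_pd d s1) (smooth_lin _ s1 (smooth_pd d s2))).
Qed.

Lemma smooth0 : smooth (fun _ : Cn R n => 0).
Proof.
move=> l; have -> : dpart l (fun _ : Cn R n => 0 : R) = fun=> 0.
  by elim: l => //= d l ->; apply/funext => z; rewrite /pd derive_cst.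
by split=> [z|z d]; [exact: cst_continuous|exact: derivable_cst].
Qed.

Definition conj_mul (l : 'I_n) (phi : Cn R n -> R[i]) : Cn R n -> R[i] :=
  fun z => conjc (zcoord z l) * phi z.

Lemma test_function_conj_mul l phi : test_function phi -> test_function (conj_mul l phi).
Proof.
move=> [sr [si [M phi0]]]; split; [|split]; last first.
- by exists M => z /phi0; rewrite /conj_mul => ->; rewrite mulr0.
- have := smooth_coord_mul ord0 l si (smooth_coord_mul ord_max l (smooth_lin (-1) sr smooth0) smooth0).
  congr smooth; apply/funext => z; rewrite /conj_mul /zcoord; case: (phi z) => a b /=.
  by rewrite !addr0 mulN1r mulrN mulNr.
- have := smooth_coord_mul ord0 l sr (smooth_coord_mul ord_max l si smooth0).
  congr smooth; apply/funext => z; rewrite /conj_mul /zcoord; case: (phi z) => a b /=.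
  by rewrite addr0 mulNr opprK.
Qed.

Lemma complex_half (a b : R) : Complex a b / 2%:R = Complex (a / 2) (b / 2).
Proof.
have n2 : 2%:R != 0 :> R[i] by rewrite pnatr_eq0.
apply: (mulIf n2); rewrite divfK// mulr2n mulrDr mulr1.
by congr Complex; rewrite /= -splitr.
Qed.

Lemma dzbarE (phi : Cn R n -> R[i]) j z : dzbar phi j z =
  Complex ((pd (reF phi) (ord0, j) z - pd (imF phi) (ord_max, j) z) / 2)
          ((pd (imF phi) (ord0, j) z + pd (reF phi) (ord_max, j) z) / 2).
Proof.
rewrite -complex_half /dzbar; congr (_ / _); rewrite /dxC -/(reF phi) -/(imF phi).
by congr Complex; rewrite /= !(mul0r, mul1r) ?sub0r ?add0r.
Qed.

Lemma pd_coord_mul i k g1 g2 d z :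
  derivable g1 z (delta_mx d.1 d.2) -> derivable g2 z (delta_mx d.1 d.2) ->
  pd (fun w : Cn R n => w i k * g1 w + g2 w) d z =
    z i k * pd g1 d z + (((i, k) == d)%:R * g1 z + pd g2 d z).
Proof. by move=> D1 D2; have [] := coord_mul_derive i k D1 D2. Qed.

Lemma dzbar_conj_mul_arith (A B C D a b x y e : R) :
  Complex ((x * A + (e * a + (y * B + (0 * b + 0))) -
            (x * D + (0 * b + (y * - C + (e * (-1 * a + 0) + 0))))) / 2)
          ((x * B + (e * b + (y * - A + (0 * (-1 * a + 0) + 0))) +
            (x * C + (0 * a + (y * D + (e * b + 0))))) / 2) =
  Complex x (- y) * Complex ((A - D) / 2) ((B + C) / 2) + Complex (e * a) (e * b).
Proof.
have E (r1 r2 s1 s2 : R) : r1 = s1 -> r2 = s2 -> Complex r1 r2 = Complex s1 s2 by move=> -> ->.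
by apply: E; field.
Qed.

Lemma dzbar_conj_mul l (phi : Cn R n -> R[i]) j z : test_function phi ->
  dzbar (conj_mul l phi) j z = conjc (zcoord z l) * dzbar phi j z + (l == j)%:R * phi z.
Proof.
move=> [sr [si _]].
have dr d : derivable (reF phi) z (delta_mx d.1 d.2) by have [_] := sr [::]; apply.
have di d : derivable (imF phi) z (delta_mx d.1 d.2) by have [_] := si [::]; apply.
have dN d : derivable (fun w => -1 * reF phi w + 0) z (delta_mx d.1 d.2).
  by have [_] := smooth_lin (-1) sr smooth0 [::]; apply.
have Nr d : pd (fun w => -1 * reF phi w + 0) d z = - pd (reF phi) d z.
  rewrite (@pd_lin _ _ (-1) (reF phi) (fun=> 0) d z (dr d) (derivable_cst _ _ _)).
  by rewrite mulN1r /pd derive_cst addr0.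
have d0 d : derivable (fun=> 0 : R) z (delta_mx d.1 d.2) by exact: derivable_cst.
have E0 d : pd (fun=> 0 : R) d z = 0 by rewrite /pd derive_cst.
have dyi d : derivable (fun w : Cn R n => w ord_max l * imF phi w + 0) z (delta_mx d.1 d.2).
  by have [] := coord_mul_derive ord_max l (di d) (d0 d).
have dyr d : derivable (fun w : Cn R n => w ord_max l * (-1 * reF phi w + 0) + 0) z (delta_mx d.1 d.2).
  by have [] := coord_mul_derive ord_max l (dN d) (d0 d).
have Er : reF (conj_mul l phi) =
    (fun w => w ord0 l * reF phi w + (w ord_max l * imF phi w + 0)).
  apply/funext => w; rewrite /reF /imF /conj_mul /zcoord; case: (phi w) => a b /=.
  by rewrite addr0 mulNr opprK.
have Ei : imF (conj_mul l phi) =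
    (fun w => w ord0 l * imF phi w + (w ord_max l * (-1 * reF phi w + 0) + 0)).
  apply/funext => w; rewrite /reF /imF /conj_mul /zcoord; case: (phi w) => a b /=.
  by rewrite !addr0 mulN1r mulrN mulNr.
rewrite !dzbarE Er Ei !pd_coord_mul// !Nr !E0 !xpair_eqE !eqxx.
rewrite (_ : (ord0 == ord_max :> 'I_2) = false)// (_ : (ord_max == ord0 :> 'I_2) = false)//=.
have -> : (l == j)%:R * phi z = Complex ((l == j)%:R * reF phi z) ((l == j)%:R * imF phi z).
  rewrite /reF /imF; case: (phi z) => a b; case: (l == j); rewrite ?mul1r ?mul0r//.
exact: dzbar_conj_mul_arith.
Qed.

End test_functions.

(** * Entire functions are weakly annihilated by dbar *)

Section weak_dbar.
Variables (R : realType) (n : nat).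
Local Notation mu := (@lebesgue_Cn R n).
Implicit Types (u v D : Cn R n -> R[i]) (a b : Cn R n -> R).

Definition cintegrable u : Prop :=
  mu.-integrable setT (EFin \o (reF u : BCn R n -> R)) /\
  mu.-integrable setT (EFin \o (imF u : BCn R n -> R)).

Lemma cintegral_CnE u : cintegrable u ->
  cintegral_Cn u = Complex (\int[mu]_z reF u z) (\int[mu]_z imF u z).
Proof.
move=> [ir ii]; rewrite /cintegral_Cn.
by congr Complex; [exact: (rintegral_CnE ir)|exact: (rintegral_CnE ii)].
Qed.

Lemma cintegrableD u v : cintegrable u -> cintegrable v ->
  cintegrable (fun z => u z + v z) /\
  cintegral_Cn (fun z => u z + v z) = cintegral_Cn u + cintegral_Cn v.
Proof.
move=> cu cv; have [ur ui] := cu; have [vr vi] := cv.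
have Er : reF (fun z => u z + v z) = (fun z => reF u z + reF v z).
  by apply/funext => z; rewrite /reF; case: (u z); case: (v z).
have Ei : imF (fun z => u z + v z) = (fun z => imF u z + imF v z).
  by apply/funext => z; rewrite /imF; case: (u z); case: (v z).
have cuv : cintegrable (fun z => u z + v z).
  split; rewrite ?Er ?Ei; [exact: (integrableD measurableT ur vr)|exact: (integrableD measurableT ui vi)].
split=> //; rewrite !cintegral_CnE// Er Ei !RintegralD//.
Qed.

Lemma cintegrable0 : cintegrable (fun=> 0) /\ cintegral_Cn (fun _ : Cn R n => 0) = 0.
Proof.
have c0 : cintegrable (fun=> 0) by split; exact: integrable0.
by split=> //; rewrite cintegral_CnE// /Rintegral !integral0.
Qed.

Lemma cintegrableN u : cintegrable u ->
  cintegrable (fun z => - u z) /\ cintegral_Cn (fun z => - u z) = - cintegral_Cn u.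
Proof.
move=> cu; have [ur ui] := cu.
have Er : reF (fun z => - u z) = (fun z => -1 * reF u z).
  by apply/funext => z; rewrite /reF mulN1r; case: (u z).
have Ei : imF (fun z => - u z) = (fun z => -1 * imF u z).
  by apply/funext => z; rewrite /imF mulN1r; case: (u z).
have cuN : cintegrable (fun z => - u z).
  split; rewrite ?Er ?Ei.
    by have := integrableZl measurableT (-1) ur; apply: eq_integrable => // z _.
  by have := integrableZl measurableT (-1) ui; apply: eq_integrable => // z _.
by split=> //; rewrite !cintegral_CnE// Er Ei !RintegralZl// !mulN1r.
Qed.

Lemma cintegrable_sum (I : Type) (r : seq I) (F : I -> Cn R n -> R[i]) :
  (forall i, cintegrable (F i)) ->
  cintegrable (fun z => \sum_(i <- r) F i z) /\
  cintegral_Cn (fun z => \sum_(i <- r) F i z) = \sum_(i <- r) cintegral_Cn (F i).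
Proof.
move=> cF; elim: r => [|i r [IH1 IH2]].
  by rewrite big_nil; under eq_fun do rewrite big_nil; exact: cintegrable0.
have [h1 h2] := cintegrableD (cF i) IH1.
by rewrite big_cons -IH2 -h2; under eq_fun do rewrite big_cons.
Qed.

Definition compactly_supported D : Prop := [/\ continuous (reF D), continuous (imF D) &
  exists M : R, forall z, M < enorm z -> D z = 0].

Lemma compactly_supported_test phi : test_function phi -> compactly_supported phi.
Proof. by move=> [sr [si M0]]; split => //; [have [] := sr [::]|have [] := si [::]]. Qed.

Lemma compactly_supported_dzbar phi j : test_function phi ->
  compactly_supported (dzbar phi j).
Proof.
move=> [sr [si [M phi0]]].
have cr d : continuous (pd (reF phi) d) by have [] := sr [:: d].
have ci d : continuous (pd (imF phi) d) by have [] := si [:: d].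
have r0 d : forall z, M < enorm z -> pd (reF phi) d z = 0.
  by apply: pd_support => z /phi0; rewrite /reF => ->.
have i0 d : forall z, M < enorm z -> pd (imF phi) d z = 0.
  by apply: pd_support => z /phi0; rewrite /imF => ->.
split; last by exists M => z Mz; rewrite dzbarE !r0// !i0// subr0 addr0 mul0r.
  have -> : reF (dzbar phi j) = (fun z =>
      (pd (reF phi) (ord0, j) z - pd (imF phi) (ord_max, j) z) / 2).
    by apply/funext => z; rewrite /reF dzbarE.
  by move=> z; exact: (cvgM (cvgB (cr _ z) (ci _ z)) (cvg_cst _)).
have -> : imF (dzbar phi j) = (fun z =>
    (pd (imF phi) (ord0, j) z + pd (reF phi) (ord_max, j) z) / 2).
  by apply/funext => z; rewrite /imF dzbarE.
by move=> z; exact: (cvgM (cvgD (ci _ z) (cr _ z)) (cvg_cst _)).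
Qed.

(** The real and the imaginary part of [phi] each yield two vanishing integrals by [entire_weak];
    combined with coefficients -1 and 1 these are the two parts of the claim. *)
Lemma entire_dbar0 h (phi : Cn R n -> R[i]) j : entire h -> test_function phi ->
  cintegral_Cn (fun z => h z * dzbar phi j z) = 0.
Proof.
move=> eh tphi; have [sr [si [M phi0]]] := tphi.
have [cu cv] := entire_continuous eh.
have phir0 z : M < enorm z -> reF phi z = 0 by move=> /phi0; rewrite /reF => ->.
have phii0 z : M < enorm z -> imF phi z = 0 by move=> /phi0; rewrite /imF => ->.
have [wr1 wr2] := entire_weak j eh sr phir0.
have [wi1 wi2] := entire_weak j eh si phii0.
have int a b d e psi : continuous a -> continuous b -> smooth psi ->
    (forall z, M < enorm z -> psi z = 0) ->
    mu.-integrable setT (EFin \o ((fun z => a z * pd psi d z + b z * pd psi e z) : BCn R n -> R)).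
  move=> ca cb sp psi0; have cp d' : continuous (pd psi d') by have [] := sp [:: d'].
  have p0 d' := @pd_support R n psi M d' psi0.
  apply: (@compact_support_integrable _ _ _ M) => [z|z Mz]; last by rewrite !p0// !mulr0 addr0.
  exact: (cvgD (cvgM (ca z) (cp _ z)) (cvgM (cb z) (cp _ z))).
have cNv : continuous (fun z => - imF h z) by move=> z; exact: (cvgN (cv z)).
have half F G : mu.-integrable setT (EFin \o (F : BCn R n -> R)) ->
    mu.-integrable setT (EFin \o (G : BCn R n -> R)) ->
    (\int[mu]_z (F z)%:E = 0)%E -> (\int[mu]_z (G z)%:E = 0)%E -> forall c,
    mu.-integrable setT (EFin \o ((fun z => 2^-1 * (F z + c * G z)) : BCn R n -> R)) /\
    \int[mu]_z (2^-1 * (F z + c * G z)) = 0.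
  move=> iF iG F0 G0 c.
  have iG' : mu.-integrable setT (EFin \o ((fun z => c * G z) : BCn R n -> R)).
    by have := integrableZl measurableT c iG; apply: eq_integrable => // z _.
  have iFG := integrableD measurableT iF iG'.
  split; first by have := integrableZl measurableT 2^-1 iFG; apply: eq_integrable => // z _.
  rewrite RintegralZl// RintegralD// RintegralZl//.
  by rewrite /Rintegral F0 G0 !(mulr0, addr0).
have ir1 := int _ _ (ord0, j) (ord_max, j) _ cu cNv sr phir0.
have ii1 := int _ _ (ord0, j) (ord_max, j) _ cv cu si phii0.
have ir2 := int _ _ (ord0, j) (ord_max, j) _ cv cu sr phir0.
have ii2 := int _ _ (ord0, j) (ord_max, j) _ cu cNv si phii0.
have EN psi : (fun z => complex.Re (h z) * pd psi (ord0, j) z + - imF h z * pd psi (ord_max, j) z) =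
    (fun z => complex.Re (h z) * pd psi (ord0, j) z - complex.Im (h z) * pd psi (ord_max, j) z).
  by apply/funext => z; rewrite mulNr.
rewrite EN in ir1; rewrite EN in ii2.
have [jr Jr] := half _ _ ir1 ii1 wr2 wi1 (-1).
have [ji Ji] := half _ _ ir2 ii2 wr1 wi2 1.
have Er : reF (fun z => h z * dzbar phi j z) = (fun z => 2^-1 *
  (complex.Re (h z) * pd (reF phi) (ord0, j) z - complex.Im (h z) * pd (reF phi) (ord_max, j) z +
   -1 * (complex.Im (h z) * pd (imF phi) (ord0, j) z + complex.Re (h z) * pd (imF phi) (ord_max, j) z))).
  apply/funext => z; rewrite [LHS]/reF dzbarE; case: (h z) => x y /=.
  by move: (pd _ _ _) (pd _ _ _) (pd _ _ _) (pd _ _ _) => A B C E; field.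
have Ei : imF (fun z => h z * dzbar phi j z) = (fun z => 2^-1 *
  (complex.Im (h z) * pd (reF phi) (ord0, j) z + complex.Re (h z) * pd (reF phi) (ord_max, j) z +
   1 * (complex.Re (h z) * pd (imF phi) (ord0, j) z - complex.Im (h z) * pd (imF phi) (ord_max, j) z))).
  apply/funext => z; rewrite [LHS]/imF dzbarE; case: (h z) => x y /=.
  by move: (pd _ _ _) (pd _ _ _) (pd _ _ _) (pd _ _ _) => A B C E; field.
rewrite cintegral_CnE; last by split; rewrite ?Er ?Ei; [exact: jr|exact: ji].
by rewrite Er Ei; congr Complex; [exact: Jr|exact: Ji].
Qed.

End weak_dbar.

(** * The primitive and its correction in the weighted space *)

Section dbar_solution.
Variables (R : realType) (n : nat) (p : Cn R n -> R) (s : R).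
Hypotheses (up : upper_semicontinuous p) (s0 : 0 < s).
Local Notation mu := (@lebesgue_Cn R n).
Implicit Types (u v D : Cn R n -> R[i]) (g : Cn R n -> R).

(** The square times the weight is [g z ^+ 2 * expR (2 * s * p z)]; on the support [p] is bounded
    above by upper semicontinuity, so this is dominated like [g ^+ 2]. *)
Lemma compactly_supported_sqint g M : continuous g ->
  (forall z, M < enorm z -> g z = 0) -> sqint p s (fun z => g z * expR (2 * s * p z)).
Proof.
move=> cg g0.
have me : measurable_fun setT (fun z : BCn R n => expR (2 * s * p z)).
  apply: measurableT_comp => //; apply: measurable_funM; first exact: measurable_cst.
  exact: usc_measurable.
have mg := continuous_borel cg.
have mge : measurable_fun setT (fun z : BCn R n => g z * expR (2 * s * p z)).
  exact: measurable_funM.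
split; first exact: mge.
have [K1 hK1] := usc_bounded M up.
have cg2 : continuous (fun z => g z * g z) by move=> z; exact: (cvgM (cg z) (cg z)).
have g20 z : M < enorm z -> g z * g z = 0 by move=> /g0 ->; rewrite mulr0.
have [K K0 hK] := compact_support_bounded cg2 g20.
have C0 : 0 <= K * expR (2 * s * K1) by rewrite mulr_ge0// expR_ge0.
apply: (@le_lt_trans _ _ (\int[mu]_z ((K * expR (2 * s * K1))%:E * (expR (- (1 * norm1 z)))%:E))%E).
  apply: ge0_le_integral => //.
  - by move=> z _; rewrite lee_fin mulr_ge0 ?sqr_ge0 ?weight_ge0.
  - apply/measurable_EFinP; apply: measurable_funM; last exact: weight_measurable.
    exact: measurable_funX.
  - by apply: measurable_funeM; exact: measurable_expRN1.
  move=> z _; rewrite -EFinM lee_fin exprMn /weight.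
  have -> : g z ^+ 2 * expR (2 * s * p z) ^+ 2 * expR (- (2 * s * p z)) =
      (g z * g z) * expR (2 * s * p z).
    by rewrite !expr2 -!mulrA -expRD subrr expR0 mulr1.
  have [zM|Mz] := leP (enorm z) M; last first.
    by rewrite g20// mul0r mulr_ge0// expR_ge0.
  rewrite [leRHS]mulrAC; apply: ler_pM; rewrite ?expR_ge0 -?expr2 ?sqr_ge0//.
    by apply: le_trans _ (hK z); rewrite -expr2 ler_norm.
  rewrite ler_expR; apply: ler_wpM2l; first by rewrite mulr_ge0// ltW.
  by apply: hK1 => i j; exact: le_trans (coord_le_enorm _ _ _) zM.
have E0 : forall z : BCn R n, setT z -> (0 <= (expR (- (1 * norm1 z)))%:E :> \bar R)%E.
  by move=> z _; rewrite lee_fin expR_ge0.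
rewrite (ge0_integralZl mu measurableT (measurable_expRN1 1) E0); last by rewrite lee_fin.
by rewrite lte_mul_pinfty ?lee_fin// integral_Cn_expRN_lty.
Qed.

(** conj(D) divided by the weight: the Riesz representative, in the weighted space, of integration
    against [D]. *)
Definition conj_over_weight D : Cn R n -> Rcomplex R :=
  fun z => Complex (reF D z * expR (2 * s * p z)) (- (imF D z * expR (2 * s * p z))).

Lemma conj_over_weight_inL2 D : compactly_supported D -> inL2 p s (conj_over_weight D).
Proof.
move=> [cr ci [M D0]]; apply/(inL2P s up); split.
  apply: (@compactly_supported_sqint _ M cr) => z /D0; by rewrite /reF => ->.
have sq : sqint p s (fun z => imF D z * expR (2 * s * p z)).
  by apply: (@compactly_supported_sqint _ M ci) => z /D0; rewrite /imF => ->.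
have := sqint_lin up (-1) sq (sqint0 p s).
by congr sqint; apply/funext => z; rewrite mulN1r addr0.
Qed.

Lemma inner_conj_over_weight u D :
  inner p s u (conj_over_weight D) = cintegral_Cn (fun z => u z * D z).
Proof.
congr cintegral_Cn; apply/funext => z; rewrite /conj_over_weight /reF /imF /weight -mulrA.
congr (_ * _); case: (D z) => a b; apply/eqP; rewrite eq_complex /= !(mulr0, subr0, add0r) opprK.
by rewrite -!mulrA -expRD subrr expR0 !mulr1 !eqxx.
Qed.

Lemma inL2_cintegrable u D : inL2 p s u -> compactly_supported D ->
  cintegrable (fun z => u z * D z).
Proof.
move=> Lu cD; have /(inL2P s up)[ur ui] := Lu.
have [cr ci [M D0]] := cD.
have sr : sqint p s (fun z => reF D z * expR (2 * s * p z)).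
  by apply: (@compactly_supported_sqint _ M cr) => z /D0; rewrite /reF => ->.
have si : sqint p s (fun z => imF D z * expR (2 * s * p z)).
  by apply: (@compactly_supported_sqint _ M ci) => z /D0; rewrite /imF => ->.
have I (a b : Cn R n -> R) : sqint p s a -> sqint p s (fun z => b z * expR (2 * s * p z)) ->
    mu.-integrable setT (EFin \o ((fun z => a z * b z) : BCn R n -> R)).
  move=> sa sb; have := wdot_integrable up sa sb; apply: eq_integrable => // z _ /=.
  by rewrite /weight -!mulrA -expRD subrr expR0 mulr1.
have Er : reF (fun z => u z * D z) = (fun z => reF u z * reF D z - imF u z * imF D z).
  by apply/funext => z; rewrite /reF /imF; case: (u z); case: (D z).
have Ei : imF (fun z => u z * D z) = (fun z => reF u z * imF D z + imF u z * reF D z).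
  by apply/funext => z; rewrite /reF /imF; case: (u z); case: (D z).
split; rewrite ?Er ?Ei.
  have := integrableB measurableT (I _ _ ur sr) (I _ _ ui si); apply: eq_integrable => //.
exact: (integrableD measurableT (I _ _ ur si) (I _ _ ui sr)).
Qed.

Definition dbar_primitive (f : form01 R n) : Cn R n -> Rcomplex R :=
  fun z => \sum_(l < n) (conjc (zcoord z l) * f l z).

(** The product rule moves conj(z_l) onto the test function: [conj(z_l) * f_l * dzbar phi j] is
    [f_l * dzbar (conj_mul l phi) j], minus [f_j * phi] when [l = j]. The first term has integral 0
    because [f_l] is entire, so the primitive is never differentiated. *)
Lemma dbar_weak_primitive (f : form01 R n) : inA2form p s f -> dbar_weak (dbar_primitive f) f.
Proof.
move=> Af j phi tphi.
have cl l := compactly_supported_dzbar j (test_function_conj_mul l tphi).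
have -> : (fun z => dbar_primitive f z * dzbar phi j z) =
    (fun z => \sum_(l < n) (f l z * dzbar (conj_mul l phi) j z) + - (f j z * phi z)).
  apply/funext => z; rewrite /dbar_primitive mulr_suml.
  have -> : f j z * phi z = \sum_(l < n) f l z * ((l == j)%:R * phi z).
    rewrite (bigD1 j)//= eqxx mul1r big1 ?addr0// => l /negbTE ->.
    by rewrite mul0r mulr0.
  rewrite -sumrB; apply: eq_bigr => l _.
  by rewrite dzbar_conj_mul// mulrDr addrK mulrA (mulrC (f l z)).
have I l : cintegrable (fun z => f l z * dzbar (conj_mul l phi) j z).
  by apply: inL2_cintegrable (cl l); have [] := Af l.
have [c1 e1] := cintegrable_sum (index_enum 'I_n) I.
have [c2 e2] : cintegrable (fun z => - (f j z * phi z)) /\ cintegral_Cn (fun z => - (f j z * phi z)) =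
    - cintegral_Cn (fun z => f j z * phi z).
  apply: cintegrableN; apply: inL2_cintegrable (compactly_supported_test tphi).
  by have [] := Af j.
have [_ ->] := cintegrableD c1 c2.
rewrite e1 e2 big1 ?add0r// => l _.
by apply: entire_dbar0; [have [] := Af l|exact: test_function_conj_mul].
Qed.

(* The canonical solution is the primitive minus its orthogonal projection on
   the entire functions, which need not be known to be entire: being a weak
   limit of entire functions it is weakly annihilated by [dbar]. *)
Lemma canonical_solution u (f : form01 R n) : inL2 p s u -> dbar_weak u f ->
  exists v, [/\ inL2 p s v, dbar_weak v f, forall h, inA2 p s h -> inner p s v h = 0 &
    (normsq p s v <= normsq p s u)%E].
Proof.
move=> Lu uf.
have sL := inL2_submodule s up; have iB := rdot_semi_inner s up.
have [P [LP orth le_u dorth]] := orthogonal_projection sL iB (inA2_submodule s up)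
  (fun h (Ah : inA2 p s h) => Ah.2) (inA2_complete up s0) Lu.
have LuP := submodule_sub sL Lu LP.
exists (u - P : Cn R n -> Rcomplex R); split => //.
- move=> j phi tphi; have cD := compactly_supported_dzbar j tphi.
  have Lpsi := conj_over_weight_inL2 cD; have LIpsi := inL2_mulI up Lpsi.
  have [h1 h2] : rdot p s P (conj_over_weight (dzbar phi j)) = 0 /\
      rdot p s P (mulI (conj_over_weight (dzbar phi j))) = 0.
    (* The representative of [dzbar phi j], and i times it, are orthogonal to all of A^2; by double
       orthogonality they are orthogonal to [P], so [u - P] and [u] have the same weak dbar. *)
    have H h : inA2 p s h -> rdot p s h (conj_over_weight (dzbar phi j)) = 0 /\
        rdot p s h (mulI (conj_over_weight (dzbar phi j))) = 0.
      move=> [eh Lh]; have := entire_dbar0 j eh tphi.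
      by rewrite -inner_conj_over_weight innerE// => -[].
    by split; apply: dorth => // h /H[].
  rewrite -(uf j phi tphi) -!inner_conj_over_weight !innerE//.
  by rewrite !(semi_innerBl iB)// h1 h2 !subr0.
- move=> h Ah; have Lh := Ah.2; rewrite innerE// orth// orth//.
  exact: inA2_mulI.
- by rewrite !normsqE// lee_fin.
Qed.

End dbar_solution.

(** * Decay of the weight and the Hilbert-Schmidt bound *)

Section decay.
Variables (R : realType) (n : nat) (p : Cn R n -> R).
Hypothesis up : upper_semicontinuous p.
Hypothesis conjugate_finite :
  forall w : Cn R n, exists M : R, forall z : Cn R n, re_inner z w - p z <= M.
Hypothesis ptilde_asymp : forall eps : R, 0 < eps ->
  exists M : R, forall z : Cn R n, M < enorm z -> `|ptilde p z / p z - 1| < eps.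

(* Only the [w] with entries [+-1] are needed: [norm1 z] is the maximum of
   [re_inner z w] over them. *)
Lemma norm1_lower_bound : exists M : R, forall z, norm1 z - M <= p z.
Proof.
pose w (e : {ffun 'I_2 * 'I_n -> bool}) : Cn R n := \matrix_(i, j) (-1) ^+ e (i, j).
have /choice[M hM] : forall e, exists M : R, forall z : Cn R n, re_inner z (w e) - p z <= M.
  by move=> e; exact: conjugate_finite.
exists (\sum_e `|M e|) => z.
pose e : {ffun 'I_2 * 'I_n -> bool} := [ffun ij => z ij.1 ij.2 < 0].
have <- : re_inner z (w e) = norm1 z.
  apply: eq_bigr => j _; rewrite !mxE !ffunE /=.
  have N (x : R) : x * (-1) ^+ (x < 0)%R = `|x|.
    by have [x0|x0] := ltP x 0; rewrite ?expr1 ?mulrN1 ?mulr1 ?expr0 ?mulr1//; [rewrite ltr0_norm|rewrite ger0_norm].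
  by rewrite !N.
rewrite lerBlDr -lerBlDl; apply: le_trans (hM e z) _.
apply: le_trans (ler_norm _) _; rewrite (bigD1 e)//= lerDl.
by apply: sumr_ge0.
Qed.

Lemma enorm_le_norm1 (z : Cn R n) : enorm z <= norm1 z.
Proof.
rewrite -[leRHS]ger0_norm ?norm1_ge0// -sqrtr_sqr ler_wsqrtr//.
rewrite big_ord_recl big_ord1 -big_split /= expr2 {1}/norm1 mulr_suml.
apply: ler_sum => j _.
apply: (@le_trans _ _ ((`|z ord0 j| + `|z ord_max j|) * (`|z ord0 j| + `|z ord_max j|))).
  rewrite (_ : lift ord0 ord0 = ord_max); last exact: ord_inj.
  rewrite -[z ord0 j ^+ 2]real_normK ?num_real// -[z ord_max j ^+ 2]real_normK ?num_real//.
  move: `|z ord0 j| `|z ord_max j| (normr_ge0 (z ord0 j)) (normr_ge0 (z ord_max j)) => x y x0 y0.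
  have := mulr_ge0 x0 y0; rewrite !expr2 => ?; nra.
apply: ler_wpM2l; first by rewrite addr_ge0.
rewrite /norm1 (bigD1 j)//= lerDl.
by apply: sumr_ge0 => k _; rewrite addr_ge0.
Qed.

(** The inequality [y <= expR y] at [y = k * x / 2], squared. *)
Lemma sqr_le_expR (k x : R) : 0 < k -> 0 <= x -> x ^+ 2 <= 4 / k ^+ 2 * expR (k * x).
Proof.
move=> k0 x0.
have h : k * x / 2 <= expR (k * x / 2).
  by apply: le_trans (expR_ge1Dx _); rewrite lerDr.
have -> : expR (k * x) = expR (k * x / 2) ^+ 2 by rewrite expr2 -expRD -splitr.
have -> : x ^+ 2 = 4 / k ^+ 2 * (k * x / 2) ^+ 2 by field; rewrite gt_eqF.
apply: ler_wpM2l; first by rewrite divr_ge0// exprn_ge0// ltW.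
by rewrite lerXn2r ?nnegrE ?expR_ge0// divr_ge0// mulr_ge0// ltW.
Qed.

Lemma ptilde_le (z : Cn R n) (N K : R) : (forall w : Cn R n, (forall i j, `|w i j| <= N) -> p w <= K) ->
  enorm z + 1 <= N -> ptilde p z <= K.
Proof.
move=> hK zN; apply: ge_sup.
  exists (p (z + 0)); exists 0 => //=; rewrite /enorm big1 ?sqrtr0// => i _.
  by rewrite big1// => j _; rewrite mxE expr0n.
move=> _ [zeta /= z1 <-]; apply: hK => i j; rewrite mxE.
apply: le_trans zN; apply: le_trans (ler_normD _ _) _.
by rewrite lerD// ?coord_le_enorm// (le_trans (coord_le_enorm _ _ _) z1).
Qed.

Lemma weight_decay (s : R) : 0 < s -> exists C : R, forall z,
  s * ptilde p z - 2 * s * p z <= C - s / 2 * norm1 z.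
Proof.
move=> s0; have [M0 hM0] := norm1_lower_bound.
(* With 1/2 as tolerance, [ptilde p] is at most [3 / 2 * p] far out; then [s * ptilde p - 2 * s * p]
   is at most [- (s / 2) * p], which fixes the slope in the conclusion. *)
have [|M1 hM1] := ptilde_asymp (eps := 2^-1); first by rewrite invr_gt0.
pose N := Num.max M0 M1.
have [K hK] := usc_bounded (N + 1) up.
exists (s * `|K| + 2 * s * `|M0|) => z.
have N0 := norm1_ge0 z; have pM := hM0 z.
have sK : 0 <= s * `|K| by rewrite mulr_ge0// ltW.
have M0n : M0 <= `|M0| by exact: ler_norm.
have [zN|Nz] := leP (enorm z) N.
  have pK : ptilde p z <= `|K|.
    by apply: le_trans _ (ler_norm K); apply: (@ptilde_le z _ _ hK); rewrite lerD2r.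
  have H1 : s * ptilde p z <= s * `|K| by rewrite ler_pM2l.
  have H2 : s * (norm1 z - `|M0|) <= s * p z by rewrite ler_pM2l//; lra.
  have H3 : 0 <= s * norm1 z by rewrite mulr_ge0// ltW.
  lra.
have zM0 : M0 < enorm z by apply: le_lt_trans Nz; rewrite le_max lexx.
have zM1 : M1 < enorm z by apply: le_lt_trans Nz; rewrite le_max lexx orbT.
(* The quotient in the asymptotic hypothesis can be cleared only for positive [p z]; beyond radius
   [M0] the linear lower bound ensures this. *)
have p0 : 0 < p z.
  by apply: lt_le_trans pM; rewrite subr_gt0 (lt_le_trans zM0)// enorm_le_norm1.
have := hM1 _ zM1; rewrite ltr_norml => /andP[_]; rewrite ltrBlDr ltr_pdivrMr// => ptp.
have H1 : s * ptilde p z <= s * ((2^-1 + 1) * p z) by rewrite ler_pM2l// ltW.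
have H2 : s * (norm1 z - `|M0|) <= s * p z by rewrite ler_pM2l//; lra.
have H3 : 0 <= s * `|M0| by rewrite mulr_ge0// ltW.
have H4 : 0 <= s * norm1 z by rewrite mulr_ge0// ltW.
lra.
Qed.

Lemma mul_bounds (A B D F G H X E : R) : 0 <= A -> 0 <= X -> 0 <= E ->
  X <= B * G -> E <= D * H -> G * H = F -> X * (A * E) <= A * (B * D) * F.
Proof.
move=> A0 X0 E0 XB ED <-.
have -> : A * (B * D) * (G * H) = A * ((B * G) * (D * H)) by ring.
by rewrite mulrCA; apply: ler_wpM2l => //; exact: ler_pM.
Qed.

(** Of the decay rate [s / 2] from [weight_decay], one half absorbs [norm1 z ^+ 2] and the other
    half is the remaining rate [k = s / 4]. *)
Lemma norm1_point_bound_decay (s : R) : 0 < s -> exists2 k, 0 < k & exists2 C, 0 <= C &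
  forall z, norm1 z ^+ 2 * (point_bound p (s / 2) z * weight p s z) <= C * expR (- (k * norm1 z)).
Proof.
move=> s0; have [C hC] := weight_decay s0.
have k0 : 0 < s / 4 by rewrite divr_gt0.
pose A := (8 / box_radius R n ^+ 2) ^+ n.
have A0 : 0 <= A by rewrite exprn_ge0// divr_ge0// exprn_ge0// ltW// box_radius_gt0.
exists (s / 4) => //; exists (A * (4 / (s / 4) ^+ 2 * expR C)).
  by rewrite !mulr_ge0// ?expR_ge0// invr_ge0 exprn_ge0// ltW.
move=> z; have := sqr_le_expR k0 (norm1_ge0 z); set N := norm1 z => hN.
have hE : expR (2 * (s / 2) * ptilde p z - 2 * s * p z) <= expR C * expR (- (s / 2 * N)).
  by rewrite -expRD ler_expR mulrCA divff// mulr1; exact: hC.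
rewrite /point_bound /weight -/A -(mulrA A) -expRD.
apply: (mul_bounds A0 (sqr_ge0 _) (expR_ge0 _) hN hE).
by rewrite -expRD; congr expR; field.
Qed.

End decay.

(** * Bessel's inequality for bounded functionals *)

Section bessel.
Variables (R : realType) (V : lmodType R) (L : V -> Prop) (B : V -> V -> R).
Hypotheses (sL : submodule_pred L) (iB : semi_inner L B).
Variables (I : eqType) (e : I -> V).
Hypotheses (Le : forall i, L (e i)) (orth : forall i k, B (e i) (e k) = (i == k)%:R).

Lemma submodule_comb (r : seq I) (a : I -> R) : L (\sum_(i <- r) a i *: e i).
Proof.
elim: r => [|i r IH]; first by rewrite big_nil; case: sL.
by rewrite big_cons; apply: sL.2.
Qed.

Lemma semi_inner_comb (r : seq I) (a : I -> R) (k : I) : k \notin r ->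
  B (\sum_(i <- r) a i *: e i) (e k) = 0.
Proof.
elim: r => [_|i r IH].
  (* Linearity at [1 *: 0 + 0] shows that the product with 0 vanishes. *)
  rewrite big_nil; have := semi_inner_linl iB 1 (sL.1) (sL.1) (Le k).
  by rewrite scale1r addr0 mul1r => /eqP; rewrite -subr_eq subrr => /eqP <-.
rewrite inE negb_or => /andP[ki kr]; rewrite big_cons (semi_inner_linl iB)// ?IH//.
  by rewrite orth eq_sym (negbTE ki) mulr0 addr0.
exact: submodule_comb.
Qed.

Lemma semi_inner_comb_sqr (r : seq I) (a : I -> R) : uniq r ->
  B (\sum_(i <- r) a i *: e i) (\sum_(i <- r) a i *: e i) = \sum_(i <- r) a i ^+ 2.
Proof.
elim: r => [_|i r IH].
  rewrite !big_nil; have := semi_inner_linl iB 1 (sL.1) (sL.1) (sL.1).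
  by rewrite scale1r addr0 mul1r => /eqP; rewrite -subr_eq subrr => /eqP <-.
rewrite cons_uniq => /andP[ir ur]; have Lr := submodule_comb r a.
rewrite !big_cons (semi_inner_sqr sL iB)// IH// orth eqxx mulr1.
by rewrite (semi_innerC iB (Le i) Lr) semi_inner_comb// mulr0 addr0.
Qed.

Variables (ev : V -> R) (c : R).
Hypotheses (ev_lin : forall a u v, ev (a *: u + v) = a * ev u + ev v)
  (ev_le : forall u, L u -> ev u ^+ 2 <= c * B u u) (c0 : 0 <= c).

(* Test the bound on the combination [\sum ev (e i) *: e i]. *)
Lemma bessel_eval (r : seq I) : uniq r -> \sum_(i <- r) ev (e i) ^+ 2 <= c.
Proof.
move=> ur; set t := \sum_(i <- r) _.
have ev0 : ev 0 = 0.
  have := ev_lin 1 0 0; rewrite scale1r addr0 mul1r => /eqP.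
  by rewrite -subr_eq subrr => /eqP <-.
have evc (q : seq I) : ev (\sum_(i <- q) ev (e i) *: e i) = \sum_(i <- q) ev (e i) ^+ 2.
  by elim: q => [|i q IH]; rewrite ?big_nil// !big_cons ev_lin IH.
have := ev_le (submodule_comb r (fun i => ev (e i))).
rewrite evc semi_inner_comb_sqr// -/t expr2.
have : 0 <= t by apply: sumr_ge0 => i _; exact: sqr_ge0.
by rewrite le_eqVlt => /predU1P[<-//|t0]; rewrite ler_pM2r.
Qed.

End bessel.

(** * Summed norms of the primitives *)

Section primitive_bound.
Variables (R : realType) (n : nat) (p : Cn R n -> R) (t s : R).
Hypothesis up : upper_semicontinuous p.
Local Notation mu := (@lebesgue_Cn R n).

Lemma abs2D (a b : R[i]) : abs2 (a + b) <= 2 * (abs2 a + abs2 b).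
Proof.
case: a b => a1 a2 [b1 b2]; rewrite /abs2 /= -subr_ge0.
rewrite (_ : _ - _ = (a1 - b1) ^+ 2 + (a2 - b2) ^+ 2); last by ring.
by rewrite addr_ge0// sqr_ge0.
Qed.

Lemma abs2M (a b : R[i]) : abs2 (a * b) = abs2 a * abs2 b.
Proof. by case: a b => a1 a2 [b1 b2]; rewrite /abs2 /=; ring. Qed.

(** Iterates |a + b|^2 <= 2(|a|^2 + |b|^2); the crude constant is harmless, since it will only
    depend on [n]. *)
Lemma abs2_sum (I : Type) (r : seq I) (a : I -> R[i]) :
  abs2 (\sum_(i <- r) a i) <= 2 ^+ size r * \sum_(i <- r) abs2 (a i).
Proof.
elim: r => [|i r IH]; first by rewrite !big_nil /abs2 /= expr0n addr0 mulr0.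
rewrite !big_cons /=; apply: le_trans (abs2D _ _) _; rewrite exprS -mulrA ler_wpM2l//.
rewrite mulrDr lerD//; rewrite ler_peMl ?abs2_ge0// exprn_ege1//.
by rewrite ler1n.
Qed.

Lemma abs2_conj_zcoord_le (z : Cn R n) l : abs2 (conjc (zcoord z l)) <= norm1 z ^+ 2.
Proof.
apply: (@le_trans _ _ (enorm z ^+ 2)); last first.
  by rewrite lerXn2r ?nnegrE ?norm1_ge0 ?sqrtr_ge0// enorm_le_norm1.
rewrite /enorm sqr_sqrtr; last by apply: sumr_ge0 => i _; apply: sumr_ge0 => j _; exact: sqr_ge0.
rewrite big_ord_recl big_ord1 -big_split /= (bigD1 l)//= /abs2 /= sqrrN.
rewrite (_ : lift ord0 ord0 = ord_max); last exact: ord_inj.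
by rewrite lerDl; apply: sumr_ge0 => i _; rewrite addr_ge0// sqr_ge0.
Qed.

Lemma abs2_dbar_primitive_le (f : form01 R n) z :
  abs2 (dbar_primitive f z) <= 2 ^+ n * (norm1 z ^+ 2 * \sum_(l < n) abs2 (f l z)).
Proof.
apply: le_trans (abs2_sum _ _) _; have -> : size (index_enum 'I_n) = n by rewrite -sum1_size sum_nat_const card_ord muln1.
apply: ler_wpM2l.
  exact: exprn_ge0.
rewrite mulr_sumr; apply: ler_sum => l _; rewrite abs2M.
by apply: ler_wpM2r; [exact: abs2_ge0|exact: abs2_conj_zcoord_le].
Qed.

Lemma dbar_primitive_measurable (f : form01 R n) : (forall l, entire (f l)) ->
  measurable_fun setT (reF (dbar_primitive f) : BCn R n -> R) /\
  measurable_fun setT (imF (dbar_primitive f) : BCn R n -> R).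
Proof.
move=> ef.
have mx i l : measurable_fun setT (fun z : BCn R n => z i l).
  by apply: continuous_borel; exact: coord_continuous.
have mr l : measurable_fun setT (reF (f l) : BCn R n -> R).
  by apply: continuous_borel; have [] := entire_continuous (ef l).
have mi l : measurable_fun setT (imF (f l) : BCn R n -> R).
  by apply: continuous_borel; have [] := entire_continuous (ef l).
have Er : reF (dbar_primitive f) =
    (fun z => \sum_(l < n) (z ord0 l * reF (f l) z + z ord_max l * imF (f l) z)).
  apply/funext => z; rewrite /reF /imF /dbar_primitive.
  rewrite (big_morph (@complex.Re R) (id1 := 0) (op1 := +%R))//; last by move=> [? ?] [? ?].
  by apply: eq_bigr => l _; rewrite /zcoord; case: (f l z) => a b /=; rewrite mulNr opprK.
have Ei : imF (dbar_primitive f) =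
    (fun z => \sum_(l < n) (z ord0 l * imF (f l) z + - (z ord_max l * reF (f l) z))).
  apply/funext => z; rewrite /reF /imF /dbar_primitive.
  rewrite (big_morph (@complex.Im R) (id1 := 0) (op1 := +%R))//; last by move=> [? ?] [? ?].
  by apply: eq_bigr => l _; rewrite /zcoord; case: (f l z) => a b /=; rewrite mulNr.
rewrite Er Ei; split; apply: measurable_sum => l.
  by apply: measurable_funD; exact: measurable_funM.
by apply: measurable_funD; [exact: measurable_funM|apply: measurableT_comp => //; exact: measurable_funM].
Qed.

Variables (k C : R).
Hypothesis C0 : 0 <= C.
Hypothesis decay : forall z, norm1 z ^+ 2 * (point_bound p t z * weight p s z) <= C * expR (- (k * norm1 z)).

(** The sum is taken under the integral, where the hypothesis bounds it uniformly over families. It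
    serves twice: for finite orthonormal families with [c = 2], and for one form, with its squared
    norm as [c], to place the primitive in the weighted space. *)
Lemma dbar_primitive_normsq_sum (I : Type) (r : seq I) (e : I -> form01 R n) (c : R) :
  0 <= c -> (forall i l, entire (e i l)) ->
  (forall l z, \sum_(i <- r) abs2 (e i l z) <= c * point_bound p t z) ->
  (\sum_(i <- r) normsq p s (dbar_primitive (e i)) <=
    (2 ^+ n * (c *+ n * C))%:E * \int[mu]_z (expR (- (k * norm1 z)))%:E)%E.
Proof.
move=> c0 ee hc; have mW := weight_measurable s up.
pose F i : BCn R n -> \bar R := fun z => (abs2 (dbar_primitive (e i) z) * weight p s z)%:E.
have F0 i z : (0 <= F i z)%E by rewrite lee_fin mulr_ge0 ?abs2_ge0 ?weight_ge0.
have mF i : measurable_fun setT (F i).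
  have [mr mi] := dbar_primitive_measurable (ee i).
  apply/measurable_EFinP; apply: measurable_funM mW.
  by apply: measurable_funD; exact: measurable_funX.
have -> : (\sum_(i <- r) normsq p s (dbar_primitive (e i)) = \sum_(i <- r) \int[mu]_z F i z)%E.
  by apply: eq_bigr => i _; rewrite /normsq (integral_CnE (mF i) (F0 i)).
rewrite -ge0_integral_sum//.
have K0 : 0 <= 2 ^+ n * (c *+ n * C) by rewrite mulr_ge0 ?exprn_ge0// mulr_ge0// mulrn_wge0.
rewrite -(ge0_integralZl mu measurableT (measurable_expRN1 k)
  (fun (z : BCn R n) _ => expR_ge0 _ : (0 <= (expR (- (k * norm1 z)))%:E)%E)); last by rewrite lee_fin.
apply: ge0_le_integral => //.
- by move=> z _; apply: sume_ge0.
- by apply: emeasurable_sum.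
- by apply: measurable_funeM; exact: measurable_expRN1.
move=> z _; rewrite /F -EFinM sumEFin lee_fin -mulr_suml.
apply: (@le_trans _ _ (2 ^+ n * (norm1 z ^+ 2 * (c *+ n * point_bound p t z)) * weight p s z)).
  apply: ler_wpM2r; first exact: weight_ge0.
  apply: (@le_trans _ _ (\sum_(i <- r) 2 ^+ n * (norm1 z ^+ 2 * \sum_(l < n) abs2 (e i l z)))).
    by apply: ler_sum => i _; exact: abs2_dbar_primitive_le.
  rewrite -!mulr_sumr; apply: ler_wpM2l; first exact: exprn_ge0.
  apply: ler_wpM2l; first exact: sqr_ge0.
  rewrite exchange_big /=; apply: (@le_trans _ _ (\sum_(l < n) c * point_bound p t z)).
    by apply: ler_sum.
  by rewrite sumr_const card_ord mulrnAl.
have E1 (a b d q w : R) : a * (b * (d * q)) * w = a * d * (b * (q * w)) by ring.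
rewrite E1 (mulrA (2 ^+ n)) -(mulrA (2 ^+ n * (c *+ n))); apply: ler_wpM2l; last exact: decay.
by rewrite mulr_ge0// ?exprn_ge0// mulrn_wge0.
Qed.

End primitive_bound.

(** * Orthonormal sets of forms *)

Section forms.
Variables (R : realType) (n : nat) (p : Cn R n -> R) (t : R).
Hypotheses (up : upper_semicontinuous p) (t0 : 0 < t).
Implicit Types (u v : Cn R n -> Rcomplex R) (f g : 'I_n -> Cn R n -> Rcomplex R).

Definition rform f g : R := \sum_(j < n) rdot p t (f j) (g j).

Definition mulI_form f : 'I_n -> Cn R n -> Rcomplex R := fun j => mulI (f j).

Lemma inA2form_submodule :
  submodule_pred (inA2form p t : ('I_n -> Cn R n -> Rcomplex R) -> Prop).
Proof.
have [A0 Alin] := inA2_submodule t up.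
by split=> [j|a f g Af Ag j]; [exact: A0|exact: Alin].
Qed.

Lemma rform_semi_inner :
  semi_inner (inA2form p t : ('I_n -> Cn R n -> Rcomplex R) -> Prop) rform.
Proof.
have iB := rdot_semi_inner t up; have L2 f j : inA2form p t f -> inL2 p t (f j).
  by move=> Af; have [] := Af j.
split=> [f g Af Ag|a f g h Af Ag Ah|f Af].
- by apply: eq_bigr => j _; apply: (semi_innerC iB); exact: L2.
- rewrite /rform mulr_sumr -big_split; apply: eq_bigr => j _.
  by apply: (semi_inner_linl iB); exact: L2.
- by apply: sumr_ge0 => j _; have [_ _] := iB; apply; exact: L2.
Qed.

Lemma inA2form_mulI f : inA2form p t f -> inA2form p t (mulI_form f).
Proof. by move=> Af j; exact: inA2_mulI. Qed.

Lemma inner_formE f g : inA2form p t f -> inA2form p t g ->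
  inner_form p t f g = Complex (rform f g) (rform f (mulI_form g)).
Proof.
move=> Af Ag; rewrite /inner_form.
rewrite (eq_bigr (fun j => Complex (rdot p t (f j) (g j)) (rdot p t (f j) (mulI (g j))))); last first.
  by move=> j _; rewrite innerE//; [have [] := Af j|have [] := Ag j].
rewrite /rform /mulI_form; elim/big_rec3: _ => // j x y w _ ->.
by [].
Qed.

Lemma wdotNl (a b : Cn R n -> R) : sqint p t a -> sqint p t b ->
  wdot p t (fun z => - a z) b = - wdot p t a b.
Proof.
move=> sa sb; rewrite -mulN1r /wdot -RintegralZl//; last exact: wdot_integrable.
by apply: eq_Rintegral => z _; rewrite mulN1r !mulNr.
Qed.

Lemma rdot_mulI u v : inL2 p t u -> inL2 p t v ->
  rdot p t (mulI u) v = - rdot p t u (mulI v).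
Proof.
move=> /(inL2P t up)[ur ui] /(inL2P t up)[vr vi]; rewrite /rdot.
rewrite [wdot p t (reF (mulI u)) _]wdotNl// (wdotC p t (reF u) (reF (mulI v))).
by rewrite [wdot p t (reF (mulI v)) _]wdotNl// (wdotC p t (imF v)) opprD opprK addrC.
Qed.

Lemma rform_mulI f g : inA2form p t f -> inA2form p t g ->
  rform (mulI_form f) g = - rform f (mulI_form g).
Proof.
move=> Af Ag; rewrite /rform -sumrN; apply: eq_bigr => j _.
by apply: rdot_mulI; [have [] := Af j|have [] := Ag j].
Qed.

(** Multiplication by i is skew, so this value equals its own negative; it is the imaginary part of
    [inner_form p t f f], which is thus real. *)
Lemma rform_mulI_self f : inA2form p t f -> rform f (mulI_form f) = 0.
Proof.
move=> Af; have Aif := inA2form_mulI Af.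
have := rform_mulI Af Af; rewrite (semi_innerC rform_semi_inner Aif Af) => /eqP.
by rewrite -addr_eq0 -mulr2n mulrn_eq0 => /eqP.
Qed.

Lemma inner_form0C f g : inA2form p t f -> inA2form p t g ->
  inner_form p t f g = 0 -> inner_form p t g f = 0.
Proof.
move=> Af Ag; have Aif := inA2form_mulI Af; have Aig := inA2form_mulI Ag.
rewrite !inner_formE// => -[h1 h2].
rewrite (semi_innerC rform_semi_inner Ag Af) h1.
by rewrite (semi_innerC rform_semi_inner Ag Aif) rform_mulI// h2 oppr0.
Qed.

Lemma point_bound_ge0 z : 0 <= point_bound p t z.
Proof.
by rewrite mulr_ge0 ?expR_ge0// exprn_ge0// divr_ge0// exprn_ge0// ltW// box_radius_gt0.
Qed.

Lemma abs2_form_le f j z : inA2form p t f -> abs2 (f j z) <= point_bound p t z * rform f f.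
Proof.
move=> Af; apply: le_trans (A2_point_bound up t0 z (Af j)) _.
apply: ler_wpM2l; first exact: point_bound_ge0.
rewrite /rform (bigD1 j)//= lerDl; apply: sumr_ge0 => k _.
by have [_ _] := rdot_semi_inner t up; apply; have [] := Af k.
Qed.

(** Bessel is applied to the two real functionals that take the real and the imaginary part of [f j]
    at [z], each bounded by [point_bound]; hence the factor 2. *)
Lemma orthonormal_eval_le (I : eqType) (r : seq I) (e : I -> form01 R n) j z :
  uniq r -> (forall i, inA2form p t (e i)) ->
  (forall i k, inner_form p t (e i) (e k) = (if i == k then 1 else 0)) ->
  \sum_(i <- r) abs2 (e i j z) <= 2 * point_bound p t z.
Proof.
move=> ur Ae orth.
have orthR i k : rform (e i) (e k) = (i == k)%:R.
  by have := orth i k; rewrite inner_formE//; case: (i == k) => -[].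
rewrite (eq_bigr (fun i => reF (e i j) z ^+ 2 + imF (e i j) z ^+ 2))//.
rewrite big_split/= mulrDl mul1r; apply: lerD.
  apply: (bessel_eval inA2form_submodule rform_semi_inner Ae orthR
    (ev := fun f => reF (f j) z)) => //.
  - by move=> a f g; rewrite -[RHS]/((fun z => a * reF (f j) z + reF (g j) z) z) -reF_lin.
  - by move=> f Af; apply: le_trans (abs2_form_le j z Af); rewrite abs2_re_im lerDl sqr_ge0.
  - exact: point_bound_ge0.
apply: (bessel_eval inA2form_submodule rform_semi_inner Ae orthR
  (ev := fun f => imF (f j) z)) => //.
- by move=> a f g; rewrite -[RHS]/((fun z => a * imF (f j) z + imF (g j) z) z) -imF_lin.
- by move=> f Af; apply: le_trans (abs2_form_le j z Af); rewrite abs2_re_im lerDr sqr_ge0.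
- exact: point_bound_ge0.
Qed.

Definition orthonormal_set (E : set (form01 R n)) : Prop :=
  (forall f, E f -> inA2form p t f /\ inner_form p t f f = 1) /\
  forall f g, E f -> E g -> f <> g -> inner_form p t f g = 0.

(** A maximal orthonormal set exists by Zorn's lemma; a nonzero form orthogonal to it could be
    normalized and added. *)
Lemma orthonormal_basis : exists2 E, orthonormal_set E &
  forall g, inA2form p t g -> (forall f, E f -> inner_form p t g f = 0) ->
    forall j z, g j z = 0.
Proof.
have [F FO tF|E [oE maxE]] := @Zorn_bigcup _ orthonormal_set.
  split=> [f [X FX Xf]|f g [X FX Xf] [Y FY Yg] fg].
    by have [+ _] := FO X FX; apply.
  have [XY|YX] := tF X Y FX FY.
    by have [_] := FO Y FY; apply => //; exact: XY.
  by have [_] := FO X FX; apply => //; exact: YX.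
exists E => // g Ag gE.
have iB := rform_semi_inner; have sA := inA2form_submodule.
have [_ _ Bge0] := iB.
(* Norm 0 gives vanishing at every point, not just almost everywhere, by the pointwise bound. *)
have [g0|g0] := eqVneq (rform g g) 0.
  move=> j z; have := abs2_form_le j z Ag; rewrite g0 mulr0 abs2_re_im => h.
  have : reF (g j) z ^+ 2 + imF (g j) z ^+ 2 == 0.
    by rewrite eq_le h addr_ge0// sqr_ge0.
  rewrite paddr_eq0 ?sqr_ge0// !sqrf_eq0 /reF /imF.
  by case: (g j z) => a b /= /andP[/eqP -> /eqP ->].
have gpos : 0 < rform g g by rewrite lt_neqAle eq_sym g0 Bge0.
pose a := (Num.sqrt (rform g g))^-1.
pose g1 : 'I_n -> Cn R n -> Rcomplex R := a *: (g : 'I_n -> Cn R n -> Rcomplex R).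
have Ag1 : inA2form p t g1 by exact: (submodule_scale sA a Ag).
have lin h : inA2form p t h -> rform g1 h = a * rform g h.
  move=> Ah; have := semi_inner_linl iB a Ag (sA.1) Ah; rewrite addr0 => ->.
  have := semi_inner_linl iB 1 (sA.1) (sA.1) Ah.
  by rewrite scale1r addr0 mul1r => /eqP; rewrite -subr_eq subrr => /eqP <-; rewrite addr0.
have norm1 : inner_form p t g1 g1 = 1.
  rewrite inner_formE// rform_mulI_self// lin// (semi_innerC iB Ag Ag1) lin//.
  by rewrite mulrA -expr2 exprVn sqr_sqrtr ?ltW// mulVf.
have g1E f : E f -> inner_form p t g1 f = 0.
  move=> Ef; have Af := (oE.1 f Ef).1; have := gE f Ef.
  rewrite !inner_formE// !lin//; last exact: inA2form_mulI.
  by move=> [-> ->]; rewrite !mulr0.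
have nE : ~ E g1.
  move=> /g1E; rewrite norm1 => /eqP; exact/negP/oner_neq0.
exfalso; apply: (maxE (E `|` [set g1])).
  split; first by move=> f; left.
  by move=> /(_ g1 (or_intror erefl)).
have [ort1 ort2] := oE.
split=> [f [/ort1//|->]|f h [Ef|->] [Eh|->] fh] //.
- exact: ort2.
- by apply: inner_form0C (g1E _ Ef) => //; exact: (ort1 _ Ef).1.
- exact: g1E.
Qed.

End forms.

(** * The Hilbert-Schmidt conclusion *)

Lemma dbar_primitive_inL2 (R : realType) (n : nat) (p : Cn R n -> R) (t s k C : R)
    (f : form01 R n) : upper_semicontinuous p -> 0 < t -> 0 < k -> 0 <= C ->
  (forall z, norm1 z ^+ 2 * (point_bound p t z * weight p s z) <= C * expR (- (k * norm1 z))) ->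
  inA2form p t f -> inL2 p s (dbar_primitive f).
Proof.
move=> up t0 k0 C0 decay Af.
have ef l : entire (f l) by have [] := Af l.
have [mr mi] := dbar_primitive_measurable ef.
split; first exact/borel_funP; split; first exact/borel_funP.
have [_ _ Bge0] := rform_semi_inner (n := n) t up.
have := @dbar_primitive_normsq_sum _ _ p t s up k C C0 decay unit [:: tt] (fun=> f)
  (rform p t f f) (Bge0 _ Af) (fun=> ef).
rewrite !big_seq1 => H; apply: le_lt_trans (H _) _.
  by move=> l z; rewrite big_seq1 mulrC; exact: abs2_form_le.
rewrite lte_mul_pinfty ?lee_fin ?integral_Cn_expRN_lty//.
by rewrite mulr_ge0 ?exprn_ge0// mulr_ge0// mulrn_wge0// Bge0.
Qed.

Unset Implicit Arguments.

Theorem theorem4p1 (R : realType) (n : nat) (p : Cn R n -> R) :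
  plurisubharmonic p ->
  (* (a) p^*(w) = sup_z (Re <z,w> - p z) < oo for every w *)
  (forall w : Cn R n, exists M : R, forall z : Cn R n, re_inner z w - p z <= M) ->
  (* (b) lim_{|z| -> oo} p~(z) / p(z) = 1 *)
  (forall eps : R, 0 < eps ->
     exists M : R, forall z : Cn R n, M < enorm z -> `|ptilde p z / p z - 1| < eps) ->
  forall sigma : R, 0 < sigma ->
    exists tau : R, 0 < tau < sigma /\
      exists S : form01 R n -> (Cn R n -> R[i]),
        canonical_solution_operator p tau sigma S /\
        hilbert_schmidt p tau sigma S.
Proof.
move=> [up _] conj_fin asymp sigma s0; set t := sigma / 2.
have t0 : 0 < t by rewrite divr_gt0.
exists t; split; first by rewrite t0 ltr_pdivrMr// ltr_pMr// ltr1n.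
have [k k0 [C C0 decay]] := norm1_point_bound_decay up conj_fin asymp s0.
(* A function on all forms is required, so forms outside A^2 receive the default value 0. The norm
   comparison with the primitive is kept along with the choice for the final estimate. *)
have /choice[S hS] : forall f : form01 R n, exists v, inA2form p t f ->
    [/\ inL2 p sigma v, dbar_weak v f, forall h, inA2 p sigma h -> inner p sigma v h = 0 &
      (normsq p sigma v <= normsq p sigma (dbar_primitive f))%E].
  move=> f; have [Af|nAf] := pselect (inA2form p t f); last by exists (fun=> 0).
  have [v hv] := canonical_solution up s0
    (dbar_primitive_inL2 up t0 k0 C0 decay Af) (dbar_weak_primitive up t0 Af).
  by exists v.
exists S; split; first by move=> f /hS[].
have [E [oE1 oE2] completeE] := orthonormal_basis up t0.
(* The orthonormal set is indexed by its own elements; [{classic _}] supplies the choice structure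
   expected of an index type. *)
pose I : choiceType := set_type (E : set {classic (form01 R n)}).
pose e (i : I) : form01 R n := val i.
have eE (i : I) : E (e i) by exact: set_mem (valP i).
have Ae (i : I) : inA2form p t (e i) := (oE1 _ (eE i)).1.
have orth (i k' : I) : inner_form p t (e i) (e k') = (if i == k' then 1 else 0).
  have [->|ik] := eqVneq i k'; first exact: (oE1 _ (eE k')).2.
  by apply: oE2 => // /val_inj ik'; rewrite ik' eqxx in ik.
exists I, e; split => //.
  move=> g Ag ge; apply: completeE => // f Ef.
  exact: (ge (SigSub (mem_set Ef) : I)).
pose J : \bar R := (\int[@lebesgue_Cn R n]_z (expR (- (k * norm1 z)))%:E)%E.
apply: (@le_lt_trans _ _ ((2 ^+ n * (2 *+ n * C))%:E * J)%E); last first.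
  by rewrite lte_mul_pinfty ?lee_fin ?integral_Cn_expRN_lty// !mulr_ge0 ?exprn_ge0 ?mulrn_wge0.
(* The sum over [I] is the supremum of its finite partial sums, so a bound uniform in the finite set
   [A] is enough. *)
apply: ge_ereal_sup => _ [A [finA _] <-]; rewrite fsbig_finite//=.
have ee i l : entire (e i l) by have [] := Ae i l.
have evE l z : \sum_(i <- finmap.enum_fset (fset_set A)) abs2 (e i l z) <= 2 * point_bound p t z.
  by apply: orthonormal_eval_le => //; exact: finmap.fset_uniq.
have := dbar_primitive_normsq_sum up C0 decay (ler0n R 2) ee evE.
by apply: le_trans; apply: lee_sum => i _; have [] := hS _ (Ae i).
Qed.
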